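(* Let $X$ be a compact complex manifold with $\dim_{\mathbb{C}}X=n\geq 3$, and let $L:\mathcal{H}_X\to[0,+\infty)$ be the functional $L(\omega)=\int_X i(\bar\partial\omega)_{prim}\wedge\overline{(\bar\partial\omega)_{prim}}\wedge\omega_{n-3}$. For any Hermitian metric $\omega$ on $X$ and any smooth real $(1,1)$-form $\gamma$ on $X$, we have $$(d_\omega L)(\gamma)=\int_X i(\bar\partial\omega)_{prim}\wedge\overline{(\bar\partial\omega)_{prim}}\wedge\gamma\wedge\omega_{n-4}+2\,\mathrm{Re}\,\langle\langle(\bar\partial\omega)_{prim},\,(\bar\partial\gamma)_{prim}\rangle\rangle_\omega-2\,\mathrm{Re}\,\langle\langle\theta_\omega^{0,1}\wedge\gamma,\,(\bar\partial\omega)_{prim}\rangle\rangle_\omega.$$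
   Context: A Hermitian metric is identified with its smooth positive definite $(1,1)$-form $\omega$; $\mathcal{H}_X$ is the set of all Hermitian metrics on $X$, an open cone in the space of smooth real $(1,1)$-forms. $\omega_k:=\omega^k/k!$, with $\omega_0=1$ and $\omega_{-1}=0$ (so the first integral is absent when $n=3$). $\langle\cdot,\cdot\rangle_\omega$ is the pointwise Hermitian inner product on forms (linear in the first argument), normalised so that $dz_1,\dots,dz_n$ are orthonormal at a point where $\omega=\sum_a i\,dz_a\wedge d\bar z_a$; $dV_\omega=\omega_n$; $\langle\langle u,v\rangle\rangle_\omega=\int_X\langle u,v\rangle_\omega\,dV_\omega$. $\Lambda_\omega$ is the adjoint of $\omega\wedge\cdot$ with respect to $\langle\cdot,\cdot\rangle_\omega$. A $k$-form with $k\le n$ is $\omega$-primitive if it lies in $\ker\Lambda_\omega$. Every $3$-form $\alpha$ has a unique Lefschetz decomposition $\alpha=\alpha_{prim}+\omega\wedge\beta$ with $\alpha_{prim}$ $\omega$-primitive and $\beta$ a $1$-form; $\alpha_{prim}$ is its $\omega$-primitive part, and $(\bar\partial\omega)_{prim}$, $(\bar\partial\gamma)_{prim}$ above are taken with respect to $\omega$. The Lee form $\theta_\omega$ is the real $1$-form with $d\omega=(d\omega)_{prim}+\omega\wedge\theta_\omega$, i.e. $\theta_\omega=\frac{1}{n-1}\Lambda_\omega(d\omega)$, and $\theta_\omega^{0,1}=\frac{1}{n-1}\Lambda_\omega(\bar\partial\omega)$ is its $(0,1)$-component. The differential is $(d_\omega L)(\gamma)=\frac{d}{dt}\big|_{t=0}L(\omega+t\gamma)$.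 *)

(* Defs.v *)
From HB Require Import structures.
From mathcomp Require Import all_boot all_order all_algebra.
From mathcomp Require Import complex.
From mathcomp Require Import all_classical all_reals all_analysis.

Set Implicit Arguments.
Unset Strict Implicit.
Unset Printing Implicit Defensive.

Import Order.TTheory GRing.Theory Num.Theory.
Import numFieldNormedType.Exports.

Local Open Scope classical_set_scope.
Local Open Scope complex_scope.
Local Open Scope ring_scope.

Section ComplexValued.
Context {R : realType}.

Definition Cderivable (V : normedModType R) (f : V -> R[i]) (x v : V) : Prop :=
  derivable (fun y => complex.Re (f y)) x v /\ derivable (fun y => complex.Im (f y)) x v.

Definition Cderive (V : normedModType R) (f : V -> R[i]) (x v : V) : R[i] :=
  ('D_v (fun y => complex.Re (f y)) x) +i* ('D_v (fun y => complex.Im (f y)) x).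

Definition Ccontinuous_at (V : normedModType R) (f : V -> R[i]) (x : V) : Prop :=
  {for x, continuous (fun y => complex.Re (f y))} /\
  {for x, continuous (fun y => complex.Im (f y))}.

(* [Ck k V f]: on the open set [V], all iterated partial derivatives of [f] of
   order at most [k] exist and are continuous. *)
Fixpoint Ck (m k : nat) (V : set 'rV[R]_m) (f : 'rV[R]_m -> R[i]) : Prop :=
  (forall z, V z -> Ccontinuous_at f z) /\
  (if k is k'.+1 then
     forall s : 'I_m,
       (forall z, V z -> Cderivable f z (delta_mx 0 s)) /\
       Ck k' V (fun z => Cderive f z (delta_mx 0 s))
   else True).

Definition smooth_on (m : nat) (V : set 'rV[R]_m) (f : 'rV[R]_m -> R[i]) : Prop :=
  forall k, Ck k V f.

(* Integral over R^m against Lebesgue measure, as an iterated integral.  It is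
   only applied to continuous functions with compact support, for which the
   order of integration is immaterial. *)
Fixpoint integral_Rm (m : nat) : ('rV[R]_m -> R) -> R :=
  if m is m'.+1 then
    fun f => (\int[@lebesgue_measure R]_(t in setT)
                integral_Rm (fun v : 'rV[R]_m' => f (row_mx (t%:M : 'rV[R]_1) v)))%R
  else fun f => f 0.

Definition Cintegral_Rm (m : nat) (f : 'rV[R]_m -> R[i]) : R[i] :=
  integral_Rm (fun z => complex.Re (f z)) +i* integral_Rm (fun z => complex.Im (f z)).

(* C^n is identified with R^(n+n): the point [z] has complex coordinates
   z_a = x_a + i y_a, where x_a, y_a are its entries of index [lshift n a] and
   [rshift n a]. *)
Definition coordC (n : nat) (z : 'rV[R]_(n + n)) (a : 'I_n) : R[i] :=
  z 0 (lshift n a) +i* z 0 (rshift n a).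

Definition d_dz (n : nat) (b : 'I_n) (f : 'rV[R]_(n + n) -> R[i]) z : R[i] :=
  (Cderive f z (delta_mx 0 (lshift n b))
   - 'i * Cderive f z (delta_mx 0 (rshift n b))) / 2.

Definition d_dzbar (n : nat) (b : 'I_n) (f : 'rV[R]_(n + n) -> R[i]) z : R[i] :=
  (Cderive f z (delta_mx 0 (lshift n b))
   + 'i * Cderive f z (delta_mx 0 (rshift n b))) / 2.

Definition holomorphic_on (n : nat) (V : set 'rV[R]_(n + n))
    (f : 'rV[R]_(n + n) -> R[i]) : Prop :=
  smooth_on V f /\ forall z, V z -> forall b, d_dzbar b f z = 0.

End ComplexValued.

Section Exterior.
Context {R : realType} {n : nat}.

(* [u S] is the coefficient of the wedge, in increasing order, of the generators
   indexed by [S]; the generator of index [lshift n a] is dz_a, that of index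
   [rshift n a] is dzbar_a. *)
Definition ext := {ffun {set 'I_(n + n)} -> R[i]^o}.

Definition ebasis (S : {set 'I_(n + n)}) : ext := [ffun T => (T == S)%:R].

Definition gen (s : 'I_(n + n)) : ext := ebasis [set s].

(* The sign in e_A /\ e_B = sign e_(A u B), for disjoint [A] and [B]. *)
Definition shuffle_sign (A B : {set 'I_(n + n)}) : R[i] :=
  (-1) ^+ #|[set p : 'I_(n + n) * 'I_(n + n)
            | [&& p.1 \in A, p.2 \in B & (p.2 < p.1)%N]]|.

Definition wedge (u v : ext) : ext :=
  [ffun S : {set _} => \sum_(A : {set 'I_(n + n)} | A \subset S)
               shuffle_sign A (S :\: A) * (u A * v (S :\: A))].

Definition ext1 : ext := ebasis finset.set0.

(* The algebra morphism sending each generator [s] to the 1-form [w s]. *)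
Definition ext_subst (w : 'I_(n + n) -> ext) (u : ext) : ext :=
  \sum_(S : {set 'I_(n + n)}) u S *: \big[wedge/ext1]_(s <- enum S) w s.

Definition bar (s : 'I_(n + n)) : 'I_(n + n) :=
  match fintype.split s with inl a => rshift n a | inr a => lshift n a end.

Definition econj (u : ext) : ext :=
  ext_subst (fun s => gen (bar s)) [ffun S => (u S)^*].

Definition hol_deg (S : {set 'I_(n + n)}) : nat :=
  #|[set a : 'I_n | lshift n a \in S]|.
Definition antihol_deg (S : {set 'I_(n + n)}) : nat :=
  #|[set a : 'I_n | rshift n a \in S]|.

Definition is_type (p q : nat) (u : ext) : Prop :=
  forall S, u S != 0 -> hol_deg S = p /\ antihol_deg S = q.

Definition type_part (p q : nat) (u : ext) : ext :=
  [ffun S => if (hol_deg S == p) && (antihol_deg S == q) then u S else 0].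

Definition is_deg (k : nat) (u : ext) : Prop :=
  forall S, u S != 0 -> #|S| = k.

(* omega_k = omega^k / k!, and 0 for k < 0. *)
Definition divpow (w : ext) (k : int) : ext :=
  match k with
  | Posz k => (k`!%:R : R[i])^-1 *: iter k (wedge w) ext1
  | Negz _ => 0
  end.

(* The matrix h with w = i sum_(a, b) h_ab dz_a /\ dzbar_b. *)
Definition herm_mx (w : ext) : 'M[R[i]]_n :=
  \matrix_(a, b) (- 'i * w (lshift n a |: [set rshift n b])).

Definition posdef (w : ext) : Prop :=
  forall v : 'I_n -> R[i], (exists a, v a != 0) ->
    0 < \sum_a \sum_b herm_mx w a b * v a * (v b)^*.

(* Gram matrix of the generators: <dz_a, dz_b> = (h^-1)_ba,
   <dzbar_a, dzbar_b> = (h^-1)_ab, <dz_a, dzbar_b> = 0.  For h = 1 the dz_a, and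
   the dzbar_a, are orthonormal. *)
Definition gram (w : ext) : 'M[R[i]]_(n + n) :=
  block_mx (invmx (herm_mx w))^T 0 0 (invmx (herm_mx w)).

(* <e_S, e_T> is the determinant of the inner products of the generators. *)
Definition inner_basis (w : ext) (S T : {set 'I_(n + n)}) : R[i] :=
  if #|S| == #|T| then
    \det (\matrix_(i < #|S|, j < #|S|)
            gram w (enum_val i) (nth (enum_val i) (enum T) j))
  else 0.

Definition inner (w u v : ext) : R[i] :=
  \sum_S \sum_T u S * (v T)^* * inner_basis w S T.

(* The adjoint of [wedge w] for [inner w]; when [w] is positive definite, [inner w]
   is nondegenerate and the condition determines [v]. *)
Definition Lambda (w u : ext) : ext :=
  xget 0 [set v : ext | forall t : ext, inner w (wedge w t) u = inner w t v].

Definition primitive (w : ext) (k : nat) (u : ext) : Prop :=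
  is_deg k u /\ Lambda w u = 0.

(* Meant for a 3-form [u]: the component [u0] of its Lefschetz decomposition. *)
Definition prim (w u : ext) : ext :=
  xget 0 [set u0 : ext | primitive w 3 u0 /\
                         exists2 b : ext, is_deg 1 b & u = u0 + wedge w b].

(* dx_1 /\ dy_1 /\ ... /\ dx_n /\ dy_n, since dx /\ dy = (i/2) dz /\ dzbar. *)
Definition vol : ext :=
  \big[wedge/ext1]_(a <- enum 'I_n)
     (('i / 2 : R[i]) *: wedge (gen (lshift n a)) (gen (rshift n a))).

Definition density (u : ext) : R[i] := u finset.setT / vol finset.setT.

End Exterior.

Arguments ext : clear implicits.

Record complexManifold (R : realType) (n : nat) := ComplexManifold {
  carrier :> topologicalType;
  chart_index : Type;
  chart_dom : chart_index -> set carrier;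
  chart : chart_index -> carrier -> 'rV[R]_(n + n);
  chart_inv : chart_index -> 'rV[R]_(n + n) -> carrier;
  manifold_hausdorff : hausdorff_space carrier;
  manifold_second_countable : @second_countable carrier;
  chart_cover : forall x, exists i, chart_dom i x;
  chart_dom_open : forall i, open (chart_dom i);
  chart_img_open : forall i, open (chart i @` chart_dom i);
  chartK : forall i x, chart_dom i x -> chart_inv i (chart i x) = x;
  chart_continuous : forall i, {within chart_dom i, continuous (chart i)};
  chart_inv_continuous :
    forall i, {within chart i @` chart_dom i, continuous (chart_inv i)};
  chart_holomorphic : forall i j a,
    holomorphic_on (chart i @` (chart_dom i `&` chart_dom j))
                   (fun z => coordC (chart j (chart_inv i z)) a)
}.

Section Forms.
Context {R : realType} {n : nat} {X : complexManifold R n}.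
Local Notation E := (ext R n).

Definition chart_img (i : chart_index X) : set 'rV[R]_(n + n) :=
  chart i @` chart_dom i.

(* A (mixed-degree) form is given by its local expressions; [eta i x] is only
   meaningful for [x] in the domain of the chart [i]. *)
Definition diff_form := chart_index X -> X -> E.

(* At [x], the pullback to the chart [i] of the generators of the chart [j]. *)
Definition transition_gen (i j : chart_index X) (x : X) (s : 'I_(n + n)) : E :=
  let F a := fun z => coordC (chart j (chart_inv i z)) a in
  match fintype.split s with
  | inl a => \sum_b d_dz b (F a) (chart i x) *: gen (lshift n b)
  | inr a => \sum_b (d_dz b (F a) (chart i x))^* *: gen (rshift n b)
  end.

Definition smooth_form (eta : diff_form) : Prop :=
  (forall i j x, chart_dom i x -> chart_dom j x ->
     eta i x = ext_subst (transition_gen i j x) (eta j x)) /\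
  (forall i S, smooth_on (chart_img i) (fun z => eta i (chart_inv i z) S)).

Definition real11_form (eta : diff_form) : Prop :=
  [/\ smooth_form eta,
      forall i x, chart_dom i x -> is_type 1 1 (eta i x) &
      forall i x, chart_dom i x -> econj (eta i x) = eta i x].

Definition hermitian_metric (omega : diff_form) : Prop :=
  real11_form omega /\ forall i x, chart_dom i x -> posdef (omega i x).

Definition fadd (eta xi : diff_form) : diff_form :=
  fun i x => eta i x + xi i x.
Definition fscale (c : R[i]) (eta : diff_form) : diff_form :=
  fun i x => c *: eta i x.
Definition fwedge (eta xi : diff_form) : diff_form :=
  fun i x => wedge (eta i x) (xi i x).
Definition fconj (eta : diff_form) : diff_form := fun i x => econj (eta i x).
Definition ftype_part (p q : nat) (eta : diff_form) : diff_form :=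
  fun i x => type_part p q (eta i x).
Definition fdivpow (omega : diff_form) (k : int) : diff_form :=
  fun i x => divpow (omega i x) k.
Definition fLambda (omega eta : diff_form) : diff_form :=
  fun i x => Lambda (omega i x) (eta i x).
Definition fprim (omega eta : diff_form) : diff_form :=
  fun i x => prim (omega i x) (eta i x).

Definition del (eta : diff_form) : diff_form := fun i x =>
  \sum_(b < n) wedge (gen (lshift n b))
    [ffun S => d_dz b (fun z => eta i (chart_inv i z) S) (chart i x)].

Definition delbar (eta : diff_form) : diff_form := fun i x =>
  \sum_(b < n) wedge (gen (rshift n b))
    [ffun S => d_dzbar b (fun z => eta i (chart_inv i z) S) (chart i x)].

Definition ext_d (eta : diff_form) : diff_form := fadd (del eta) (delbar eta).

Definition lee_form (omega : diff_form) : diff_form :=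
  fscale (n.-1%:R)^-1 (fLambda omega (ext_d omega)).

Definition lee_form01 (omega : diff_form) : diff_form :=
  ftype_part 0 1 (lee_form omega).

End Forms.

Arguments diff_form {R n} X.

Record partition_of_unity (R : realType) (n : nat) (X : complexManifold R n) :=
  PartitionOfUnity {
  pu_size : nat;
  pu_chart : 'I_pu_size -> chart_index X;
  pu_fun : 'I_pu_size -> X -> R;
  pu_ge0 : forall k x, 0 <= pu_fun k x;
  pu_sum1 : forall x, \sum_k pu_fun k x = 1;
  pu_supp : forall k,
    closure [set x | pu_fun k x != 0] `<=` chart_dom (pu_chart k);
  pu_smooth : forall k i,
    smooth_on (chart_img i) (fun z => (pu_fun k (chart_inv i z))%:C)
}.

Section Integration.
Context {R : realType} {n : nat} {X : complexManifold R n}.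
Variable P : partition_of_unity X.

(* Integral over X of the top-degree part of [eta].  By the change of variables
   formula the value for a smooth form does not depend on [P]. *)
Definition integralX (eta : diff_form X) : R[i] :=
  \sum_(k < pu_size P)
    Cintegral_Rm (fun z =>
      let i := pu_chart k in
      let x := chart_inv i z in
      if z \in chart_img i then (pu_fun k x)%:C * density (eta i x) else 0).

Definition innerX (omega u v : diff_form X) : R[i] :=
  integralX (fun i x => inner (omega i x) (u i x) (v i x)
                        *: divpow (omega i x) n%:Z).

Definition functional_L (omega : diff_form X) : R[i] :=
  let v := fprim omega (delbar omega) in
  integralX (fscale 'i (fwedge (fwedge v (fconj v))
                               (fdivpow omega (n%:Z - 3)))).

Definition diff_L (omega gamma : diff_form X) : R[i] :=
  Cderive (fun t : R => functional_L (fadd omega (fscale t%:C gamma))) 0 1.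

Definition derivable_L (omega gamma : diff_form X) : Prop :=
  Cderivable (fun t : R => functional_L (fadd omega (fscale t%:C gamma))) 0 1.

End Integration.

(* Main.v *)
(* Contraction against a (1,1)-form omega gives an explicit Lefschetz operator Lambda, and
   the primitive part of a 3-form u is v = u - (n-1)^-1 omega /\ Lambda u.  A primitive form v
   of type (1,2) satisfies omega_(n-3) /\ conj v = const * (Hodge star of v), so the
   Hermitian pairing (a, b) |-> i a /\ conj b /\ omega_(n-3) is <a, b> dV for b primitive,
   and it vanishes on omega /\ (1-form).  This gives L >= 0.  Along omega + t gamma, the
   derivative of v is dbar gamma - theta /\ gamma - omega /\ (derivative of theta), whose last
   term is orthogonal to v; the derivative of omega_(n-3) is gamma /\ omega_(n-4).  All the
   integrands are rational in the coefficients, hence have expansions f_0 + t f_1 + O(t^2)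
   uniformly on the compact supports of the partition of unity, and the expansion can be
   integrated term by term. *)

Require Import Defs.
From HB Require Import structures.
From mathcomp Require Import all_boot all_order all_algebra.
From mathcomp Require Import complex.
From mathcomp Require Import all_classical all_reals all_analysis.
From mathcomp Require Import ring lra.

Set Implicit Arguments.
Unset Strict Implicit.
Unset Printing Implicit Defensive.

Import Order.TTheory GRing.Theory Num.Theory.
Import numFieldNormedType.Exports.

Local Open Scope complex_scope.
Local Open Scope ring_scope.

(** Two obstacles shape the proof. [Lambda] and [prim] are choice operators, so their dependence on
    the parameter cannot be read off their definitions; they are replaced by Cramer-type formulas,
    which agree with them where the matrix of the form is invertible and, by compactness of the
    supports, for all small [t] at once. And the integral is an iterated one: additivity,
    homogeneity and a bound by the sup norm on a box are all that is established for it. Remainders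
    bounded by M t^2 with a single M fit these three facts, since such expansions are closed under
    sums, products and inverses and survive integration by the sup bound. On the algebraic side no
    Hodge star is constructed. A contraction [J s] sends omega to the generator [s], hence
    omega_(m+1) to that generator times omega_m; applied to a product omega_(m+1) /\ conj v that
    vanishes for degree reasons, it moves one generator at a time across to v. The vanishing itself
    and the star formula both come from this device, by induction on the degree. *)

Lemma addrr_inj (F : numFieldType) (x y : F) : x + x = y + y -> x = y.
Proof.
have n2 : 2%:R != 0 :> F by rewrite pnatr_eq0.
by move=> h; apply: (mulfI n2); rewrite !mulr_natl !mulr2n.
Qed.

(** * Exterior algebra *)

Section ExteriorAlgebra.
Context {R : realType} {n : nat}.
Local Notation C := R[i].
Local Notation E := (ext R n).
Local Notation I := 'I_(n + n).
Implicit Types (u v w : E) (s t r : I) (S T A B D : {set I}).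

Lemma ebasisE S T : ebasis S T = (T == S)%:R :> C.
Proof. by rewrite ffunE. Qed.

Lemma ext_expand u : u = \sum_S (u S : C) *: ebasis S.
Proof.
apply/ffunP => T; rewrite sum_ffunE (bigD1 T) //= big1 ?addr0.
  by rewrite ffunE ebasisE eqxx /= /GRing.scale /= mulr1.
by move=> S ST; rewrite ffunE ebasisE eq_sym (negbTE ST) /GRing.scale /= mulr0.
Qed.

Lemma extDE u v S : (u + v) S = u S + v S. Proof. exact: ffunE. Qed.
Lemma extNE u S : (- u) S = - u S. Proof. exact: ffunE. Qed.
Lemma extZE (c : C) u S : (c *: u) S = c * u S. Proof. exact: ffunE. Qed.
Lemma ext0E S : (0 : E) S = 0. Proof. exact: ffunE. Qed.
Lemma ext_sumE (J : Type) (r : seq J) (P : pred J) (F : J -> E) S :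
  (\sum_(i <- r | P i) F i) S = \sum_(i <- r | P i) F i S.
Proof. exact: sum_ffunE. Qed.

Lemma wedgeE u v S : wedge u v S =
  \sum_(A : {set I} | A \subset S) shuffle_sign A (S :\: A) * (u A * v (S :\: A)).
Proof. exact: ffunE. Qed.

Lemma wedge_is_linear u : linear (wedge u).
Proof.
move=> c v w; apply/ffunP => S; rewrite !ffunE scaler_sumr -big_split /=.
by apply: eq_bigr => A _; rewrite !ffunE /GRing.scale /=; ring.
Qed.

HB.instance Definition _ u := GRing.isLinear.Build C E E *:%R (wedge u)
  (wedge_is_linear u).

Lemma wedgel_is_linear v : linear (wedge^~ v).
Proof.
move=> c u w; apply/ffunP => S; rewrite !ffunE scaler_sumr -big_split /=.
by apply: eq_bigr => A _; rewrite !ffunE /GRing.scale /=; ring.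
Qed.

Definition wedge_r v u := wedge u v.

HB.instance Definition _ v := GRing.isLinear.Build C E E *:%R (wedge_r v)
  (wedgel_is_linear v).

Lemma wedgeDl u v w : wedge (u + v) w = wedge u w + wedge v w.
Proof. exact: (linearD (wedge_r w)). Qed.
Lemma wedgeNl u w : wedge (- u) w = - wedge u w.
Proof. exact: (linearN (wedge_r w)). Qed.
Lemma wedgeZl (c : C) u w : wedge (c *: u) w = c *: wedge u w.
Proof. exact: (linearZ_LR (wedge_r w)). Qed.
Lemma wedge0l w : wedge 0 w = 0.
Proof. exact: (linear0 (wedge_r w)). Qed.
Lemma wedge_suml (J : Type) (r : seq J) (P : pred J) (F : J -> E) w :
  wedge (\sum_(i <- r | P i) F i) w = \sum_(i <- r | P i) wedge (F i) w.
Proof. exact: (linear_sum (wedge_r w)). Qed.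
Lemma wedgeDr w u v : wedge w (u + v) = wedge w u + wedge w v.
Proof. exact: linearD. Qed.
Lemma wedgeNr w u : wedge w (- u) = - wedge w u.
Proof. exact: linearN. Qed.
Lemma wedgeZr (c : C) w u : wedge w (c *: u) = c *: wedge w u.
Proof. exact: linearZ_LR. Qed.
Lemma wedge0r w : wedge w 0 = 0.
Proof. exact: linear0. Qed.
Lemma wedge_sumr (J : Type) (r : seq J) (P : pred J) (F : J -> E) w :
  wedge w (\sum_(i <- r | P i) F i) = \sum_(i <- r | P i) wedge w (F i).
Proof. exact: linear_sum. Qed.

Local Notation sgn A B := (shuffle_sign A B : C).

(* In [shuffle_sign] the braces parse as a [classical_set], not as a [finset]. *)
Lemma shuffle_signE A B : sgn A B =
  (-1) ^+ #|[set p : I * I | [&& p.1 \in A, p.2 \in B & (p.2 < p.1)%N]]%SET|.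
Proof.
rewrite /shuffle_sign; congr (_ ^+ _); apply: eq_card => p; rewrite [RHS]inE.
by apply/idP/idP => [/set_mem|/mem_set].
Qed.

Lemma shuffle_signK A B : sgn A B * sgn A B = 1.
Proof. by rewrite -expr2 shuffle_signE sqrr_sign. Qed.

Lemma shuffle_signUl A B D : [disjoint A & B] ->
  sgn (A :|: B) D = sgn A D * sgn B D.
Proof.
move=> AB; rewrite !shuffle_signE -exprD -cardsUI.
congr (_ ^+ _); rewrite -[LHS]addn0; congr (_ + _)%N.
  by apply: eq_card => p; rewrite !inE andb_orl.
apply/esym/eqP; rewrite cards_eq0 -finset.subset0; apply/fintype.subsetP => p.
rewrite !inE => /andP[/and3P[pA _ _] /and3P[pB _ _]].
by move: (disjointFr AB pA); rewrite pB.
Qed.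

Lemma shuffle_signUr A B D : [disjoint B & D] ->
  sgn A (B :|: D) = sgn A B * sgn A D.
Proof.
move=> AB; rewrite !shuffle_signE -exprD -cardsUI.
congr (_ ^+ _); rewrite -[LHS]addn0; congr (_ + _)%N.
  by apply: eq_card => p; rewrite !inE andb_orl andb_orr.
apply/esym/eqP; rewrite cards_eq0 -finset.subset0; apply/fintype.subsetP => p.
rewrite !inE => /andP[/and3P[_ pA _] /and3P[_ pB _]].
by move: (disjointFr AB pA); rewrite pB.
Qed.

Lemma shuffle_sign11 s t : sgn [set s] [set t] = (-1) ^+ (t < s)%N.
Proof.
rewrite shuffle_signE; congr (_ ^+ _); case: ltnP => ts /=.
  rewrite (_ : [set _ | _] = [set (s, t)]) ?cards1 //.
  apply/setP => -[a b]; rewrite !inE /= xpair_eqE.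
  by case: eqVneq => [->|]//=; case: eqVneq => [->|].
apply: eq_card0 => -[a b]; rewrite !inE /=.
case: eqVneq => [->|]//=; case: eqVneq => [->|]//=.
by rewrite ltnNge ts.
Qed.

Lemma shuffle_sign0l B : sgn finset.set0 B = 1.
Proof.
by rewrite shuffle_signE eq_card0 // => p; rewrite !inE.
Qed.

Lemma shuffle_sign0r B : sgn B finset.set0 = 1.
Proof.
by rewrite shuffle_signE eq_card0 // => p; rewrite !inE andbF.
Qed.

Lemma wedge_ebasisl A v S : wedge (ebasis A) v S =
  (if A \subset S then sgn A (S :\: A) * v (S :\: A) else 0) :> C.
Proof.
rewrite ffunE; case: ifPn => AS.
  rewrite (bigD1 A) //= big1 ?addr0 => [|D /andP[_ DA]]; rewrite ebasisE.
    by rewrite eqxx mul1r.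
  by rewrite (negbTE DA) mul0r mulr0.
rewrite big1 // => D DS; rewrite ebasisE; case: eqVneq => [DA|]; last first.
  by rewrite mul0r mulr0.
by rewrite DA (negbTE AS) in DS.
Qed.

Lemma wedge_ebasis A B : wedge (ebasis A) (ebasis B) =
  (if [disjoint A & B] then sgn A B *: ebasis (A :|: B) else 0) :> E.
Proof.
apply/ffunP => S; rewrite wedge_ebasisl ebasisE.
case: (boolP [disjoint A & B]) => AB.
  rewrite ffunE ebasisE /GRing.scale /=; case: (eqVneq S (A :|: B)) => [->|SAB].
    rewrite finset.subsetUl finset.setDUl finset.setDv finset.set0U.
    by rewrite (finset.setDidPl _) ?eqxx // disjoint_sym.
  rewrite mulr0; case: ifP => // AS; case: eqVneq; last by rewrite mulr0.
  move=> SB; case/eqP: SAB; rewrite -SB.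
  by rewrite -[in LHS](finset.setID S A) (finset.setIidPr AS).
rewrite ffunE; case: ifP => // AS; case: eqVneq; last by rewrite mulr0.
move=> SB; case/negP: AB; rewrite -SB -finset.setI_eq0.
by rewrite finset.setIDA finset.setIC finset.setDIl finset.setDv finset.setI0.
Qed.

Lemma disjointsUl A B D :
  [disjoint A :|: B & D] = [disjoint A & D] && [disjoint B & D].
Proof. by rewrite -!finset.setI_eq0 finset.setIUl finset.setU_eq0. Qed.

Lemma disjointsUr A B D :
  [disjoint D & A :|: B] = [disjoint D & A] && [disjoint D & B].
Proof. by rewrite -!finset.setI_eq0 finset.setIUr finset.setU_eq0. Qed.

(** Extending the sign by zero to overlapping sets gives one formula for all products of basis
    elements, and associativity becomes the cocycle identity [sgn0A]. *)
Let sgn0 A B : C := if [disjoint A & B] then sgn A B else 0.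

Let wedge_ebasis0 A B :
  wedge (ebasis A) (ebasis B) = sgn0 A B *: ebasis (A :|: B) :> E.
Proof. by rewrite wedge_ebasis /sgn0; case: ifP => // _; rewrite [RHS]scale0r. Qed.

Let sgn0A A B D :
  sgn0 B D * sgn0 A (B :|: D) = sgn0 A B * sgn0 (A :|: B) D.
Proof.
rewrite /sgn0 disjointsUl disjointsUr.
case: (boolP [disjoint A & B]) => AB /=; last by rewrite mul0r mulr0.
case: (boolP [disjoint B & D]) => BD /=; last by rewrite mul0r andbF mulr0.
case: (boolP [disjoint A & D]) => AD /=; last by rewrite !mulr0.
by rewrite shuffle_signUl // shuffle_signUr // mulrC -mulrA.
Qed.

Lemma wedgeA : associative (@wedge R n).
Proof.
move=> u v w; rewrite (ext_expand u) !(wedge_suml, wedge_sumr).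
apply: eq_bigr => A _; rewrite !wedgeZl; congr (_ *: _).
rewrite (ext_expand v) !(wedge_suml, wedge_sumr).
apply: eq_bigr => B _; rewrite !(wedgeZl, wedgeZr); congr (_ *: _).
rewrite (ext_expand w) !(wedge_suml, wedge_sumr).
apply: eq_bigr => D _; rewrite !(wedgeZl, wedgeZr); congr (_ *: _).
rewrite !wedge_ebasis0 wedgeZl wedgeZr !wedge_ebasis0.
by rewrite [LHS]scalerA [RHS]scalerA sgn0A finset.setUA.
Qed.

Lemma wedge1l u : wedge ext1 u = u.
Proof.
apply/ffunP => S; rewrite wedge_ebasisl finset.sub0set finset.setD0.
by rewrite shuffle_sign0l mul1r.
Qed.

Lemma wedge1r u : wedge u ext1 = u.
Proof.
rewrite [in RHS](ext_expand u) [in LHS](ext_expand u) wedge_suml.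
apply: eq_bigr => S _; rewrite wedgeZl wedge_ebasis -finset.setI_eq0.
by rewrite finset.setI0 eqxx shuffle_sign0r scale1r finset.setU0.
Qed.

Lemma wedge_genE t u S : wedge (gen t) u S =
  (if t \in S then sgn [set t] (S :\ t) * u (S :\ t) else 0) :> C.
Proof. by rewrite wedge_ebasisl finset.sub1set. Qed.

Lemma wedge_gen_ebasis s S : s \notin S ->
  wedge (gen s) (ebasis S) = sgn [set s] S *: ebasis (s |: S) :> E.
Proof. by move=> sS; rewrite wedge_ebasis disjoints1 sS. Qed.

Lemma wedge_gen_ebasis0 s S : s \in S -> wedge (gen s) (ebasis S) = 0 :> E.
Proof. by move=> sS; rewrite wedge_ebasis disjoints1 sS. Qed.

(** The interior product with the vector dual to the generator [s]. *)
Definition contr s u : E :=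
  [ffun S : {set I} => if s \in S then 0 else sgn [set s] S * u (s |: S)].

Lemma contr_is_linear s : linear (contr s).
Proof.
move=> c u v; apply/ffunP => S; rewrite !ffunE /GRing.scale /=.
by case: ifP => _; rewrite ?mulr0 ?addr0 // mulrDr; congr (_ + _); ring.
Qed.

HB.instance Definition _ s := GRing.isLinear.Build C E E *:%R (contr s)
  (contr_is_linear s).

Lemma contrE s u S :
  contr s u S = (if s \in S then 0 else sgn [set s] S * u (s |: S)) :> C.
Proof. exact: ffunE. Qed.
Lemma contrD s u v : contr s (u + v) = contr s u + contr s v.
Proof. exact: linearD. Qed.
Lemma contrN s u : contr s (- u) = - contr s u.
Proof. exact: linearN. Qed.
Lemma contrZ s (c : C) u : contr s (c *: u) = c *: contr s u.
Proof. exact: linearZ_LR. Qed.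
Lemma contr0 s : contr s 0 = 0.
Proof. exact: linear0. Qed.
Lemma contr_sum s (J : Type) (r : seq J) (P : pred J) (F : J -> E) :
  contr s (\sum_(i <- r | P i) F i) = \sum_(i <- r | P i) contr s (F i).
Proof. exact: linear_sum. Qed.

Lemma shuffle_signD1 s t S : t \in S ->
  sgn [set s] S = (-1) ^+ (t < s)%N * sgn [set s] (S :\ t).
Proof.
move=> tS; rewrite -{1}(finset.setD1K tS) shuffle_signUr ?shuffle_sign11 //.
by rewrite disjoints1 !inE eqxx.
Qed.

(** The canonical anticommutation relation. With [contr1] it determines contractions by induction on
    products, so that most later arguments need no shuffle signs. *)
Lemma contr_gen s t u :
  contr s (wedge (gen t) u) = (s == t)%:R *: u - wedge (gen t) (contr s u).
Proof.
apply/ffunP => S; rewrite [LHS]ffunE !wedge_genE.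
rewrite extDE extNE extZE wedge_genE.
rewrite ffunE !inE (eq_sym t s).
case: (eqVneq s t) => [<-|st] /=; rewrite ?mul1r ?mul0r ?add0r.
  case: ifPn => sS.
    by rewrite finset.setD1K // mulrA shuffle_signK mul1r subrr.
  by rewrite setU1K // mulrA shuffle_signK mul1r subr0.
case: (boolP (t \in S)) => tS; last by case: ifP; rewrite ?mulr0 ?oppr0.
case: (boolP (s \in S)) => sS; first by rewrite /= mulr0 oppr0.
rewrite (shuffle_signD1 s tS) (@shuffle_signD1 t s ((s |: S) :\ t)); last first.
  by rewrite !inE st eqxx.
have -> : ((s |: S) :\ t) = s |: (S :\ t).
  apply/setP => x; rewrite !inE; case: (eqVneq x s) => [->|]//=.
  by rewrite st.
have -> : (s |: S :\ t) :\ s = S :\ t.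
  by rewrite setU1K // !inE (negbTE sS) andbF.
rewrite !mulrA -mulNr; congr (_ * _).
have ts : t != s :> nat by rewrite eq_sym.
by case: (ltngtP s t) ts => //= _ _; ring.
Qed.

Lemma contr1 s : contr s ext1 = 0.
Proof.
apply/ffunP => S; rewrite !ffunE; case: ifP => // _.
case: eqP => [/setP/(_ s)|_]; last by rewrite mulr0.
by rewrite !inE eqxx.
Qed.

Lemma gen_anti s t u :
  wedge (gen s) (wedge (gen t) u) = - wedge (gen t) (wedge (gen s) u).
Proof.
rewrite !wedgeA -wedgeNl; congr (wedge _ u); rewrite !wedge_ebasis.
rewrite !disjoints1 !inE (eq_sym t s); case: eqVneq => [|st]; first by rewrite oppr0.
rewrite -scaleNr finset.setUC !shuffle_sign11; congr (_ *: _).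
have ts : t != s :> nat by rewrite eq_sym.
by case: (ltngtP s t) ts => //= _ _; ring.
Qed.

(** Adding an element below all the others makes [ebasis (m |: S)] the product of [gen m] and
    [ebasis S] with no sign. *)
Lemma set_min_ind (P : {set I} -> Prop) :
  P finset.set0 ->
  (forall (m : I) S, (forall x, x \in S -> (m < x)%N) -> P S -> P (m |: S)) ->
  forall S, P S.
Proof.
move=> P0 PS S; move: {-1}#|S| (leqnn #|S|) => k; elim: k S => [|k IH] S Sk.
  by move: Sk; rewrite leqn0 cards_eq0 => /eqP->.
have [->//|[x xS]] := set_0Vmem S.
pose m := [arg min_(i < x in S) (i : nat)].
have [mS mmin] : m \in S /\ forall y, y \in S -> (m <= y)%N.
  by rewrite /m; case: arg_minnP => // i iS imin.
rewrite -(finset.setD1K mS); apply: PS.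
  move=> y; rewrite !inE => /andP[ym yS]; rewrite ltn_neqAle mmin // andbT.
  by rewrite eq_sym in ym.
by apply: IH; move: Sk; rewrite (cardsD1 m) mS.
Qed.

Lemma shuffle_sign_min (m : I) S : (forall x, x \in S -> (m < x)%N) ->
  sgn [set m] S = 1.
Proof.
move=> mS; rewrite shuffle_signE eq_card0 // => -[a b]; rewrite !inE /=.
case: eqVneq => //= ->; case: (boolP (b \in S)) => //= /mS.
by rewrite ltnNge => /negbTE; rewrite leq_eqVlt => /norP[_ /negbTE].
Qed.

Lemma ebasis_min (m : I) S : (forall x, x \in S -> (m < x)%N) ->
  ebasis (m |: S) = wedge (gen m) (ebasis S) :> E.
Proof.
move=> mS; rewrite wedge_gen_ebasis ?shuffle_sign_min ?scale1r //.
by apply/negP => /mS; rewrite ltnn.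
Qed.

Lemma ext_ind (P : E -> Prop) :
  P ext1 -> (forall u v, P u -> P v -> P (u + v)) ->
  (forall (c : C) u, P u -> P (c *: u)) ->
  (forall s u, P u -> P (wedge (gen s) u)) -> forall u, P u.
Proof.
move=> P1 PD PZ Pg u; rewrite (ext_expand u).
have P0 : P 0 by rewrite -(scale0r ext1); apply: PZ.
elim/big_ind: _ => // S _; apply: PZ; elim/set_min_ind: S => // m S mS PS.
by rewrite ebasis_min //; apply: Pg.
Qed.

#[local] Opaque wedge contr.

(* [F (e_S)] is determined by the values on increasing products, so that a linear
   map intertwining [gen m] and [B m] on them intertwines them everywhere. *)
Lemma intertwine (V : lmodType C) (F : {linear E -> V}) (B : I -> {linear V -> V}) :
  (forall s t u, B s (B t (F u)) = - B t (B s (F u))) ->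
  (forall (m : I) S, (forall x, x \in S -> (m < x)%N) ->
     F (ebasis (m |: S)) = B m (F (ebasis S))) ->
  forall s u, F (wedge (gen s) u) = B s (F u).
Proof.
move=> anti Fmin s u; rewrite (ext_expand u) wedge_sumr !linear_sum /=.
apply: eq_bigr => S _; rewrite wedgeZr !linearZ /=; congr (_ *: _) => {u}.
(* Anticommutation of [B r] with itself says that twice its square is zero; this handles a repeated
   generator. *)
have sq r u : B r (B r (F u)) = 0.
  have /eqP := anti r r u; rewrite -addr_eq0 -mulr2n -scaler_nat scaler_eq0.
  by rewrite pnatr_eq0 /= => /eqP.
elim/set_min_ind: S s => [|m S mS IH] s.
  by rewrite -ebasis_min ?Fmin // => x; rewrite inE.
(* Sort [s] into the increasing product: it is already in place below [m], is swapped with [m] above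
   it, and gives zero on both sides when equal to [m]. *)
case: (ltngtP s m) => [sm|ms|/val_inj ->].
- have smin x : x \in m |: S -> (s < x)%N.
    by rewrite !inE => /orP[/eqP->//|/mS]; apply: ltn_trans.
  by rewrite -ebasis_min // Fmin.
- rewrite Fmin // anti -IH [in LHS]ebasis_min // gen_anti linearN; congr (- _).
  case: (boolP (s \in S)) => sS.
    by rewrite wedge_gen_ebasis0 // wedge0r !linear0.
  have smin x : x \in s |: S -> (m < x)%N by rewrite !inE => /orP[/eqP->//|/mS].
  rewrite !wedge_gen_ebasis // wedgeZr !linearZ /=; congr (_ *: _).
  by rewrite -ebasis_min // [LHS]Fmin.
- by rewrite Fmin // sq wedge_gen_ebasis0 ?linear0 // !inE eqxx.
Qed.

End ExteriorAlgebra.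
#[local] Opaque wedge contr.

(** * Grading, Leibniz rule and conjugation *)

Section GradedAlgebra.
Context {R : realType} {n : nat}.
Local Notation C := R[i].
Local Notation E := (ext R n).
Local Notation I := 'I_(n + n).
Implicit Types (u v w : E) (s t r : I) (S T A B D : {set I}).

(** The grading involution. It carries the signs of the Leibniz and commutation rules for forms that
    need not be homogeneous. *)
Definition hat u : E := [ffun S : {set I} => (-1) ^+ #|S| * u S].

Lemma hat_is_linear : linear hat.
Proof.
move=> c u v; apply/ffunP => S; rewrite !ffunE /GRing.scale /=.
by rewrite mulrDr mulrCA.
Qed.

HB.instance Definition _ := GRing.isLinear.Build C E E *:%R hat hat_is_linear.

Lemma hatE u S : hat u S = (-1) ^+ #|S| * u S. Proof. exact: ffunE. Qed.
Lemma hatD u v : hat (u + v) = hat u + hat v. Proof. exact: linearD. Qed.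
Lemma hatZ (c : C) u : hat (c *: u) = c *: hat u. Proof. exact: linearZ_LR. Qed.
#[local] Opaque hat.

Lemma hat1 : hat ext1 = ext1.
Proof.
apply/ffunP => S; rewrite hatE ffunE; case: eqP => [->|_]; last by rewrite mulr0.
by rewrite cards0 mul1r.
Qed.

Lemma hat_gen s u : hat (wedge (gen s) u) = - wedge (gen s) (hat u).
Proof.
apply/ffunP => S; rewrite extNE hatE !wedge_genE hatE.
case: ifP => sS; last by rewrite mulr0 oppr0.
by rewrite (cardsD1 s) sS exprS mulN1r mulNr mulrCA.
Qed.

Lemma contr_wedge s u v :
  contr s (wedge u v) = wedge (contr s u) v + wedge (hat u) (contr s v).
Proof.
elim/(@ext_ind R n): u => [|u1 u2 IH1 IH2|c u IH|t u IH].
- by rewrite contr1 hat1 !wedge1l wedge0l add0r.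
- by rewrite wedgeDl !contrD hatD !wedgeDl IH1 IH2 addrACA.
- by rewrite wedgeZl !contrZ IH hatZ !wedgeZl scalerDr.
- rewrite -wedgeA !contr_gen hat_gen IH wedgeDr wedgeDl !wedgeNl !wedgeA wedgeZl.
  by rewrite opprD addrA.
Qed.

Lemma wedge_genr u s : wedge u (gen s) = wedge (gen s) (hat u).
Proof.
elim/(@ext_ind R n): u => [|u1 u2 IH1 IH2|c u IH|t u IH].
- by rewrite hat1 wedge1l wedge1r.
- by rewrite hatD wedgeDl wedgeDr IH1 IH2.
- by rewrite hatZ wedgeZl wedgeZr IH.
- by rewrite -wedgeA IH gen_anti hat_gen wedgeNr.
Qed.

Lemma wedge_even w u : hat w = w -> wedge w u = wedge u w.
Proof.
move=> hw; elim/(@ext_ind R n): u => [|u1 u2 IH1 IH2|c u IH|t u IH].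
- by rewrite wedge1l wedge1r.
- by rewrite wedgeDl wedgeDr IH1 IH2.
- by rewrite wedgeZl wedgeZr IH.
- by rewrite wedgeA wedge_genr hw -!wedgeA IH.
Qed.

Lemma wedge_odd w u : hat w = - w -> wedge w u = wedge (hat u) w.
Proof.
move=> hw; elim/(@ext_ind R n): u => [|u1 u2 IH1 IH2|c u IH|t u IH].
- by rewrite hat1 wedge1l wedge1r.
- by rewrite hatD wedgeDl wedgeDr IH1 IH2.
- by rewrite hatZ wedgeZl wedgeZr IH.
- by rewrite wedgeA wedge_genr hw hat_gen wedgeNr !wedgeNl -!wedgeA IH.
Qed.

Lemma contr_anti s t u : contr s (contr t u) = - contr t (contr s u).
Proof.
elim/(@ext_ind R n): u => [|u1 u2 IH1 IH2|c u IH|r u IH].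
- by rewrite !contr1 !contr0 oppr0.
- by rewrite !contrD IH1 IH2 opprD.
- by rewrite !contrZ IH scalerN.
- rewrite !contr_gen !contrD !contrN !contrZ !contr_gen IH wedgeNr.
  by rewrite opprK opprD opprB addrA addrAC.
Qed.

Lemma is_degP k u : is_deg k u <-> forall S, #|S| != k -> u S = 0.
Proof.
split=> [du S Sk|du S uS]; last by apply/eqP/negPn/negP => /du/eqP; rewrite (negbTE uS).
by apply/eqP/negPn/negP => /du/eqP; rewrite (negbTE Sk).
Qed.

Lemma is_deg_hat k u : is_deg k u -> hat u = (-1) ^+ k *: u.
Proof.
move/is_degP => du; apply/ffunP => S; rewrite extZE hatE.
by have [->//|/du->] := eqVneq #|S| k; rewrite !mulr0.
Qed.

Lemma is_deg0 k : is_deg k (0 : E).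
Proof. by apply/is_degP => S _; rewrite ext0E. Qed.

Lemma is_degD k u v : is_deg k u -> is_deg k v -> is_deg k (u + v).
Proof.
by move=> /is_degP du /is_degP dv; apply/is_degP => S Sk; rewrite extDE du ?dv ?addr0.
Qed.

Lemma is_degZ k (c : C) u : is_deg k u -> is_deg k (c *: u).
Proof. by move=> /is_degP du; apply/is_degP => S Sk; rewrite extZE du ?mulr0. Qed.

Lemma is_degN k u : is_deg k u -> is_deg k (- u).
Proof. by rewrite -scaleN1r; apply: is_degZ. Qed.

Lemma is_deg_sum (J : Type) (l : seq J) (P : pred J) (F : J -> E) k :
  (forall i, P i -> is_deg k (F i)) -> is_deg k (\sum_(i <- l | P i) F i).
Proof.
by move=> FP; elim/big_ind: _ => //; [exact: is_deg0|exact: is_degD].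
Qed.

Lemma is_deg_ext1 : is_deg 0 (ext1 : E).
Proof.
by apply/is_degP => S; rewrite ffunE cards_eq0 => /negbTE->.
Qed.

Lemma is_deg_gen k s u : is_deg k u -> is_deg k.+1 (wedge (gen s) u).
Proof.
move=> /is_degP du; apply/is_degP => S Sk; rewrite wedge_genE.
case: ifP => // sS; rewrite du ?mulr0 //.
by apply: contra Sk => /eqP<-; rewrite (cardsD1 s S) sS.
Qed.

Lemma is_deg_contr k s u : is_deg k.+1 u -> is_deg k (contr s u).
Proof.
move=> /is_degP du; apply/is_degP => S Sk; rewrite contrE.
case: ifPn => // sS; rewrite du ?mulr0 //.
by rewrite cardsU1 sS add1n eqSS.
Qed.

Lemma is_deg0_contr s u : is_deg 0 u -> contr s u = 0.
Proof.
move=> /is_degP du; apply/ffunP => S; rewrite contrE ext0E.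
by case: ifPn => // sS; rewrite du ?mulr0 // cardsU1 sS.
Qed.

Lemma is_deg0E u : is_deg 0 u -> u = (u finset.set0 : C) *: ext1.
Proof.
move=> /is_degP du; apply/ffunP => S; rewrite extZE ffunE.
case: eqVneq => [->|S0]; first by rewrite mulr1.
by rewrite [RHS]mulr0 du ?cards_eq0.
Qed.

Lemma is_deg_over k u : is_deg k u -> (n + n < k)%N -> u = 0.
Proof.
move=> /is_degP du nk; apply/ffunP => S; rewrite ext0E du //.
rewrite neq_ltn (leq_ltn_trans _ nk) //.
by rewrite -[leqRHS]card_ord max_card.
Qed.

Lemma is_deg_wedge k l u v : is_deg k u -> is_deg l v -> is_deg (k + l) (wedge u v).
Proof.
move=> /is_degP du /is_degP dv; apply/is_degP => S Skl; rewrite wedgeE.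
apply: big1 => A AS; have [Ak|/du->] := eqVneq #|A| k; last by rewrite mul0r mulr0.
rewrite dv ?mulr0 //; apply: contra Skl => /eqP<-.
by rewrite cardsD (finset.setIidPr AS) -Ak subnKC // subset_leq_card.
Qed.

(** Each coefficient [u S] is recovered once for every element of [S]. This identity is what lowers
    the degree in the inductions of [prim_wedge0] and [inner_ge0]. *)
Lemma number k u : is_deg k u -> \sum_s wedge (gen s) (contr s u) = k%:R *: u.
Proof.
move=> /is_degP du; apply/ffunP => S; rewrite extZE ext_sumE.
have [Sk|Sk] := eqVneq #|S| k; last first.
  rewrite du // mulr0 big1 // => s _; rewrite wedge_genE.
  by case: ifP => // sS; rewrite contrE !inE eqxx /= finset.setD1K // du ?mulr0.
rewrite (eq_bigr (fun s => if s \in S then u S else 0)).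
  by rewrite -big_mkcond /= sumr_const Sk mulr_natl.
move=> s _; rewrite wedge_genE; case: ifP => // sS.
by rewrite contrE !inE eqxx /= finset.setD1K // mulrA shuffle_signK mul1r.
Qed.

Lemma enum_min (m : I) S : (forall x, x \in S -> (m < x)%N) ->
  enum (m |: S) = m :: enum S.
Proof.
move=> mS; have srt A : sorted (fun x y : I => x < y)%N (enum A).
  rewrite /enum_mem; apply: sorted_filter; first by move=> ? ? ?; apply: ltn_trans.
  have := iota_ltn_sorted 0 (n + n); rewrite -val_enum_ord sorted_map -enumT; exact.
apply: (irr_sorted_eq (leT := fun x y : I => (x < y)%N)) => //.
- by move=> ? ? ?; apply: ltn_trans.
- by move=> x; rewrite ltnn.
- rewrite /= path_min_sorted //; apply/allP => x; rewrite mem_enum; exact: mS.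
- by move=> x; rewrite inE !mem_enum !inE.
Qed.

Lemma bar_lshift (a : 'I_n) : bar (lshift n a) = rshift n a.
Proof. by rewrite /bar (unsplitK (inl a)). Qed.

Lemma bar_rshift (a : 'I_n) : bar (rshift n a) = lshift n a.
Proof. by rewrite /bar (unsplitK (inr a)). Qed.

Lemma barK : involutive (@bar n).
Proof. by move=> s; case: (split_ordP s) => a ->; rewrite ?(bar_lshift, bar_rshift). Qed.

(** Conjugation is split into an antilinear action on coefficients and the linear substitution
    [bar_subst], because [intertwine] speaks of linear maps. *)
Definition conj_coef u : E := [ffun S => ((u S : C)^*)%R].
Definition bar_subst u : E := ext_subst (fun s => gen (bar s)) u.

Lemma bar_subst_is_linear : linear bar_subst.
Proof.
move=> c u v; rewrite /bar_subst /ext_subst scaler_sumr -big_split /=.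
by apply: eq_bigr => S _; rewrite extDE extZE scalerDl scalerA.
Qed.

HB.instance Definition _ := GRing.isLinear.Build C E E *:%R bar_subst
  bar_subst_is_linear.

Lemma bar_subst_ebasis S :
  bar_subst (ebasis S) = \big[wedge/ext1]_(s <- enum S) gen (bar s).
Proof.
rewrite /bar_subst /ext_subst (bigD1 S) //= ebasisE eqxx scale1r big1 ?addr0 //.
by move=> T TS; rewrite ebasisE (negbTE TS) scale0r.
Qed.

Lemma bar_subst_gen s u :
  bar_subst (wedge (gen s) u) = wedge (gen (bar s)) (bar_subst u).
Proof.
apply: (@intertwine _ _ _ bar_subst (fun s => wedge (gen (bar s)))).
  by move=> *; apply: gen_anti.
by move=> m S mS; rewrite [LHS]bar_subst_ebasis enum_min // big_cons -bar_subst_ebasis.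
Qed.

Lemma econjE u : econj u = bar_subst (conj_coef u). Proof. by []. Qed.

Lemma econjD u v : econj (u + v) = econj u + econj v.
Proof.
rewrite !econjE -linearD; congr bar_subst.
by apply/ffunP => S; rewrite !ffunE rmorphD.
Qed.

Lemma econjZ (c : C) u : econj (c *: u) = (c^*)%R *: econj u.
Proof.
rewrite !econjE -linearZ; congr bar_subst.
by apply/ffunP => S; rewrite !ffunE rmorphM.
Qed.

Lemma is_deg_econj k u : is_deg k u -> is_deg k (econj u).
Proof.
move=> /is_degP du; rewrite econjE (ext_expand (conj_coef u)) linear_sum /=.
apply: is_deg_sum => S _; rewrite linearZ /= ffunE bar_subst_ebasis.
have [<-|/du->] := eqVneq #|S| k; last by rewrite conjC0 scale0r; exact: is_deg0.
apply: is_degZ; rewrite cardE; elim: (enum _) => [|s l IH].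
  by rewrite big_nil; exact: is_deg_ext1.
by rewrite big_cons; exact: is_deg_gen.
Qed.

#[local] Opaque econj.

Lemma econj0 : econj 0 = 0 :> E.
Proof. by have := econjZ 0 0; rewrite conjC0 !scale0r. Qed.

Lemma econjN u : econj (- u) = - econj u.
Proof. by rewrite -scaleN1r econjZ rmorphN1 scaleN1r. Qed.

Lemma econj_sum (J : Type) (l : seq J) (P : pred J) (F : J -> E) :
  econj (\sum_(i <- l | P i) F i) = \sum_(i <- l | P i) econj (F i).
Proof. exact: (big_morph econj econjD econj0). Qed.

Lemma econj1 : econj ext1 = ext1 :> E.
Proof.
rewrite econjE (_ : conj_coef ext1 = ext1) ?bar_subst_ebasis ?enum_set0 ?big_nil //.
by apply/ffunP => S; rewrite !ffunE conjC_nat.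
Qed.

Lemma econj_gen s u : econj (wedge (gen s) u) = wedge (gen (bar s)) (econj u).
Proof.
rewrite !econjE -bar_subst_gen; congr bar_subst; apply/ffunP => S.
rewrite ffunE !wedge_genE ffunE; case: ifP => _; last exact: conjC0.
by rewrite rmorphM rmorphXn rmorphN1.
Qed.

Lemma econjM u v : econj (wedge u v) = wedge (econj u) (econj v).
Proof.
elim/(@ext_ind R n): u => [|u1 u2 IH1 IH2|c u IH|s u IH].
- by rewrite econj1 !wedge1l.
- by rewrite wedgeDl !econjD wedgeDl IH1 IH2.
- by rewrite wedgeZl !econjZ wedgeZl IH.
- by rewrite -wedgeA !econj_gen IH wedgeA.
Qed.

Lemma econjK : involutive (@econj R n).
Proof.
elim/(@ext_ind R n) => [|u1 u2 IH1 IH2|c u IH|s u IH].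
- by rewrite !econj1.
- by rewrite (econjD u1) (econjD (econj u1)); congr (_ + _).
- by rewrite !econjZ conjCK IH.
- by rewrite !econj_gen barK IH.
Qed.

Lemma econj_contr s u : econj (contr s u) = contr (bar s) (econj u).
Proof.
elim/(@ext_ind R n): u => [|u1 u2 IH1 IH2|c u IH|t u IH].
- by rewrite econj1 !contr1 econj0.
- by rewrite econjD !contrD econjD IH1 IH2.
- by rewrite econjZ !contrZ econjZ IH.
- rewrite econj_gen !contr_gen econjD econjZ econjN econj_gen IH conjC_nat.
  by rewrite (inj_eq (can_inj barK)).
Qed.

End GradedAlgebra.

(** * The inner product on forms and the adjoint of a generator *)

Section Inner.
Context {R : realType} {n : nat}.
Local Notation C := R[i].
Local Notation E := (ext R n).
Local Notation I := 'I_(n + n).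
Implicit Types (u v : E) (s t r : I) (S T A B D : {set I}).

Variable w : E.
Local Notation G := (gram w).

Lemma inner_is_linear v : linear_for *%R (fun u => inner w u v : C).
Proof.
move=> c u1 u2; rewrite /inner mulr_sumr -big_split /=; apply: eq_bigr => S _.
rewrite mulr_sumr -big_split /=; apply: eq_bigr => T _.
by rewrite extDE extZE !mulrDl !mulrA.
Qed.

Lemma innerDl u1 u2 v : inner w (u1 + u2) v = inner w u1 v + inner w u2 v.
Proof. by have := inner_is_linear v 1 u1 u2; rewrite scale1r mul1r. Qed.

Lemma inner0l v : inner w 0 v = 0.
Proof. by rewrite /inner big1 // => S _; rewrite big1 // => T _; rewrite ext0E !mul0r. Qed.

Lemma innerZl (c : C) u v : inner w (c *: u) v = c * inner w u v.
Proof. by have := inner_is_linear v c u 0; rewrite inner0l !addr0. Qed.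

Lemma inner_suml (J : Type) (l : seq J) (P : pred J) (F : J -> E) v :
  inner w (\sum_(i <- l | P i) F i) v = \sum_(i <- l | P i) inner w (F i) v.
Proof. exact: (big_morph (fun u => inner w u v) (fun x y => innerDl x y v) (inner0l v)). Qed.

Lemma innerDr u v1 v2 : inner w u (v1 + v2) = inner w u v1 + inner w u v2.
Proof.
rewrite /inner -big_split /=; apply: eq_bigr => S _.
rewrite -big_split /=; apply: eq_bigr => T _.
by rewrite extDE rmorphD mulrDr mulrDl.
Qed.

Lemma innerZr (c : C) u v : inner w u (c *: v) = (c^*)%R * inner w u v.
Proof.
rewrite /inner mulr_sumr; apply: eq_bigr => S _.
rewrite mulr_sumr; apply: eq_bigr => T _.
have sh (a b x y : C) : a * (x * b) * y = x * (a * b * y) by ring.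
by rewrite extZE rmorphM; exact: sh.
Qed.

Lemma inner0r u : inner w u 0 = 0.
Proof. by have := innerZr 0 u 0; rewrite conjC0 scale0r mul0r. Qed.

Lemma inner_sumr (J : Type) (l : seq J) (P : pred J) (F : J -> E) u :
  inner w u (\sum_(i <- l | P i) F i) = \sum_(i <- l | P i) inner w u (F i).
Proof. exact: (big_morph (inner w u) (innerDr u) (inner0r u)). Qed.

Lemma inner_ebasis S T : inner w (ebasis S) (ebasis T) = inner_basis w S T.
Proof.
rewrite /inner (bigD1 S) //= [X in _ + X]big1 ?addr0; last first.
  by move=> A AS; rewrite big1 // => B _; rewrite ebasisE (negbTE AS) !mul0r.
rewrite (bigD1 T) //= big1 ?addr0; last first.
  by move=> A AS; rewrite [ebasis T A]ebasisE (negbTE AS) conjC0 mulr0 mul0r.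
by rewrite !ebasisE !eqxx conjC1 !mul1r.
Qed.

Lemma inner_basis00 : inner_basis w finset.set0 finset.set0 = 1.
Proof.
rewrite /inner_basis eqxx.
suff det0 k (M : 'M[C]_k) : k = 0%N -> \det M = 1 by apply: det0; rewrite cards0.
by move=> k0; move: M; rewrite k0 => M; exact: det_mx00.
Qed.

(** The adjoint of left multiplication by [gen s], as [inner_gen] shows; the Gram entries are
    conjugated since [inner] is antilinear in its second argument. *)
Definition adj s v : E := \sum_t ((G s t)^*)%R *: contr t v.

Lemma adjE s v : adj s v = \sum_t ((G s t)^*)%R *: contr t v. Proof. by []. Qed.

Lemma adjD s u v : adj s (u + v) = adj s u + adj s v.
Proof.
rewrite -big_split; apply: eq_bigr => t _ /=.
by rewrite contrD scalerDr.
Qed.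

Lemma adjZ s (c : C) v : adj s (c *: v) = c *: adj s v.
Proof.
rewrite scaler_sumr; apply: eq_bigr => t _ /=.
by rewrite contrZ !scalerA mulrC.
Qed.

Lemma adj0 s : adj s 0 = 0.
Proof. by have := adjZ s 0 0; rewrite !scale0r. Qed.

Lemma adj_sum s (J : Type) (l : seq J) (P : pred J) (F : J -> E) :
  adj s (\sum_(i <- l | P i) F i) = \sum_(i <- l | P i) adj s (F i).
Proof. exact: (big_morph _ (adjD s) (adj0 s)). Qed.

Lemma contr_adj r s v : contr r (adj s v) = - adj s (contr r v).
Proof.
rewrite contr_sum -sumrN; apply: eq_bigr => t _.
by rewrite contrZ contr_anti scalerN.
Qed.

Lemma adj_anti s t v : adj s (adj t v) = - adj t (adj s v).
Proof.
rewrite [adj t v in LHS]/adj adj_sum [LHS]/= [adj t _]/adj -sumrN.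
by apply: eq_bigr => r _; rewrite adjZ contr_adj scalerN opprK.
Qed.

Lemma contr_ebasis t T : contr t (ebasis T) =
  (if t \in T then (shuffle_sign [set t] (T :\ t) : C) *: ebasis (T :\ t) else 0) :> E.
Proof.
apply/ffunP => S; rewrite contrE ebasisE.
case: (boolP (t \in T)) => tT; last first.
  rewrite ext0E; case: ifP => // tS; case: eqP => [TS|]; last by rewrite mulr0.
  by move: tT; rewrite -TS !inE eqxx.
rewrite extZE ebasisE; case: (boolP (t \in S)) => tS.
  case: eqP => [ST|]; last by rewrite mulr0.
  by move: tS; rewrite ST !inE eqxx.
case: (eqVneq S (T :\ t)) => [->|ST]; first by rewrite finset.setD1K ?eqxx.
rewrite mulr0; case: eqP => [tST|]; last by rewrite mulr0.
by case/eqP: ST; rewrite -tST setU1K.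
Qed.

Lemma enum_set_sorted A : sorted <%O (enum A).
Proof.
rewrite /enum_mem; apply: sorted_filter; first exact: lt_trans.
have := iota_ltn_sorted 0 (n + n); rewrite -val_enum_ord sorted_map -enumT.
by apply: sub_sorted => x y /=; rewrite ltEord.
Qed.

(** The elements of [T] below [t] are those enumerated before it. The wedge sign thus becomes the
    cofactor sign of a determinant expansion. *)
Lemma shuffle_sign_index t T : t \in T ->
  shuffle_sign [set t] (T :\ t) = (-1) ^+ index t (enum T) :> C.
Proof.
move=> tT; rewrite shuffle_signE; congr (_ ^+ _).
rewrite -[RHS](count_lt_nth t (enum_set_sorted T)) ?index_mem ?mem_enum //.
rewrite nth_index ?mem_enum // -size_filter.
have -> : [set p : I * I | [&& p.1 \in [set t], p.2 \in T :\ t & (p.2 < p.1)%N]]%SET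
  = [set (t, x) | x in [set x in T | (x < t)%N]]%SET.
  apply/setP => -[a b]; rewrite !inE /=; apply/idP/imsetP => [|[x]].
    by move=> /and3P[/eqP-> /andP[_ bT] bt]; exists b; rewrite ?inE ?bT.
  rewrite inE => /andP[xT xt] [-> ->]; rewrite eqxx xT xt !andbT /=.
  by rewrite -val_eqE neq_ltn xt.
rewrite card_imset => [|x y [->] //]; rewrite cardE; apply: perm_size.
apply: uniq_perm; [exact: enum_uniq|exact/filter_uniq/enum_uniq|move=> x].
by rewrite [RHS]mem_filter !mem_enum !inE andbC ltEord.
Qed.

(** Laplace expansion of the Gram determinant along its first row, which is the row of [m] since [m]
    is minimal. *)
Lemma inner_basis_min (m : I) S v : (forall x, x \in S -> (m < x)%N) ->
  inner w (ebasis (m |: S)) v = inner w (ebasis S) (adj m v).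
Proof.
move=> mS; rewrite (ext_expand v) adj_sum !inner_sumr; apply: eq_bigr => T _.
rewrite adjZ !innerZr; congr (_ * _) => {v}.
rewrite inner_sumr inner_ebasis.
have mnS : m \notin S by apply/negP => /mS; rewrite ltnn.
rewrite (eq_bigr (fun t => if t \in T then
   G m t * ((-1) ^+ index t (enum T) * inner_basis w S (T :\ t)) else 0)); last first.
  move=> t _; rewrite innerZr conjCK contr_ebasis; case: ifP => tT.
    by rewrite innerZr inner_ebasis shuffle_sign_index // rmorphXn rmorphN1.
  by rewrite inner0r mulr0.
rewrite -big_mkcond /= {1}/inner_basis.
have cS : #|m |: S| = #|S|.+1 by rewrite cardsU1 mnS.
case: (boolP (#|m |: S| == #|T|)) => [/eqP ST|ST]; last first.
  rewrite big1 // => t tT; rewrite cS (cardsD1 t T) tT eqSS in ST.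
  by rewrite /inner_basis (negbTE ST) !mulr0.
(* Indexing by lists with one common default makes deleting a column the same as deleting a list
   entry, so the minors are again Gram determinants. *)
pose gdet k l1 l2 := \det (\matrix_(i < k, j < k) G (nth m l1 i) (nth m l2 j)).
have gdetE A B : #|A| = #|B| -> \det (\matrix_(i < #|A|, j < #|A|)
      G (enum_val i) (nth (enum_val i) (enum B) j)) = gdet #|A| (enum A) (enum B).
  move=> AB; congr (\det _); apply/matrixP => i j; rewrite [LHS]mxE [RHS]mxE; congr (G _ _).
    by rewrite /enum_val; apply: set_nth_default; rewrite -cardE.
  by apply: set_nth_default; rewrite -cardE -AB.
transitivity (gdet #|S|.+1 (m :: enum S) (enum T)).
  by rewrite gdetE // cS enum_min.
rewrite cS in ST.
rewrite /gdet (expand_det_row _ ord0) -[RHS]big_enum [RHS](big_nth m) -cardE -ST big_mkord.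
apply: eq_bigr => j _; have jT : (j < size (enum T))%N by rewrite -cardE -ST.
have tT : nth m (enum T) j \in T by rewrite -mem_enum mem_nth.
rewrite mxE /= /cofactor add0n index_uniq ?enum_uniq //; congr (_ * (_ * _)).
have STj : #|S| = #|T :\ nth m (enum T) j|.
  by move: (ST); rewrite (cardsD1 (nth m (enum T) j) T) tT => -[].
rewrite /inner_basis -STj eqxx gdetE // /gdet; congr (\det _); apply/matrixP => i k.
rewrite 3![LHS]mxE [RHS]mxE /=; congr (G _ _).
have -> : enum (T :\ nth m (enum T) j) = take j (enum T) ++ drop j.+1 (enum T).
  rewrite -[in take j _](index_uniq m jT (enum_uniq _)).
  rewrite -[in drop j.+1 _](index_uniq m jT (enum_uniq _)) -remE.
  rewrite rem_filter ?enum_uniq // /enum_mem -filter_predI.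
  by apply: eq_filter => x; rewrite /= !inE.
rewrite nth_cat size_take jT; case: (ltnP k j) => kj.
  by rewrite nth_take // /bump leqNgt kj.
by rewrite nth_drop /bump kj addSn subnKC.
Qed.

#[local] Opaque inner.

(** For [intertwine], the inner product is read as a linear map from its first argument to functions
    of the second, on which adjoints act by precomposition. *)
Let inner_fun u : E -> C^o := fun v => inner w u v.

Let inner_fun_is_linear : linear inner_fun.
Proof. by move=> c u1 u2; apply/funext => v; rewrite /inner_fun innerDl innerZl. Qed.

HB.instance Definition _ := GRing.isLinear.Build C E (E -> C^o) *:%R
  inner_fun inner_fun_is_linear.

Let adj_fun s (f : E -> C^o) : E -> C^o := fun v => f (adj s v).

Let adj_fun_is_linear s : linear (adj_fun s).
Proof. by move=> c f g; apply/funext. Qed.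

HB.instance Definition _ s := GRing.isLinear.Build C (E -> C^o) (E -> C^o) *:%R
  (adj_fun s) (adj_fun_is_linear s).

Lemma inner_gen s u v : inner w (wedge (gen s) u) v = inner w u (adj s v).
Proof.
rewrite -[RHS]/(adj_fun s (inner_fun u) v).
rewrite -(@intertwine _ _ _ inner_fun adj_fun) // => [r t f|m S mS].
  apply/funext => x; rewrite -[LHS]/(inner w f (adj t (adj r x))).
  rewrite -[RHS]/(- inner w f (adj r (adj t x))) adj_anti.
  by rewrite -scaleN1r innerZr rmorphN1 mulN1r.
by apply/funext => x; apply: inner_basis_min.
Qed.

End Inner.
#[local] Opaque inner econj hat adj.

(** * Bidegrees *)

Section Types.
Context {R : realType} {n : nat}.
Local Notation C := R[i].
Local Notation E := (ext R n).
Local Notation I := 'I_(n + n).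
Implicit Types (u v : E) (s t r : I) (S T A B D : {set I}).

Definition is_hol s : bool := if fintype.split s is inl _ then true else false.

Lemma is_hol_lshift (a : 'I_n) : is_hol (lshift n a) = true.
Proof. by rewrite /is_hol (unsplitK (inl a)). Qed.

Lemma is_hol_rshift (a : 'I_n) : is_hol (rshift n a) = false.
Proof. by rewrite /is_hol (unsplitK (inr a)). Qed.

Lemma hol_degE S : hol_deg S = (\sum_(s in S) is_hol s)%N.
Proof.
rewrite big_mkcond big_split_ord /= [X in (_ + X)%N]big1 ?addn0; last first.
  by move=> a _; rewrite is_hol_rshift; case: ifP.
rewrite /hol_deg -sum1_card big_mkcond; apply: eq_bigr => a _.
rewrite is_hol_lshift; congr (if _ then _ else _).
by apply/idP/idP => [/set_mem|/mem_set].
Qed.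

Lemma antihol_degE S : antihol_deg S = (\sum_(s in S) ~~ is_hol s)%N.
Proof.
rewrite big_mkcond big_split_ord /= [X in (X + _)%N]big1 ?add0n; last first.
  by move=> a _; rewrite is_hol_lshift; case: ifP.
rewrite /antihol_deg -sum1_card big_mkcond; apply: eq_bigr => a _.
rewrite is_hol_rshift; congr (if _ then _ else _).
by apply/idP/idP => [/set_mem|/mem_set].
Qed.

Lemma hol_antihol_deg S : (hol_deg S + antihol_deg S)%N = #|S|.
Proof.
rewrite hol_degE antihol_degE -big_split -sum1_card /=.
by apply: eq_bigr => s _; case: is_hol.
Qed.

Lemma is_typeP p q u :
  is_type p q u <-> forall S, ~~ ((hol_deg S == p) && (antihol_deg S == q)) -> u S = 0.
Proof.
split=> [tu S|tu S uS].
  by apply: contraNeq => /tu[-> ->]; rewrite !eqxx.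
by have [/andP[/eqP-> /eqP->]//|/tu uS0] :=
  boolP ((hol_deg S == p) && (antihol_deg S == q)); rewrite uS0 eqxx in uS.
Qed.

Lemma is_type_deg p q u : is_type p q u -> is_deg (p + q) u.
Proof. by move=> tu S /tu[<- <-]; rewrite hol_antihol_deg. Qed.

Lemma is_type0 p q : is_type p q (0 : E).
Proof. by apply/is_typeP => S _; rewrite ext0E. Qed.

Lemma is_typeD p q u v : is_type p q u -> is_type p q v -> is_type p q (u + v).
Proof.
by move=> /is_typeP tu /is_typeP tv; apply/is_typeP => S Sk; rewrite extDE tu ?tv ?addr0.
Qed.

Lemma is_typeZ p q (c : C) u : is_type p q u -> is_type p q (c *: u).
Proof. by move=> /is_typeP tu; apply/is_typeP => S Sk; rewrite extZE tu ?mulr0. Qed.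

Lemma is_typeN p q u : is_type p q u -> is_type p q (- u).
Proof. by rewrite -scaleN1r; apply: is_typeZ. Qed.

Lemma is_type_sum p q (J : Type) (l : seq J) (P : pred J) (F : J -> E) :
  (forall i, P i -> is_type p q (F i)) -> is_type p q (\sum_(i <- l | P i) F i).
Proof.
by move=> FP; elim/big_ind: _ => //; [exact: is_type0|exact: is_typeD].
Qed.

Lemma is_type_wedge p q p' q' u v : is_type p q u -> is_type p' q' v ->
  is_type (p + p') (q + q') (wedge u v).
Proof.
move=> /is_typeP tu /is_typeP tv; apply/is_typeP => S SN.
rewrite wedgeE big1 // => A AS.
have [/andP[/eqP hA /eqP aA]|/tu->] :=
  boolP ((hol_deg A == p) && (antihol_deg A == q)); last by rewrite mul0r mulr0.
rewrite tv ?mul0r ?mulr0 //; apply: contra SN => /andP[/eqP hD /eqP aD].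
rewrite -hA -aA -hD -aD !hol_degE !antihol_degE.
by rewrite (big_setID A) (finset.setIidPr AS) /= eqxx /= (big_setID A)
  (finset.setIidPr AS) /= eqxx.
Qed.

Lemma is_type_genl (a : 'I_n) : is_type 1 0 (gen (lshift n a) : E).
Proof.
move=> S; rewrite ebasisE; have [-> _|] := eqVneq S; last by rewrite eqxx.
by rewrite hol_degE antihol_degE !big_set1 is_hol_lshift.
Qed.

Lemma is_type_genr (a : 'I_n) : is_type 0 1 (gen (rshift n a) : E).
Proof.
move=> S; rewrite ebasisE; have [-> _|] := eqVneq S; last by rewrite eqxx.
by rewrite hol_degE antihol_degE !big_set1 is_hol_rshift.
Qed.

Lemma is_type_contrl (a : 'I_n) p q u : is_type p.+1 q u -> is_type p q (contr (lshift n a) u).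
Proof.
move=> /is_typeP tu; apply/is_typeP => S SN; rewrite contrE.
case: ifPn => // aS; rewrite tu ?mulr0 //; apply: contra SN.
by rewrite !hol_degE !antihol_degE !big_setU1 //= is_hol_lshift add1n eqSS add0n.
Qed.

Lemma is_type_contrr (a : 'I_n) p q u : is_type p q.+1 u -> is_type p q (contr (rshift n a) u).
Proof.
move=> /is_typeP tu; apply/is_typeP => S SN; rewrite contrE.
case: ifPn => // aS; rewrite tu ?mulr0 //; apply: contra SN.
by rewrite !hol_degE !antihol_degE !big_setU1 //= is_hol_rshift add1n eqSS add0n.
Qed.

Lemma type_part_id p q u : is_type p q u -> type_part p q u = u.
Proof.
by move=> /is_typeP tu; apply/ffunP => S; rewrite ffunE; case: ifPn => // /tu.
Qed.

Lemma type_part_eq0 p q p' q' u : is_type p' q' u -> (p, q) != (p', q') ->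
  type_part p q u = 0.
Proof.
move=> /is_typeP tu pq; apply/ffunP => S; rewrite ffunE ext0E.
case: ifPn => // /andP[/eqP hS /eqP aS]; apply: tu; rewrite hS aS.
by rewrite -xpair_eqE.
Qed.

Lemma type_partD p q u v : type_part p q (u + v) = type_part p q u + type_part p q v.
Proof.
by apply/ffunP => S; rewrite extDE !ffunE; case: ifP; rewrite ?addr0.
Qed.

Lemma bideg11P S : hol_deg S = 1%N -> antihol_deg S = 1%N ->
  exists a b, S = lshift n a |: [set rshift n b].
Proof.
move=> hS aS.
have [a aSa] : exists a, lshift n a \in S.
  move/eqP: hS; rewrite hol_degE big_mkcond big_split_ord /=.
  rewrite [X in (_ + X)%N]big1 => [|a _]; last by rewrite is_hol_rshift; case: ifP.
  rewrite addn0 => h; apply/existsP; apply: contraLR isT => /existsPn aN.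
  by rewrite big1 // in h => a _; rewrite (negbTE (aN a)).
have [b bSb] : exists b, rshift n b \in S.
  move/eqP: aS; rewrite antihol_degE big_mkcond big_split_ord /=.
  rewrite [X in (X + _)%N]big1 => [|b _]; last by rewrite is_hol_lshift; case: ifP.
  rewrite add0n => h; apply/existsP; apply: contraLR isT => /existsPn bN.
  by rewrite big1 // in h => b _; rewrite (negbTE (bN b)).
exists a, b; apply/esym/eqP; rewrite eqEcard finset.subUset !finset.sub1set aSa bSb /=.
by rewrite -hol_antihol_deg hS aS cardsU1 cards1 inE eq_lrshift.
Qed.

End Types.
Arguments divpow : simpl never.

(** * Hermitian forms and Lefschetz operators *)

Section HermitianForm.
Context {R : realType} {n : nat}.
Local Notation C := R[i].
Local Notation E := (ext R n).
Local Notation I := 'I_(n + n).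
Implicit Types (u v : E) (s t r : I) (S T A B D : {set I}).

Variable w : E.
Hypothesis w11 : is_type 1 1 w.
Hypothesis w_real : econj w = w.
(** Invertibility is the nonvanishing of a determinant, hence the condition that can be propagated
    from omega to omega + t gamma for small [t]. *)
Hypothesis w_unit : herm_mx w \in unitmx.

Local Notation H := (herm_mx w).
Local Notation K := (invmx (herm_mx w)).
Local Notation G := (gram w).

Lemma gram_ll (a c : 'I_n) : G (lshift n a) (lshift n c) = K c a.
Proof. by rewrite block_mxEul mxE. Qed.
Lemma gram_lr (a c : 'I_n) : G (lshift n a) (rshift n c) = 0.
Proof. by rewrite block_mxEur mxE. Qed.
Lemma gram_rl (a c : 'I_n) : G (rshift n a) (lshift n c) = 0.
Proof. by rewrite block_mxEdl mxE. Qed.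
Lemma gram_rr (a c : 'I_n) : G (rshift n a) (rshift n c) = K a c.
Proof. by rewrite block_mxEdr. Qed.

Lemma form11_expand v : is_type 1 1 v ->
  v = \sum_a \sum_b ('i * herm_mx v a b) *: wedge (gen (lshift n a)) (gen (rshift n b)).
Proof.
move=> tv.
have ab_enum (a b : 'I_n) : wedge (gen (lshift n a)) (gen (rshift n b)) =
    ebasis (lshift n a |: [set rshift n b]) :> E.
  rewrite -ebasis_min // => x; rewrite inE => /eqP->.
  by rewrite /= ltn_addr.
apply/ffunP => S; rewrite ext_sumE.
rewrite (eq_bigr (fun a => \sum_b ('i * herm_mx v a b) *
   (S == lshift n a |: [set rshift n b])%:R)); last first.
  move=> a _; rewrite ext_sumE; apply: eq_bigr => b _.
  by rewrite ab_enum extZE ebasisE.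
have [/andP[/eqP hS /eqP aS]|SN] := boolP ((hol_deg S == 1%N) && (antihol_deg S == 1%N)).
  have [a [b Sab]] := bideg11P hS aS.
  have inj (a' b' : 'I_n) : (S == lshift n a' |: [set rshift n b']) = (a == a') && (b == b').
    apply/eqP/andP => [SE|[/eqP<- /eqP<-]//]; split.
      have : lshift n a \in S by rewrite Sab !inE eqxx.
      by rewrite SE !inE eq_lshift eq_lrshift orbF.
    have : rshift n b \in S by rewrite Sab !inE eqxx orbT.
    by rewrite SE !inE eq_rlshift eq_rshift.
  rewrite (bigD1 a) //= [X in _ + X]big1 ?addr0 => [|c ca]; last first.
    by apply: big1 => d _; rewrite inj eq_sym (negbTE ca) mulr0.
  rewrite (bigD1 b) //= big1 ?addr0 => [|c ca]; last first.
    by rewrite inj [b == _]eq_sym (negbTE ca) andbF mulr0.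
  by rewrite inj !eqxx mulr1 mxE Sab mulrA mulrN -expr2 sqrCi opprK mul1r.
rewrite (proj1 (is_typeP _ _ _) tv) // big1 // => a _; rewrite big1 // => b _.
case: eqP => [SE|]; last by rewrite mulr0.
case/negP: SN; rewrite hol_degE antihol_degE SE.
rewrite !big_setU1 ?inE ?eq_lrshift //= !big_set1 is_hol_lshift is_hol_rshift //.
Qed.

Let conj_iM (x : C) : (('i * x)^* = - ('i * x^*))%R.
Proof. by rewrite -mulNr -conjCi; apply: rmorphM. Qed.

Let conjN (x : C) : ((- x)^* = - x^*)%R.
Proof. exact: rmorphN. Qed.

Lemma herm_conj (a b : 'I_n) : ((H a b)^*)%R = H b a.
Proof.
have h c d : 'i * H d c = 'i * ((H c d)^*)%R.
  (* [ev] reads off the coefficient of dz_d /\ dzbar_c. *)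
  pose ev (u : E) := contr (rshift n c) (contr (lshift n d) u) finset.set0 : C.
  have evD u v : ev (u + v) = ev u + ev v by rewrite /ev contrD contrD extDE.
  have ev0 : ev 0 = 0 by rewrite /ev contr0 contr0 ext0E.
  have evZ (k : C) u : ev (k *: u) = k * ev u by rewrite /ev contrZ contrZ extZE.
  have evb (a' b' : 'I_n) : ev (wedge (gen (lshift n a')) (gen (rshift n b'))) =
      ((d == a') && (c == b'))%:R.
    rewrite /ev -[gen (rshift n b')]wedge1r contr_gen contr_gen contr1 wedge0r subr0.
    rewrite eq_lrshift scale0r wedge0r subr0 contrZ contr_gen contr1 wedge0r subr0.
    rewrite !extZE ebasisE eqxx mulr1 eq_lshift eq_rshift -natrM mulnb //.
  have evsum (F : 'I_n -> 'I_n -> C) :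
      ev (\sum_a' \sum_b' F a' b' *: wedge (gen (lshift n a')) (gen (rshift n b'))) = F d c.
    rewrite (big_morph ev evD ev0) (bigD1 d) //= [X in _ + X]big1 ?addr0; last first.
      move=> i id; rewrite (big_morph ev evD ev0) big1 // => k _.
      by rewrite evZ evb eq_sym (negbTE id) mulr0.
    rewrite (big_morph ev evD ev0) (bigD1 c) //= big1 ?addr0; last first.
      by move=> i id; rewrite evZ evb [c == _]eq_sym (negbTE id) andbF mulr0.
    by rewrite evZ evb !eqxx mulr1.
  have := congr1 ev w_real; rewrite [in RHS](form11_expand w11) evsum => <-.
  rewrite [in LHS](form11_expand w11) econj_sum.
  rewrite (eq_bigr (fun a' => \sum_b' ('i * ((H a' b')^*)%R) *:
     wedge (gen (lshift n b')) (gen (rshift n a')))); last first.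
    move=> a' _; rewrite econj_sum; apply: eq_bigr => b' _.
    rewrite econjZ conj_iM -[gen (rshift n b')]wedge1r econj_gen econj_gen.
    by rewrite bar_lshift bar_rshift econj1 gen_anti scalerN !wedge1r scaleNr opprK.
  by rewrite exchange_big evsum.
by apply/esym/(mulfI (neq0Ci C)); rewrite h.
Qed.

Lemma herm_inv_conj (a b : 'I_n) : ((K a b)^*)%R = K b a.
Proof.
have HT : map_mx Num.conj H = H^T by apply/matrixP => c d; rewrite mxE [RHS]mxE herm_conj.
have := congr1 (fun M : 'M[C]_n => M a b) (map_invmx Num.conj H).
by rewrite HT mxE => ->; rewrite -trmx_inv mxE.
Qed.

Lemma adj_lshift (a : 'I_n) v :
  adj w (lshift n a) v = \sum_c K a c *: contr (lshift n c) v.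
Proof.
rewrite adjE big_split_ord /= [X in _ + X]big1 ?addr0 => [|c _]; last first.
  by rewrite gram_lr conjC0 scale0r.
by apply: eq_bigr => c _; rewrite gram_ll herm_inv_conj.
Qed.

Lemma adj_rshift (b : 'I_n) v :
  adj w (rshift n b) v = \sum_c K c b *: contr (rshift n c) v.
Proof.
rewrite adjE big_split_ord /= [X in X + _]big1 ?add0r => [|c _]; last first.
  by rewrite gram_rl conjC0 scale0r.
by apply: eq_bigr => c _; rewrite gram_rr herm_inv_conj.
Qed.

(** The factor that relates [J s] to the adjoint of [gen s] under conjugation, see [econj_adj]; it
    reflects the factor i in front of the Hermitian matrix of [w]. *)
Definition kap s : C := if is_hol s then 'i else - 'i.
(** The inverse of the matrix of [w] seen as an alternating form, hence alternating itself
    ([jmx_anti]). *)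
Definition jmx s t : C := kap s * G s (bar t).
(* The contraction characterised by [J s w = gen s]. *)
Definition J s u : E := \sum_t jmx s t *: contr t u.

Lemma JD s u v : J s (u + v) = J s u + J s v.
Proof. by rewrite -big_split; apply: eq_bigr => t _; rewrite contrD scalerDr. Qed.

Lemma JZ s (c : C) u : J s (c *: u) = c *: J s u.
Proof.
by rewrite scaler_sumr; apply: eq_bigr => t _; rewrite contrZ !scalerA mulrC.
Qed.

Lemma J0 s : J s 0 = 0.
Proof. by have := JZ s 0 0; rewrite !scale0r. Qed.

Lemma contr_J r s v : contr r (J s v) = - J s (contr r v).
Proof.
rewrite contr_sum -sumrN; apply: eq_bigr => t _.
by rewrite contrZ contr_anti scalerN.
Qed.

Lemma J_wedge s u v : J s (wedge u v) = wedge (J s u) v + wedge (hat u) (J s v).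
Proof.
rewrite wedge_suml wedge_sumr -big_split; apply: eq_bigr => t _ /=.
by rewrite contr_wedge scalerDr wedgeZl wedgeZr.
Qed.

Lemma jmx_ll (a c : 'I_n) : jmx (lshift n a) (lshift n c) = 0.
Proof. by rewrite /jmx bar_lshift gram_lr mulr0. Qed.
Lemma jmx_rr (a c : 'I_n) : jmx (rshift n a) (rshift n c) = 0.
Proof. by rewrite /jmx bar_rshift gram_rl mulr0. Qed.
Lemma jmx_lr (a b : 'I_n) : jmx (lshift n a) (rshift n b) = 'i * K b a.
Proof. by rewrite /jmx bar_rshift gram_ll /kap is_hol_lshift. Qed.
Lemma jmx_rl (a b : 'I_n) : jmx (rshift n b) (lshift n a) = - ('i * K b a).
Proof. by rewrite /jmx bar_lshift gram_rr /kap is_hol_rshift mulNr. Qed.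

Lemma jmx_anti s t : jmx s t = - jmx t s.
Proof.
case: (split_ordP s) => a ->; case: (split_ordP t) => b ->;
  rewrite ?(jmx_ll, jmx_rr, jmx_lr, jmx_rl) ?opprK ?oppr0 //.
Qed.

Lemma J_lshift (a : 'I_n) u :
  J (lshift n a) u = \sum_b ('i * K b a) *: contr (rshift n b) u.
Proof.
rewrite /J big_split_ord /= big1 ?add0r => [|c _]; last by rewrite jmx_ll scale0r.
by apply: eq_bigr => b _; rewrite jmx_lr.
Qed.

Lemma J_rshift (b : 'I_n) u :
  J (rshift n b) u = - \sum_a ('i * K b a) *: contr (lshift n a) u.
Proof.
rewrite /J big_split_ord /= [X in _ + X]big1 ?addr0 => [|c _]; last by rewrite jmx_rr scale0r.
by rewrite -sumrN; apply: eq_bigr => c _; rewrite jmx_rl scaleNr.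
Qed.

Lemma contrl_form (a : 'I_n) : contr (lshift n a) w = \sum_b ('i * H a b) *: gen (rshift n b).
Proof.
rewrite [in LHS](form11_expand w11) contr_sum (bigD1 a) //= [X in _ + X]big1 ?addr0.
  rewrite contr_sum; apply: eq_bigr => b _.
  rewrite contrZ -[gen (rshift n b) in LHS]wedge1r !contr_gen contr1 wedge0r subr0.
  by rewrite eqxx scale1r eq_lrshift scale0r wedge0r subr0 wedge1r.
move=> c ca; rewrite contr_sum big1 // => b _.
rewrite contrZ -[gen (rshift n b) in LHS]wedge1r !contr_gen contr1 wedge0r subr0.
by rewrite eq_lshift eq_sym (negbTE ca) eq_lrshift !scale0r wedge0r subr0 scaler0.
Qed.

Lemma contrr_form (b : 'I_n) :
  contr (rshift n b) w = - \sum_a ('i * H a b) *: gen (lshift n a).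
Proof.
rewrite [in LHS](form11_expand w11) contr_sum -sumrN; apply: eq_bigr => a _.
rewrite contr_sum (bigD1 b) //= [X in _ + X]big1 ?addr0.
  rewrite contrZ -[gen (rshift n b) in LHS]wedge1r !contr_gen contr1 wedge0r subr0.
  by rewrite eq_rlshift scale0r add0r eqxx scale1r wedge1r scalerN.
move=> c cb; rewrite contrZ -[gen (rshift n c) in LHS]wedge1r !contr_gen contr1 wedge0r subr0.
by rewrite eq_rlshift eq_rshift eq_sym (negbTE cb) !scale0r wedge0r subr0 scaler0.
Qed.

Lemma mulHK (a c : 'I_n) : \sum_b H a b * K b c = (a == c)%:R.
Proof. by have /matrixP/(_ a c) := mulmxV w_unit; rewrite !mxE. Qed.

Lemma mulKH (a c : 'I_n) : \sum_b K a b * H b c = (a == c)%:R.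
Proof. by have /matrixP/(_ a c) := mulVmx w_unit; rewrite !mxE. Qed.

Lemma mulii (x y : C) : ('i * x) * ('i * y) = - (x * y).
Proof. by rewrite mulrACA -expr2 sqrCi mulN1r. Qed.

Lemma sum_delta (F : 'I_n -> E) (a : 'I_n) (d : 'I_n -> C) :
  (forall c, d c = (c == a)%:R) -> \sum_c d c *: F c = F a.
Proof.
move=> dE; rewrite (bigD1 a) //= dE eqxx scale1r big1 ?addr0 // => c ca.
by rewrite dE (negbTE ca) scale0r.
Qed.

Lemma J_form s : J s w = gen s.
Proof.
case: (split_ordP s) => a ->.
  rewrite J_lshift.
  transitivity (\sum_c (\sum_b H c b * K b a) *: gen (lshift n c) : E).
    rewrite (eq_bigr (fun b => \sum_c (H c b * K b a) *: gen (lshift n c))).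
      by rewrite exchange_big; apply: eq_bigr => c _; rewrite scaler_suml.
    move=> b _; rewrite contrr_form scalerN scaler_sumr -sumrN; apply: eq_bigr => c _.
    by rewrite scalerA mulii scaleNr opprK mulrC.
  by apply: sum_delta => c; rewrite mulHK.
rewrite J_rshift.
transitivity (\sum_c (\sum_b K a b * H b c) *: gen (rshift n c) : E).
  rewrite -sumrN (eq_bigr (fun b => \sum_c (K a b * H b c) *: gen (rshift n c))).
    by rewrite exchange_big; apply: eq_bigr => c _; rewrite scaler_suml.
  move=> b _; rewrite contrl_form scaler_sumr -sumrN; apply: eq_bigr => c _.
  by rewrite scalerA mulii scaleNr opprK.
by apply: sum_delta => c; rewrite mulKH eq_sym.
Qed.

Lemma econj_adj s v : J s (econj v) = kap s *: econj (adj w s v).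
Proof.
rewrite adjE econj_sum scaler_sumr /J (reindex_inj (can_inj (@barK n))).
apply: eq_bigr => t _; rewrite econjZ conjCK econj_contr scalerA.
by rewrite /jmx barK.
Qed.

Lemma double_inj u v : u + u = v + v -> u = v.
Proof.
by move=> h; apply/ffunP => S; apply: (@addrr_inj C); rewrite -!extDE h.
Qed.

(** Contraction with the inverse of [w]. Summing over the dz_a counts each pair of indices once; the
    sum over all generators is twice as large ([sum_J_contr]). *)
Definition Lam u : E := - \sum_a J (lshift n a) (contr (lshift n a) u).

Lemma LamD u v : Lam (u + v) = Lam u + Lam v.
Proof.
rewrite -opprD -big_split; congr (- _); apply: eq_bigr => a _ /=.
by rewrite contrD JD.
Qed.

Lemma LamZ (c : C) u : Lam (c *: u) = c *: Lam u.
Proof.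
by rewrite scalerN scaler_sumr; congr (- _); apply: eq_bigr => a _; rewrite contrZ JZ.
Qed.

Lemma LamN u : Lam (- u) = - Lam u.
Proof. by rewrite -scaleN1r LamZ scaleN1r. Qed.

Lemma is_deg_J k s u : is_deg k.+1 u -> is_deg k (J s u).
Proof.
by move=> du; apply: is_deg_sum => t _; apply: is_degZ; apply: is_deg_contr.
Qed.

Lemma is_deg0_J s u : is_deg 0 u -> J s u = 0.
Proof. by move=> du; rewrite /J big1 // => t _; rewrite is_deg0_contr ?scaler0. Qed.

Lemma is_deg_Lam k u : is_deg k.+2 u -> is_deg k (Lam u).
Proof.
move=> du; apply: is_degN; apply: is_deg_sum => a _.
by apply: is_deg_J; apply: is_deg_contr.
Qed.

Lemma is_type_Lam p q u : is_type p.+1 q.+1 u -> is_type p q (Lam u).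
Proof.
move=> tu; apply: is_typeN; apply: is_type_sum => a _; rewrite J_lshift.
apply: is_type_sum => b _; apply: is_typeZ.
by apply: is_type_contrr; apply: is_type_contrl.
Qed.

Lemma sum_J_contr u : \sum_s J s (contr s u) = - (Lam u + Lam u).
Proof.
rewrite /Lam -opprD opprK big_split_ord /=; congr (_ + _).
transitivity (\sum_b \sum_a ('i * K b a) *: contr (rshift n b) (contr (lshift n a) u)).
  apply: eq_bigr => b _; rewrite J_rshift -sumrN; apply: eq_bigr => a _.
  by rewrite contr_anti scalerN opprK.
by rewrite exchange_big; apply: eq_bigr => a _; rewrite J_lshift.
Qed.

Lemma contr_Lam s u : contr s (Lam u) = Lam (contr s u).
Proof.
rewrite /Lam contrN contr_sum; congr (- _); apply: eq_bigr => a _.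
by rewrite contr_J contr_anti -[- contr _ _]scaleN1r JZ scaleN1r opprK.
Qed.

Lemma adj_Lam s u : adj w s (Lam u) = Lam (adj w s u).
Proof.
rewrite !adjE; apply: (big_rec2 (fun x y => x = Lam y)).
  by rewrite /Lam big1 ?oppr0 // => a _; rewrite contr0 J0.
by move=> t x y _ ->; rewrite LamD LamZ contr_Lam.
Qed.

(** Each dz_a and dzbar_b crosses over as its adjoint. The coefficients of [w] cancel the inverse
    matrix contained in one of the two adjoints, and the other adjoint is [J] up to a factor i. *)
Lemma inner_wedge_form (t u : E) : inner w (wedge w t) u = inner w t (Lam u).
Proof.
have -> : wedge w t = wedge (\sum_a \sum_b ('i * H a b) *:
    wedge (gen (lshift n a)) (gen (rshift n b))) t.
  by congr (wedge _ t); apply: form11_expand.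
transitivity (inner w t (\sum_a \sum_b (('i * H a b)^*)%R *:
    adj w (rshift n b) (adj w (lshift n a) u))).
  rewrite wedge_suml inner_suml inner_sumr; apply: eq_bigr => a _.
  rewrite wedge_suml inner_suml inner_sumr; apply: eq_bigr => b _.
  by rewrite wedgeZl innerZl innerZr -wedgeA 2!inner_gen conjCK.
congr (inner w t _).
have Jl a x : J (lshift n a) x = 'i *: adj w (rshift n a) x.
  rewrite J_lshift adj_rshift scaler_sumr; apply: eq_bigr => b _.
  by rewrite scalerA.
rewrite /Lam -sumrN exchange_big; apply: eq_bigr => b _ /=.
rewrite Jl -scaleNr.
transitivity (- 'i *: adj w (rshift n b)
    (\sum_c (\sum_a H b a * K a c) *: contr (lshift n c) u)).
  rewrite [in RHS](eq_bigr (fun c => \sum_a (H b a * K a c) *: contr (lshift n c) u));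
    last by move=> c _; rewrite scaler_suml.
  rewrite exchange_big adj_sum scaler_sumr; apply: eq_bigr => a _.
  rewrite conj_iM herm_conj adj_lshift !adj_sum !scaler_sumr; apply: eq_bigr => c _.
  by rewrite !adjZ !scalerA !mulNr mulrA.
congr (- 'i *: adj w _ _).
by apply: sum_delta => c; rewrite mulHK eq_sym.
Qed.

(** If [v] is orthogonal to everything, so is each [adj w s v], hence each contraction of [v],
    because the inverse matrix can be undone. Contracting with the elements of [S] one by one
    reduces [v S] to a coefficient of degree 0, which pairing with [ext1] detects. *)
Lemma inner_nondeg v : (forall t : E, inner w t v = 0) -> v = 0.
Proof.
suff h S : forall v, (forall t : E, inner w t v = 0) -> v S = 0.
  by move=> v0; apply/ffunP => S; rewrite ext0E h.
elim/(@set_min_ind n): S => [{}v v0|m S mS IH {}v v0].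
  have := v0 ext1; rewrite (ext_expand v) inner_sumr.
  rewrite (bigD1 finset.set0) //= big1 ?addr0 => [|S S0].
    rewrite innerZr inner_ebasis inner_basis00 mulr1 => /eqP.
    by rewrite -(ext_expand v) conjC_eq0 => /eqP.
  by rewrite innerZr inner_ebasis /inner_basis ifN ?mulr0 // cards0 eq_sym cards_eq0.
have mnS : m \notin S by apply/negP => /mS; rewrite ltnn.
suff cm (t : E) : inner w t (contr m v) = 0.
  have := IH _ cm; rewrite contrE (negbTE mnS) shuffle_sign_min ?mul1r //.
have adj0v s : inner w t (adj w s v) = 0 by rewrite -inner_gen v0.
case: (split_ordP m) => a ->.
  have -> : contr (lshift n a) v = \sum_b H a b *: adj w (lshift n b) v.
    have -> : \sum_b H a b *: adj w (lshift n b) v =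
        \sum_c (\sum_b H a b * K b c) *: contr (lshift n c) v.
      rewrite [RHS](eq_bigr (fun c => \sum_b (H a b * K b c) *: contr (lshift n c) v));
        last by move=> c _; rewrite scaler_suml.
      rewrite exchange_big; apply: eq_bigr => b _ /=.
      by rewrite adj_lshift scaler_sumr; apply: eq_bigr => c _; rewrite scalerA.
    by apply/esym/sum_delta => c; rewrite mulHK eq_sym.
  by rewrite inner_sumr big1 // => b _; rewrite innerZr adj0v mulr0.
have -> : contr (rshift n a) v = \sum_b H b a *: adj w (rshift n b) v.
  have -> : \sum_b H b a *: adj w (rshift n b) v =
      \sum_c (\sum_b K c b * H b a) *: contr (rshift n c) v.
    rewrite [RHS](eq_bigr (fun c => \sum_b (H b a * K c b) *: contr (rshift n c) v));
      last by move=> c _; rewrite scaler_suml; apply: eq_bigr => b _; rewrite mulrC.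
    rewrite exchange_big; apply: eq_bigr => b _ /=.
    by rewrite adj_rshift scaler_sumr; apply: eq_bigr => c _; rewrite scalerA.
  by apply/esym/sum_delta => c; rewrite mulKH.
by rewrite inner_sumr big1 // => b _; rewrite innerZr adj0v mulr0.
Qed.

Lemma LambdaE u : Lambda w u = Lam u.
Proof.
apply: xget_unique => [t|v vP]; first exact: inner_wedge_form.
apply/eqP; rewrite -subr_eq0; apply/eqP/inner_nondeg => t.
by rewrite -scaleN1r innerDr innerZr rmorphN1 mulN1r -vP inner_wedge_form subrr.
Qed.

Lemma hat_form : hat w = w.
Proof. by rewrite (is_deg_hat (is_type_deg w11)) sqrrN expr1n scale1r. Qed.

Lemma divpow0 : divpow w 0%N = ext1.
Proof. by rewrite /divpow fact0 invr1 scale1r. Qed.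

Lemma divpowS (m : nat) : wedge w (divpow w m) = m.+1%:R *: divpow w m.+1.
Proof.
by rewrite /divpow wedgeZr scalerA factS natrM invfM mulrA divff ?mul1r // pnatr_eq0.
Qed.

Lemma is_deg_divpow (m : nat) : is_deg (m + m) (divpow w m).
Proof.
apply: is_degZ; elim: m => [|m IH]; first exact: is_deg_ext1.
by rewrite iterS addSn addnS; exact: (is_deg_wedge (is_type_deg w11) IH).
Qed.

Lemma hat_divpow (m : nat) : hat (divpow w m) = divpow w m.
Proof.
by rewrite (is_deg_hat (@is_deg_divpow m)) exprD -expr2 sqrr_sign scale1r.
Qed.

(** [J s] is an antiderivation sending the even element [w] to [gen s], so it acts on divided powers
    as differentiation in [w] followed by multiplication by [gen s]. *)
Lemma J_divpow s (m : nat) : J s (divpow w m.+1) = wedge (gen s) (divpow w m).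
Proof.
have cancel (k : nat) : k.+1%:R *: J s (divpow w k.+1) = k.+1%:R *: wedge (gen s) (divpow w k) ->
    J s (divpow w k.+1) = wedge (gen s) (divpow w k).
  by apply: scalerI; rewrite pnatr_eq0.
elim: m => [|m IH]; apply: cancel.
  rewrite -JZ -divpowS J_wedge divpow0 J_form is_deg0_J ?wedge0r ?addr0 ?scale1r //.
  exact: is_deg_ext1.
rewrite -JZ -divpowS J_wedge J_form hat_form IH [wedge w (wedge _ _)]wedgeA.
rewrite (wedge_even _ hat_form) -wedgeA divpowS wedgeZr.
by rewrite -[in RHS]nat1r [RHS]scalerDl scale1r.
Qed.

Lemma wedge_divpow_comm (m : nat) u : wedge (divpow w m) u = wedge u (divpow w m).
Proof. by apply: wedge_even; apply: hat_divpow. Qed.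

Lemma divpow_gen (m : nat) s u :
  wedge (divpow w m) (wedge (gen s) u) = wedge (gen s) (wedge (divpow w m) u).
Proof. by rewrite wedgeA wedge_divpow_comm -wedgeA. Qed.

(** Induction on the degree in place of sl2 theory. Contractions of a primitive form are primitive,
    so omega_(m+1) kills each [contr s v]; applying [J s] to that product trades gen s /\ omega_m /\
    contr s v for omega_(m+1) /\ J s (contr s v), up to sign. Summed over [s], one side is the
    degree times omega_m /\ v by [number], and the other is a multiple of [Lam v]. *)
Lemma prim_wedge0 k (m : nat) v : is_deg k v -> Lam v = 0 -> (n < m + k)%N ->
  wedge (divpow w m) v = 0.
Proof.
elim: k m v => [|k IH] m v dv Lv nmk.
  rewrite (@is_deg_over _ _ (m + m) (divpow w m)) ?wedge0l //; first exact: is_deg_divpow.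
  by rewrite addn0 in nmk; rewrite -addSn leq_add // ltnW.
suff : k.+1%:R *: wedge (divpow w m) v = 0.
  by move/eqP; rewrite scaler_eq0 pnatr_eq0 /= => /eqP.
rewrite -wedgeZr -(number dv) wedge_sumr.
transitivity (- wedge (divpow w m.+1) (\sum_s J s (contr s v))).
  rewrite wedge_sumr -sumrN; apply: eq_bigr => s _.
  rewrite divpow_gen wedgeA -J_divpow.
  have IHs : wedge (divpow w m.+1) (contr s v) = 0.
    apply: IH; first exact: is_deg_contr.
      by rewrite -contr_Lam Lv contr0.
    by rewrite addSnnS.
  have := J_wedge s (divpow w m.+1) (contr s v).
  rewrite IHs J0 hat_divpow => /eqP; rewrite eq_sym addr_eq0 => /eqP->.
  by [].
by rewrite sum_J_contr Lv addr0 oppr0 wedge0r oppr0.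
Qed.

Definition mono (l : seq I) : E := foldr (fun s => wedge (gen s)) ext1 l.

(** For each generator: the sign for carrying it past the [size l'] remaining ones, one more minus
    from the Leibniz rule, and the factor [kap] of [econj_adj]. *)
Fixpoint mono_cst (l : seq I) : C :=
  if l is s :: l' then (-1) ^+ (size l').+1 * kap s * mono_cst l' else 1.

Lemma is_deg_mono l : is_deg (size l) (mono l).
Proof. by elim: l => [|s l IH] /=; [exact: is_deg_ext1|exact: is_deg_gen]. Qed.

Lemma jmx_conj s t : ((jmx s t)^*)%R = jmx (bar s) (bar t).
Proof.
case: (split_ordP s) => a ->; case: (split_ordP t) => b ->;
  rewrite ?bar_lshift ?bar_rshift ?(jmx_ll, jmx_rr, jmx_lr, jmx_rl) ?conjC0 //.
- by rewrite conj_iM herm_inv_conj.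
- by rewrite conjN conj_iM herm_inv_conj opprK.
Qed.

Lemma econj_J s u : econj (J s u) = J (bar s) (econj u).
Proof.
rewrite econj_sum /J [RHS](reindex_inj (can_inj (@barK n))); apply: eq_bigr => t _.
by rewrite econjZ jmx_conj econj_contr.
Qed.

Lemma econj_Lam u : econj (Lam u) = Lam (econj u).
Proof.
apply: double_inj; rewrite -econjD -[in LHS](opprK (Lam u + Lam u)) -(sum_J_contr u).
rewrite econjN econj_sum.
rewrite -[RHS]opprK -sum_J_contr; congr (- _).
rewrite [RHS](reindex_inj (can_inj (@barK n))); apply: eq_bigr => s _.
by rewrite econj_J econj_contr.
Qed.

(** The Hodge star of a primitive form, tested on monomials. The first generator is moved next to
    omega_m, where it forms [J s] of omega_(m+1). As omega_(m+1) /\ conj v vanishes, precisely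
    because [m + size l = n], the Leibniz rule transfers [J s] to conj v, where it is the conjugate
    of an adjoint; [inner_gen] then puts the generator back into the inner product. *)
Lemma star_mono l (m : nat) v : is_deg (size l) v -> Lam v = 0 -> (m + size l)%N = n ->
  wedge (mono l) (wedge (divpow w m) (econj v)) =
    (mono_cst l * inner w (mono l) v) *: divpow w n.
Proof.
elim: l m v => [|s l IH] m v /= dv Lv mn.
  rewrite addn0 in mn; rewrite mn wedge1l {1}(is_deg0E dv) econjZ econj1 wedgeZr wedge1r.
  by rewrite mul1r {2}(is_deg0E dv) innerZr inner_ebasis inner_basis00 mulr1.
have dA : is_deg (size l) (adj w s v).
  by rewrite adjE; apply: is_deg_sum => t _; apply: is_degZ; apply: is_deg_contr.
have LA : Lam (adj w s v) = 0 by rewrite -adj_Lam Lv adj0.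
have gl : wedge (gen s) (mono l) = (-1) ^+ size l *: wedge (mono l) (gen s).
  rewrite wedge_genr (is_deg_hat (@is_deg_mono l)) wedgeZr scalerA -expr2 sqrr_sign.
  by rewrite scale1r.
rewrite [in LHS]gl wedgeZl -wedgeA.
have -> : wedge (gen s) (wedge (divpow w m) (econj v)) =
    - (kap s *: wedge (divpow w m.+1) (econj (adj w s v))).
  rewrite wedgeA -J_divpow -wedgeZr -econj_adj.
  have pw0 : wedge (divpow w m.+1) (econj v) = 0.
    apply: (@prim_wedge0 (size l).+1); first exact: is_deg_econj.
      by rewrite -econj_Lam Lv econj0.
    by rewrite addSn mn.
  have := J_wedge s (divpow w m.+1) (econj v).
  by rewrite pw0 J0 hat_divpow => /eqP; rewrite eq_sym addr_eq0 => /eqP.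
rewrite wedgeNr wedgeZr IH ?addSnnS // -inner_gen -scaleNr !scalerA; congr (_ *: _).
by rewrite exprS; ring.
Qed.

Lemma mono_enum S : mono (enum S) = ebasis S.
Proof.
elim/(@set_min_ind n): S => [|m S mS IH]; first by rewrite enum_set0.
by rewrite enum_min //= IH ebasis_min.
Qed.

Lemma prod_kap S : \prod_(s <- enum S) kap s = 'i ^+ hol_deg S * (- 'i) ^+ antihol_deg S.
Proof.
rewrite big_enum /= (eq_bigr (fun s => 'i ^+ is_hol s * (- 'i) ^+ (~~ is_hol s))).
  by rewrite big_split /= -!expr_sum -hol_degE -antihol_degE.
by move=> s _; rewrite /kap; case: is_hol; rewrite /= ?expr0 ?expr1 ?mulr1 ?mul1r.
Qed.

(** The signs multiply to (-1)^(3+2+1) = 1; one dz and two dzbar contribute i (-i)^2 = -i. *)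
Lemma mono_cst12 S : hol_deg S = 1%N -> antihol_deg S = 2%N -> mono_cst (enum S) = - 'i.
Proof.
move=> hS aS; have : size (enum S) = 3%N by rewrite -cardE -hol_antihol_deg hS aS.
have := prod_kap S; rewrite hS aS.
case: (enum S) => [|s [|t [|r [|//]]]] // pk _ /=.
have ii : 'i * 'i = -1 :> C by rewrite -expr2 sqrCi.
move: pk; rewrite !big_cons big_nil mulr1 expr1 expr2 mulrNN ii mulrN1 => <-.
by ring.
Qed.

Lemma star12 u v (m : nat) : is_type 1 2 u -> is_deg 3 v -> Lam v = 0 -> (m + 3)%N = n ->
  wedge u (wedge (divpow w m) (econj v)) = (- 'i * inner w u v) *: divpow w n.
Proof.
move=> /is_typeP tu dv Lv mn.
rewrite (ext_expand u) wedge_suml inner_suml mulr_sumr scaler_suml.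
apply: eq_bigr => S _; rewrite wedgeZl innerZl.
have [/andP[/eqP hS /eqP aS]|/tu->] := boolP ((hol_deg S == 1%N) && (antihol_deg S == 2%N)).
  have sS : size (enum S) = 3%N by rewrite -cardE -hol_antihol_deg hS aS.
  have := @star_mono (enum S) m v; rewrite sS mono_enum => -> //.
  by rewrite mono_cst12 // scalerA mulrCA.
by rewrite mul0r mulr0 !scale0r.
Qed.

(** The commutator of the two Lefschetz operators on 1-forms, where [Lam b] itself vanishes. Over
    the 2n generators, the terms J s (contr s w) give -2n b, [number] gives b, and the antisymmetry
    of [jmx] gives b again; the total -(2n - 2) b is minus twice the left side. *)
Lemma Lam_wedge_form b : is_deg 1 b -> Lam (wedge w b) = (n%:R - 1) *: b.
Proof.
move=> db; apply: double_inj; apply: oppr_inj; rewrite -sum_J_contr.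
have scal s : is_deg 0 (J s b) by apply: is_deg_J.
transitivity (\sum_s (- b + wedge (gen s) (contr s b) - wedge (contr s w) (J s b))).
  apply: eq_bigr => s _; rewrite contr_wedge hat_form JD !J_wedge J_form hat_form.
  rewrite [J s (contr s b)]is_deg0_J ?wedge0r ?addr0; last exact: is_deg_contr.
  have -> : J s (contr s w) = - ext1.
    rewrite -[J s (contr s w)]opprK -contr_J J_form -[gen s]wedge1r contr_gen.
    by rewrite eqxx scale1r contr1 wedge0r subr0.
  rewrite wedgeNl wedge1l (is_deg_hat (@is_deg_contr R n 1 s w (is_type_deg w11))) expr1.
  by rewrite scaleN1r wedgeNl addrAC.
rewrite !big_split /= [X in _ + _ + X]sumrN (number db) scale1r sumr_const card_ord.
have -> : \sum_s wedge (contr s w) (J s b) = - b.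
  transitivity (\sum_s \sum_t (jmx s t * (contr t b finset.set0)) *: contr s w).
    apply: eq_bigr => s _; rewrite wedge_sumr; apply: eq_bigr => t _.
    rewrite wedgeZr {1}(is_deg0E (@is_deg_contr R n 0 t b db)) wedgeZr wedge1r scalerA.
    by [].
  rewrite exchange_big /= -[in RHS](scale1r b) -(number db) -sumrN.
  apply: eq_bigr => t _; rewrite {2}(is_deg0E (@is_deg_contr R n 0 t b db)) wedgeZr wedge1r.
  rewrite -(J_form t) scaler_sumr -sumrN; apply: eq_bigr => s _.
  by rewrite jmx_anti scalerA mulNr scaleNr mulrC.
rewrite opprK -scaler_nat -[in X in _ *: X + _ + _]scaleN1r.
rewrite -[in X in _ + X + _](scale1r b) -[in X in _ + _ + X](scale1r b) scalerA.
rewrite -scalerDl -scalerDl -[in RHS]scalerDl -scaleNr natrD.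
by congr (_ *: _); ring.
Qed.

(** Applying [Lam] to any Lefschetz decomposition returns its 1-form times n - 1, the eigenvalue of
    [Lam_wedge_form]. This yields both the formula and the uniqueness that pins down the choice in
    [prim]. *)
Lemma primE u : is_deg 3 u -> (1 < n)%N ->
  prim w u = u - (n.-1%:R)^-1 *: wedge w (Lam u).
Proof.
move=> du n1; have n0 : (n.-1%:R : C) != 0 by rewrite pnatr_eq0 -lt0n -subn1 subn_gt0.
have nE : n%:R - 1 = n.-1%:R :> C.
  by rewrite -{1}(prednK (ltnW n1)) -nat1r addrC addKr.
have dw (b : E) : is_deg 1 b -> is_deg 3 (wedge w b).
  by move=> db; exact: (is_deg_wedge (is_type_deg w11) db).
apply: xget_unique => [|u0 [[du0 Lu0] [b db uE]]].
  split; first split.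
  - by apply: is_degD => //; apply/is_degN/is_degZ/dw/is_deg_Lam.
  - rewrite LambdaE LamD LamN LamZ Lam_wedge_form ?nE; last exact: is_deg_Lam.
    by rewrite scalerA mulVf // scale1r subrr.
  exists ((n.-1%:R)^-1 *: Lam u); first exact/is_degZ/is_deg_Lam.
  by rewrite wedgeZr subrK.
rewrite uE LamD Lam_wedge_form // -LambdaE Lu0 add0r nE wedgeZr scalerA mulVf //.
by rewrite scale1r addrK.
Qed.

End HermitianForm.

(** * Positive definite matrices *)

Section PositiveMatrix.
Context {C : numClosedFieldType} {n : nat}.
Variable H : 'M[C]_n.
Hypothesis H_conj : forall a b, ((H a b)^* = H b a)%R.
Hypothesis H_pos : forall v : 'I_n -> C, (exists a, v a != 0) ->
  0 < \sum_a \sum_b H a b * v a * ((v b)^*)%R.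

Lemma posdef_unitmx : H \in unitmx.
Proof.
rewrite -row_free_unit -kermx_eq0; apply/negPn/negP => /rowV0Pn[v /sub_kermxP vH v0].
have /rV0Pn[a va] := v0.
have := H_pos (ex_intro (fun a => v 0 a != 0) a va).
rewrite exchange_big big1 ?ltxx //= => b _; rewrite -mulr_suml.
have := congr1 (fun M : 'rV[C]_n => M 0 b) vH; rewrite !mxE => vHb.
rewrite (eq_bigr (fun i => v 0 i * H i b)) => [|i _]; last by rewrite mulrC.
by rewrite vHb mul0r.
Qed.

(** The spectral theorem, with [d] the inverses of the eigenvalues. It is used to write the norm of
    a form as a combination of squares. *)
Lemma posdef_inv_decomp : exists (d : 'I_n -> C) (P : 'M[C]_n),
  (forall r, 0 <= d r) /\
  forall a b, invmx H a b = \sum_r d r * (((P r a)^*)%R * P r b).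
Proof.
have HT : (map_mx Num.conj H^T = H)%R.
  by apply/matrixP => a b; rewrite !mxE H_conj.
have /orthomx_spectralP HE : H \is normalmx by apply/normalmxP; rewrite HT.
set P := spectralmx H in HE; set D := spectral_diag H in HE.
have Pu : P \in unitmx := spectral_unit H.
have PT : invmx P = map_mx Num.conj P^T by rewrite invmx_unitary ?spectral_unitarymx.
(* The eigenvalue is the value of the Hermitian form on row [r] of [P], a nonzero row since [P] is
   invertible. *)
have Dpos r : 0 < D 0 r.
  have Pr0 : exists a, P r a != 0.
    apply/existsP; apply: contraLR Pu => /existsPn Pr; rewrite unitmxE unitfE.
    apply/negPn/eqP; rewrite (expand_det_row _ r) big1 // => a _.
    by rewrite (eqP (negPn (Pr a))) mul0r.
  have := H_pos Pr0; congr (0 < _).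
  have -> : D 0 r = (P *m H *m invmx P) r r.
    by rewrite HE !mulmxA mulmxV // mul1mx mulmxK // mxE eqxx mulr1n.
  rewrite PT mxE exchange_big; apply: eq_bigr => b _ /=.
  by rewrite !mxE mulr_suml; apply: eq_bigr => a _; rewrite [H a b * _]mulrC.
exists (fun r => (D 0 r)^-1), P; split=> [r|a b]; first by rewrite invr_ge0 ltW.
pose D' : 'rV[C]_n := \row_r (D 0 r)^-1.
have DD : diag_mx D *m diag_mx D' = 1%:M.
  apply/matrixP => i j; rewrite mul_diag_mx !mxE.
  case: eqP => [->|]; rewrite ?mulr1n ?mulr0n ?mulr0 //.
  by rewrite divff // gt_eqF.
have -> : invmx H = invmx P *m diag_mx D' *m P.
  have HK : H *m (invmx P *m diag_mx D' *m P) = 1%:M.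
    rewrite {1}HE -!mulmxA (mulmxA P) mulmxV // mul1mx (mulmxA (diag_mx D)) DD.
    by rewrite mul1mx mulVmx.
  by rewrite -[RHS](mulKmx posdef_unitmx) HK mulmx1.
rewrite PT mxE; apply: eq_bigr => r _; rewrite mul_mx_diag !mxE.
by rewrite mulrA [_ * (D 0 r)^-1]mulrC.
Qed.

End PositiveMatrix.
Lemma conj_half_i (F : numClosedFieldType) : (('i / 2)^* = - ('i / 2) :> F)%R.
Proof.
transitivity ('i^* * (2^-1)^* : F)%R; first exact: rmorphM.
by rewrite conjCi geC0_conj ?mulNr // invr_ge0 ler0n.
Qed.

(** Scalar bookkeeping for [theta_conj]: 2 and i/2 make a second factor i, and i^2 cancels the extra
    -1. *)
Lemma theta_cst (F : numClosedFieldType) (m c t : F) :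
  m * (c * t) = (-1 * m) * 'i * c * (2 * t) * ('i / 2).
Proof.
have ii : 'i * 'i = -1 :> F by rewrite -expr2 sqrCi.
transitivity (- ('i * 'i) * (m * (c * t))); first by rewrite ii opprK mul1r.
by field.
Qed.

Lemma sum_mul_ge0 (F : numDomainType) (I : finType) (d x : I -> F) :
  (forall r, 0 <= d r) -> (forall r, 0 <= x r) -> 0 <= \sum_r d r * x r.
Proof. by move=> d0 x0; apply: sumr_ge0 => r _; apply: mulr_ge0. Qed.

(** * Top-degree densities and positivity *)

Section Density.
Context {R : realType} {n : nat}.
Local Notation C := R[i].
Local Notation E := (ext R n).
Local Notation I := 'I_(n + n).
Implicit Types (u v : E) (s t r : I) (S T A B D : {set I}).

Definition volume_list (l : seq 'I_n) : E := \big[wedge/ext1]_(a <- l)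
  (('i / 2 : C) *: wedge (gen (lshift n a)) (gen (rshift n a))).

Lemma volume_list_cons a l : volume_list (a :: l) =
  ('i / 2 : C) *: wedge (gen (lshift n a)) (wedge (gen (rshift n a)) (volume_list l)).
Proof. by rewrite /volume_list big_cons wedgeZl -wedgeA. Qed.

Lemma contr_volume_list s l : (forall a, a \in l -> (s != lshift n a) && (s != rshift n a)) ->
  contr s (volume_list l) = 0.
Proof.
elim: l => [|a l IH] sl; first by rewrite /volume_list big_nil contr1.
have /andP[sa sa'] := sl a (mem_head _ _).
rewrite volume_list_cons contrZ contr_gen contr_gen IH ?(negbTE sa) ?(negbTE sa').
  by rewrite wedge0r !scale0r subr0 wedge0r subr0 scaler0.
by move=> b bl; apply: sl; rewrite inE bl orbT.
Qed.

Lemma half_i_neq0 : 'i / 2 != 0 :> C.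
Proof. by rewrite mulf_neq0 ?neq0Ci // invr_eq0 pnatr_eq0. Qed.

(** Contracting with the pair of vectors dual to dz_a and dzbar_a strips off the first factor, so
    vanishing would descend to [ext1]. *)
Lemma volume_list_neq0 l : uniq l -> volume_list l != 0.
Proof.
elim: l => [_|a l IH /= /andP[al ul]].
  rewrite /volume_list big_nil; apply/eqP => /ffunP/(_ finset.set0).
  by rewrite ebasisE ext0E eqxx => /eqP; rewrite oner_eq0.
apply: contraNneq (IH ul) => V0.
have notin s : s = lshift n a \/ s = rshift n a -> contr s (volume_list l) = 0.
  move=> sE; apply: contr_volume_list => b bl; have ab : a != b.
    by apply: contraNneq al => ->.
  by case: sE => ->; rewrite ?eq_lshift ?eq_rshift ?eq_lrshift ?eq_rlshift ab.
have := congr1 (fun x => contr (rshift n a) (contr (lshift n a) x)) V0.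
rewrite volume_list_cons contrZ contrZ !contr0 contr_gen contr_gen notin ?wedge0r ?subr0; last by left.
rewrite eqxx scale1r eq_lrshift scale0r wedge0r subr0 contr_gen notin; last by right.
rewrite eqxx scale1r wedge0r subr0 => /eqP; rewrite scaler_eq0.
by rewrite (negbTE half_i_neq0).
Qed.

Lemma is_deg_volume_list l : is_deg (size l).*2 (volume_list l).
Proof.
elim: l => [|a l IH]; first by rewrite /volume_list big_nil; exact: is_deg_ext1.
by rewrite volume_list_cons doubleS; apply/is_degZ/is_deg_gen/is_deg_gen.
Qed.

Lemma econj_volume_list l : econj (volume_list l) = volume_list l.
Proof.
elim: l => [|a l IH]; first by rewrite /volume_list big_nil econj1.
rewrite volume_list_cons econjZ econj_gen econj_gen bar_lshift bar_rshift IH gen_anti.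
rewrite scalerN -scaleNr; congr (_ *: _).
by rewrite [(_^*)%R]conj_half_i opprK.
Qed.

Lemma vol_neq0 : (vol : E) finset.setT != 0 :> C.
Proof.
apply: contraNneq (volume_list_neq0 (enum_uniq 'I_n)) => v0.
have /is_degP vd := @is_deg_volume_list (enum 'I_n).
apply/eqP/ffunP => S; rewrite ext0E.
have [->|ST] := eqVneq S finset.setT; first exact: v0.
apply: vd; rewrite size_enum_ord -addnn.
have := subset_leqif_cards (finset.subsetT S) => -[_]; rewrite cardsT card_ord => ->.
exact: ST.
Qed.

Lemma densityD u v : density (u + v) = density u + density v.
Proof. by rewrite /density extDE mulrDl. Qed.

Lemma densityN u : density (- u) = - density u.
Proof. by rewrite /density extNE mulNr. Qed.

Lemma densityZ (c : C) u : density (c *: u) = c * density u.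
Proof. by rewrite /density extZE mulrA. Qed.

Lemma density0 : density (0 : E) = 0.
Proof. by rewrite /density ext0E mul0r. Qed.

Lemma density_vol : density (vol : E) = 1.
Proof. exact: divff vol_neq0. Qed.

Lemma top_expand u : is_deg (n + n) u -> u = density u *: vol.
Proof.
move=> /is_degP du; have /is_degP dv := @is_deg_volume_list (enum 'I_n).
apply/ffunP => S; rewrite extZE.
have [->|ST] := eqVneq S finset.setT; first by rewrite /density divfK ?vol_neq0.
have Sn : #|S| != (n + n)%N.
  have := subset_leqif_cards (finset.subsetT S) => -[_]; rewrite cardsT card_ord => ->.
  exact: ST.
by rewrite du // [vol S]dv ?mulr0 // size_enum_ord -addnn.
Qed.

Lemma density_econj u : is_deg (n + n) u -> density (econj u) = ((density u)^*)%R.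
Proof.
move=> du; rewrite [in LHS](top_expand du) econjZ densityZ.
by rewrite [econj vol]econj_volume_list [density (volume_list _)]density_vol mulr1.
Qed.

Variable w : E.
Hypothesis w11 : is_type 1 1 w.
Hypothesis w_real : econj w = w.
Hypothesis w_pos : posdef w.

Let H_conj := herm_conj w11 w_real.

Lemma posdef_unit : herm_mx w \in unitmx.
Proof. exact: (@posdef_unitmx _ _ _ w_pos). Qed.

Local Notation G := (gram w).

(** Induction on the degree: by [number], a positive multiple of the norm of [u] pairs contractions
    of [u] with their adjoints. Diagonalising the inverse matrix turns this into a nonnegative
    combination of norms of [x r] and [y r], contractions of [u] along an eigenframe. *)
Lemma inner_ge0 k u : is_deg k u -> 0 <= inner w u u.
Proof.
have [d [P [d0 KE]]] := posdef_inv_decomp H_conj w_pos.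
elim: k u => [|k IH] u du.
  rewrite (is_deg0E du) innerZl innerZr inner_ebasis inner_basis00 mulr1.
  exact: mul_conjC_ge0.
suff : 0 <= k.+1%:R * inner w u u by rewrite pmulr_rge0 ?ltr0n.
have nu : k.+1%:R * inner w u u = \sum_s inner w (contr s u) (adj w s u).
  rewrite -innerZl -(number du) inner_suml; apply: eq_bigr => s _.
  by rewrite inner_gen.
pose x (r : 'I_n) := \sum_a P r a *: contr (lshift n a) u : E.
pose y (r : 'I_n) := \sum_a ((P r a)^*)%R *: contr (rshift n a) u : E.
have KC := herm_inv_conj w11 w_real.
have xE : \sum_a inner w (contr (lshift n a) u) (adj w (lshift n a) u) =
    \sum_r d r * inner w (x r) (x r).
  transitivity (\sum_a \sum_c \sum_r d r * (P r a * ((P r c)^*)%R *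
      inner w (contr (lshift n a) u) (contr (lshift n c) u))).
    apply: eq_bigr => a _; rewrite (adj_lshift w11 w_real) inner_sumr; apply: eq_bigr => c _.
    rewrite innerZr KC KE mulr_suml; apply: eq_bigr => r _.
    by rewrite -mulrA [P r a * _]mulrC.
  rewrite (eq_bigr _ (fun a _ => exchange_big _ _ _ _ _ _)) exchange_big /=.
  apply: eq_bigr => r _; rewrite inner_suml mulr_sumr; apply: eq_bigr => a _.
  rewrite innerZl inner_sumr mulr_sumr mulr_sumr; apply: eq_bigr => c _.
  by rewrite innerZr !mulrA.
have yE : \sum_a inner w (contr (rshift n a) u) (adj w (rshift n a) u) =
    \sum_r d r * inner w (y r) (y r).
  transitivity (\sum_a \sum_c \sum_r d r * (((P r a)^*)%R * P r c *
      inner w (contr (rshift n a) u) (contr (rshift n c) u))).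
    apply: eq_bigr => a _; rewrite (adj_rshift w11 w_real) inner_sumr; apply: eq_bigr => c _.
    rewrite innerZr KC KE mulr_suml; apply: eq_bigr => r _.
    by rewrite -mulrA.
  rewrite (eq_bigr _ (fun a _ => exchange_big _ _ _ _ _ _)) exchange_big /=.
  apply: eq_bigr => r _; rewrite inner_suml mulr_sumr; apply: eq_bigr => a _.
  rewrite innerZl inner_sumr mulr_sumr mulr_sumr; apply: eq_bigr => c _.
  by rewrite innerZr conjCK !mulrA.
have xd (r : 'I_n) : is_deg k (x r) by apply: is_deg_sum => a _; exact/is_degZ/is_deg_contr.
have yd (r : 'I_n) : is_deg k (y r) by apply: is_deg_sum => a _; exact/is_degZ/is_deg_contr.
have hx := @sum_mul_ge0 C _ _ _ d0 (fun r : 'I_n => IH _ (xd r)).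
have hy := @sum_mul_ge0 C _ _ _ d0 (fun r : 'I_n => IH _ (yd r)).
have e : k.+1%:R * inner w u u = \sum_r d r * inner w (x r) (x r) +
    \sum_r d r * inner w (y r) (y r).
  rewrite nu; etransitivity; first exact: big_split_ord.
  exact: (congr2 +%R xE yE).
by rewrite e; exact: (@addr_ge0 C _ _ hx hy).
Qed.

(* [star_mono] at dz_1 /\ ... /\ dz_n computes [density (divpow w n)]. *)
Let theta (l : seq 'I_n) : E := mono (map (@lshift n n) l).

Lemma contr_theta (d : 'I_n) l : contr (rshift n d) (theta l) = 0.
Proof.
elim: l => [|a l IH]; first exact: contr1.
by rewrite [theta _]/= contr_gen -/(theta l) IH eq_rlshift scale0r wedge0r subr0.
Qed.

Lemma Lam_theta l : Lam w (theta l) = 0.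
Proof.
rewrite /Lam big1 ?oppr0 // => a _; rewrite J_lshift big1 // => b _.
by rewrite contr_anti contr_theta contr0 oppr0 scaler0.
Qed.

Lemma theta_conj l : wedge (theta l) (econj (theta l)) =
  (mono_cst (map (@lshift n n) l) * 2 ^+ size l) *: volume_list l.
Proof.
elim: l => [|a l IH].
  by rewrite [theta _]/= econj1 wedge1l /volume_list big_nil expr0 mulr1 scale1r.
have -> : wedge (theta (a :: l)) (econj (theta (a :: l))) = (-1) ^+ size l *:
    wedge (gen (lshift n a)) (wedge (gen (rshift n a)) (wedge (theta l) (econj (theta l)))).
  rewrite [theta (a :: l)]/= -/(theta l) econj_gen bar_lshift -wedgeA.
  rewrite [wedge (theta l) (wedge _ _)]wedgeA wedge_genr.
  have -> : hat (theta l) = (-1) ^+ size l *: theta l.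
    by rewrite -{1}(size_map (@lshift n n)); apply/is_deg_hat/is_deg_mono.
  by rewrite wedgeZr wedgeZl wedgeZr -wedgeA.
rewrite IH 2!wedgeZr volume_list_cons !scalerA; congr (_ *: _).
rewrite /= size_map /kap is_hol_lshift exprS exprS; exact: theta_cst.
Qed.

Lemma density_divpow_gt0 : 0 < density (divpow w n).
Proof.
have st : size (map (@lshift n n) (enum 'I_n)) = n by rewrite size_map size_enum_ord.
have := @star_mono _ _ w w11 w_real posdef_unit (map (@lshift n n) (enum 'I_n)) 0
  (theta (enum 'I_n)) (@is_deg_mono _ _ _) (Lam_theta _) st.
rewrite divpow0 wedge1l -/(theta _) theta_conj => /(congr1 density).
rewrite 2!densityZ [density (volume_list _)]density_vol mulr1 -mulrA size_enum_ord.
have c0 : mono_cst (map (@lshift n n) (enum 'I_n)) != 0 :> C.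
  elim: (map _ _) => [|s l IHl] /=; first exact: oner_neq0.
  rewrite !mulf_neq0 ?signr_eq0 // /kap; case: is_hol; rewrite ?oppr_eq0 neq0Ci //.
(* What remains is 2^n = |theta|^2 times the density. The norm is nonnegative, so both factors are
   positive. *)
move=> /(mulfI c0) th.
have : 0 < inner w (theta (enum 'I_n)) (theta (enum 'I_n)) * density (divpow w n).
  by rewrite -th exprn_gt0 // ltr0n.
have := inner_ge0 (@is_deg_mono _ _ (map (@lshift n n) (enum 'I_n))).
rewrite le_eqVlt => /orP[/eqP<-|p0]; first by rewrite mul0r ltxx.
by rewrite pmulr_rgt0.
Qed.

End Density.

(** * Iterated integrals of compactly supported functions *)

Section IteratedIntegral.
Context {R : realType}.
Local Open Scope classical_set_scope.
Local Open Scope ring_scope.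

(** A class of integrands preserved, with the same [A], by fixing the first coordinate; this is what
    an iterated integral needs. *)
Definition box_supported m (A : R) (f : 'rV[R]_m -> R) :=
  continuous f /\ forall z : 'rV[R]_m, (exists j, A < `|z 0 j|) -> f z = 0.

Lemma box_supportedD m A (f g : 'rV[R]_m -> R) :
  box_supported A f -> box_supported A g -> box_supported A (fun z => f z + g z).
Proof.
move=> [cf sf] [cg sg]; split; first by move=> z; exact: (cvgD (cf z) (cg z)).
by move=> z zA; rewrite sf ?sg ?addr0.
Qed.

Lemma box_supportedZ m A c (f : 'rV[R]_m -> R) :
  box_supported A f -> box_supported A (fun z => c * f z).
Proof.
move=> [cf sf]; split; first by move=> z; exact: (cvgM (cvg_cst c) (cf z)).
by move=> z zA; rewrite sf ?mulr0.
Qed.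

Definition slice m (f : 'rV[R]_m.+1 -> R) (t : R) : 'rV[R]_m -> R :=
  fun v => f (row_mx (t%:M : 'rV[R]_1) v).

Lemma row_mx_continuous m :
  continuous (fun p : 'rV[R]_m * R => row_mx (p.2%:M : 'rV[R]_1) p.1 : 'rV[R]_m.+1).
Proof.
move=> [v t]; apply/cvg_ballP => e e0.
apply: filterS (nbhsx_ballx (v, t) _ e0) => p [pv pt]; split=> // i j /=.
rewrite !mxE; case: (@fintype.splitP 1 m j) => k _.
  by rewrite !mxE (ord1 k) (ord1 i) eqxx !mulr1n.
by rewrite (ord1 i); apply: pv.2.
Qed.

Lemma row_mxr_continuous m t :
  continuous (fun v => row_mx (t%:M : 'rV[R]_1) v : 'rV[R]_m.+1).
Proof.
move=> v U /nbhs_ballP[e e0 eU].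
have := nbhsx_ballx v _ e0; apply: filterS => u uv; apply: eU; split=> // i j /=.
rewrite !mxE; case: (@fintype.splitP 1 m j) => k _; first exact: ballxx.
by rewrite (ord1 i); apply: uv.2.
Qed.

Lemma slice_supported m A (f : 'rV[R]_m.+1 -> R) t :
  box_supported A f -> box_supported A (slice f t).
Proof.
move=> [cf sf]; split=> [v|v [j Aj]]; last first.
  by apply: sf; exists (rshift 1 j); rewrite (row_mxEr (t%:M : 'rV_1) v).
apply: (@continuous_comp _ _ _ (fun v => row_mx (t%:M : 'rV[R]_1) v : 'rV[R]_m.+1) f); last exact: cf.
exact: row_mxr_continuous.
Qed.

Lemma slice_out m A (f : 'rV[R]_m.+1 -> R) t :
  box_supported A f -> A < `|t| -> slice f t = cst 0.
Proof.
move=> [_ sf] At; apply/funext => v; apply: sf; exists (lshift m (ord0 : 'I_1)).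
by rewrite (row_mxEl (t%:M : 'rV_1) v) mxE eqxx mulr1n.
Qed.

Lemma box_compact m (A : R) :
  compact [set v : 'rV[R]_m | forall i, `[- A, A]%classic (v ord0 i)].
Proof. exact: (@rV_compact R m (fun _ => `[- A, A]%classic) (fun _ => @segment_compact _ _ _)). Qed.

(** A tube argument: joint continuity is made uniform in [v] over the compact cube, and outside the
    cube both slices vanish. *)
Lemma slice_unif m A (f : 'rV[R]_m.+1 -> R) t0 e : box_supported A f -> 0 < e ->
  \forall t \near t0, forall v, `|slice f t v - slice f t0 v| <= e.
Proof.
move=> fs e0; have [cf sf] := fs.
pose B := [set v : 'rV[R]_m | forall i, `[- A, A]%classic (v ord0 i)].
have cF : continuous (fun p : 'rV[R]_m * R => slice f p.2 p.1).
  move=> p; apply: (@continuous_comp _ _ _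
    (fun p : 'rV[R]_m * R => row_mx (p.2%:M : 'rV[R]_1) p.1 : 'rV[R]_m.+1) f).
    exact: row_mx_continuous.
  exact: cf.
have /compact_near_coveringP/(_ R (nbhs t0)
    (fun t v => `|slice f t v - slice f t0 v| <= e)) := @box_compact m A.
have H : forall v, B v -> \forall v' \near v & t \near t0,
    `|slice f t v' - slice f t0 v'| <= e.
  move=> v _; have e2 : 0 < e / 2 by rewrite divr_gt0.
  have /cvgrPdist_le/(_ _ e2) [[U V] /= [Uv Vt] UV] := cF (v, t0).
  exists (U, V) => //= -[v' t] /= [Uv' Vt'].
  have h1 := UV (v', t) (conj Uv' Vt').
  have h2 := UV (v', t0) (conj Uv' (nbhs_singleton Vt)).
  rewrite /= in h1 h2; rewrite (splitr e).
  rewrite -[X in `|X|](subrKA (slice f t0 v)) (le_trans (ler_normD _ _)) // lerD //.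
  by rewrite distrC.
move=> /(_ _ H) K; near=> t => v.
have [vB|vB] := pselect (B v); first by have := near K t; apply.
have [j vj] : exists j, A < `|v 0 j|.
  apply/not_existsP => vA; apply: vB => i; rewrite /= in_itv /= -ler_norml.
  by rewrite leNgt; apply/negP/vA.
by rewrite /slice !sf ?subrr ?normr0 ?ltW //; exists (rshift 1 j); rewrite (row_mxEr (_ : 'rV_1) v).
Unshelve. all: end_near. Qed.

Local Notation mu := (@lebesgue_measure R).

Lemma integral_Rm0 m : integral_Rm (cst 0 : 'rV[R]_m -> R) = 0.
Proof.
elim: m => [//|m IH] /=; rewrite (@eq_Rintegral _ _ _ mu setT (cst 0)); last by move=> t _; exact: IH.
by rewrite Rintegral_cst // mul0r.
Qed.

Section OneVariable.
Variables (A : R) (g : R -> R).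
Hypothesis A0 : 0 <= A.
Hypothesis g_cont : continuous g.
Hypothesis g_out : forall t, A < `|t| -> g t = 0.

Lemma Rintegral_segment : (\int[mu]_(t in setT) g t)%R = (\int[mu]_(t in `[- A, A]) g t)%R.
Proof.
rewrite [RHS]Rintegral_mkcond; apply: eq_Rintegral => t _; rewrite patchE.
case: ifPn => //; rewrite notin_setE /= in_itv /= -ler_norml => /negP.
by rewrite -ltNge => /g_out.
Qed.

Lemma integrable_segment : mu.-integrable `[- A, A] (EFin \o g).
Proof.
apply: continuous_compact_integrable; first exact: segment_compact.
by apply: continuous_subspaceT => t; exact: g_cont.
Qed.

End OneVariable.

(** The three claims are proved in one induction: each one-dimensional step needs integrability,
    obtained from continuity of the inner integral in the outer variable, and that continuity
    follows from linearity and the bound one dimension below. *)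
Lemma integral_Rm_lin_bound m (A : R) : 0 <= A ->
  [/\ forall f g : 'rV[R]_m -> R, box_supported A f -> box_supported A g ->
        integral_Rm (fun z => f z + g z) = integral_Rm f + integral_Rm g,
      forall (c : R) (f : 'rV[R]_m -> R), box_supported A f ->
        integral_Rm (fun z => c * f z) = c * integral_Rm f &
      forall (c : R) (f : 'rV[R]_m -> R), box_supported A f ->
        (forall z, `|f z| <= c) -> `|integral_Rm f| <= c * (A + A) ^+ m].
Proof.
move=> A0; elim: m => [|m [IHD IHZ IHb]].
  by split=> //= c f _ fc; rewrite expr0 mulr1.
have contS (f : 'rV[R]_m.+1 -> R) : box_supported A f ->
    continuous (fun t => integral_Rm (slice f t)).
  move=> fs t0; apply/cvgrPdist_le => e e0.
  (* The added 1 keeps the divisor positive when the cube is degenerate. *)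
  pose M := (A + A) ^+ m + 1.
  have M0 : 0 < M by rewrite ltr_wpDl // exprn_ge0 // addr_ge0.
  have := @slice_unif _ _ _ t0 (e / M) fs (divr_gt0 e0 M0); apply: filterS => t ht.
  have dE : integral_Rm (slice f t0) - integral_Rm (slice f t) =
      integral_Rm (fun v => slice f t0 v + (-1) * slice f t v).
    have st := slice_supported t fs; have st0 := slice_supported t0 fs.
    by rewrite IHD ?IHZ ?mulN1r //; exact: box_supportedZ.
  rewrite dE (le_trans (IHb (e / M) _ _ _)) //.
  - by apply: box_supportedD; [|apply: box_supportedZ]; exact: slice_supported.
  - by move=> v; rewrite mulN1r distrC.
  - by rewrite mulrAC ler_pdivrMr // ler_pM2l // lerDl ler01.
have outS (f : 'rV[R]_m.+1 -> R) : box_supported A f ->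
    forall t, A < `|t| -> integral_Rm (slice f t) = 0.
  by move=> fs t At; rewrite (slice_out fs At) integral_Rm0.
have sE (f : 'rV[R]_m.+1 -> R) :
    integral_Rm f = (\int[mu]_(t in setT) integral_Rm (slice f t))%R by [].
split=> [f g fs gs|c f fs|c f fs fc].
- rewrite !sE (@eq_Rintegral _ _ _ mu setT (fun t => integral_Rm (slice f t) + integral_Rm (slice g t))).
    have hs t : A < `|t| -> integral_Rm (slice f t) + integral_Rm (slice g t) = 0.
      by move=> At; rewrite !outS ?addr0.
    rewrite (Rintegral_segment hs) (Rintegral_segment (outS f fs)) (Rintegral_segment (outS g gs)).
    by rewrite RintegralD //; apply: integrable_segment; apply: contS.
  by move=> t _; apply: IHD; exact: slice_supported.
- rewrite !sE (@eq_Rintegral _ _ _ mu setT (fun t => c * integral_Rm (slice f t))).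
    have hs t : A < `|t| -> c * integral_Rm (slice f t) = 0.
      by move=> At; rewrite outS ?mulr0.
    rewrite (Rintegral_segment hs) (Rintegral_segment (outS f fs)).
    by rewrite RintegralZl //; apply: integrable_segment; apply: contS.
  by move=> t _; apply: IHZ; exact: slice_supported.
- rewrite sE (Rintegral_segment (outS f fs)).
  have fi := integrable_segment A (contS f fs).
  have c0 : 0 <= c by rewrite (le_trans _ (fc 0)).
  apply: (le_trans (le_normr_Rintegral _ fi)) => //.
  apply: (@le_trans _ _ (\int[mu]_(t in `[- A, A]) (cst (c * (A + A) ^+ m) t))%R).
    apply: le_Rintegral => //.
    + exact: integrable_norm.
    + apply: integrable_segment; exact: cst_continuous.
    + move=> t _; apply: IHb; first exact: slice_supported.
      by move=> v; exact: fc.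
  rewrite Rintegral_cst //= lebesgue_measure_itv /=.
  case: ifPn => _; rewrite ?mulr0 /= ?opprK ?exprSr ?mulrA //.
  by rewrite mulr_ge0 ?mulr_ge0 ?exprn_ge0 ?addr_ge0.
Qed.

End IteratedIntegral.

(** * Uniform first-order expansions in a real parameter *)

Section Jets.
Context {R : realType}.
Local Open Scope classical_set_scope.
Local Open Scope ring_scope.
Local Notation C := R[i].

Lemma normc_real (t : R) : Normc.normc t%:C = `|t|.
Proof. by rewrite /Normc.normc /= expr0n addr0 sqrtr_sqr. Qed.

Lemma normc_ge0 (x : C) : 0 <= Normc.normc x.
Proof. by case: x => a b; exact: sqrtr_ge0. Qed.

Lemma normc_Re (x : C) : `|complex.Re x| <= Normc.normc x.
Proof. by have := normc_ge_Re x; rewrite lecR. Qed.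

Lemma normc_Im (x : C) : `|complex.Im x| <= Normc.normc x.
Proof.
by case: x => a b /=; rewrite -sqrtr_sqr ler_wsqrtr // lerDr sqr_ge0.
Qed.

Lemma normc_le_ReIm (x : C) : Normc.normc x <= `|complex.Re x| + `|complex.Im x|.
Proof.
rewrite {1}(complexE x) (le_trans (le_normcD _ _)) // normc_real lerD2l.
by rewrite Normc.normcM normc_real /= expr0n expr1n add0r sqrtr1 mul1r.
Qed.

Lemma normc_conj (x : C) : Normc.normc (x^*)%R = Normc.normc x.
Proof. by case: x => a b /=; rewrite sqrrN. Qed.

Section Continuity.
Context {V : normedModType R}.
Implicit Types (f g : V -> C) (z : V).

Lemma eq_continuous_at (h k : V -> R) z : (forall y, k y = h y) ->
  {for z, continuous h} -> {for z, continuous k}.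
Proof. by move=> kh; rewrite (_ : k = h) //; apply/funext. Qed.

Lemma Ccontinuous_cst (c : C) z : Ccontinuous_at (fun _ : V => c) z.
Proof. by split; exact: cst_continuous. Qed.

Lemma CcontinuousD f g z : Ccontinuous_at f z -> Ccontinuous_at g z ->
  Ccontinuous_at (fun y => f y + g y) z.
Proof.
have re (x y : C) : complex.Re (x + y) = complex.Re x + complex.Re y by case: x y => ? ? [].
have im (x y : C) : complex.Im (x + y) = complex.Im x + complex.Im y by case: x y => ? ? [].
move=> [fr fi] [gr gi]; split.
  by apply: eq_continuous_at (fun y => re _ _) (cvgD fr gr).
by apply: eq_continuous_at (fun y => im _ _) (cvgD fi gi).
Qed.

Lemma CcontinuousM f g z : Ccontinuous_at f z -> Ccontinuous_at g z ->
  Ccontinuous_at (fun y => f y * g y) z.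
Proof.
have re (x y : C) : complex.Re (x * y) =
  complex.Re x * complex.Re y - complex.Im x * complex.Im y by case: x y => ? ? [].
have im (x y : C) : complex.Im (x * y) =
  complex.Re x * complex.Im y + complex.Im x * complex.Re y by case: x y => ? ? [].
move=> [fr fi] [gr gi]; split.
  by apply: eq_continuous_at (fun y => re _ _) (cvgB (cvgM fr gr) (cvgM fi gi)).
by apply: eq_continuous_at (fun y => im _ _) (cvgD (cvgM fr gi) (cvgM fi gr)).
Qed.

Lemma Ccontinuous_conj f z : Ccontinuous_at f z ->
  Ccontinuous_at (fun y => ((f y)^*)%R) z.
Proof.
have re (x : C) : complex.Re (x^*)%R = complex.Re x by case: x.
have im (x : C) : complex.Im (x^*)%R = - complex.Im x by case: x.
move=> [fr fi]; split; first by apply: eq_continuous_at (fun y => re _) fr.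
by apply: eq_continuous_at (fun y => im _) (cvgN fi).
Qed.

Lemma CcontinuousV f z : f z != 0 -> Ccontinuous_at f z ->
  Ccontinuous_at (fun y => (f y)^-1) z.
Proof.
pose d (x : C) := complex.Re x * complex.Re x + complex.Im x * complex.Im x.
have re (x : C) : complex.Re x^-1 = complex.Re x * (d x)^-1.
  by case: x => a b; rewrite /d /= !expr2.
have im (x : C) : complex.Im x^-1 = - (complex.Im x * (d x)^-1).
  by case: x => a b; rewrite /d /= !expr2.
move=> fz [fr fi].
have d0 : d (f z) != 0.
  apply: contraNneq fz => /eqP; rewrite /d -!expr2 paddr_eq0 ?sqr_ge0 // !sqrf_eq0.
  by case: (f z) => a b /= /andP[/eqP-> /eqP->].
have dc : {for z, continuous (fun y => d (f y))} by exact: (cvgD (cvgM fr fr) (cvgM fi fi)).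
split; first by apply: eq_continuous_at (fun y => re _) (cvgM fr (cvgV d0 dc)).
by apply: eq_continuous_at (fun y => im _) (cvgN (cvgM fi (cvgV d0 dc))).
Qed.

Lemma Ccontinuous_near f g z : (\forall y \near z, f y = g y) ->
  Ccontinuous_at f z -> Ccontinuous_at g z.
Proof.
move=> fg [fr fi]; have fgz := nbhs_singleton fg; split.
  apply: cvg_trans (_ : _ --> complex.Re (g z)); last by rewrite -fgz; exact: fr.
  by apply: near_eq_cvg; apply: filterS fg => y ->.
apply: cvg_trans (_ : _ --> complex.Im (g z)); last by rewrite -fgz; exact: fi.
by apply: near_eq_cvg; apply: filterS fg => y ->.
Qed.

Lemma Ccontinuous_bounded (K : set V) f : compact K ->
  (forall z, K z -> Ccontinuous_at f z) -> exists M, forall z, K z -> Normc.normc (f z) <= M.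
Proof.
move=> cK fc.
have bnd (h : V -> R) : (forall z, K z -> {for z, continuous h}) ->
    exists M, forall z, K z -> `|h z| <= M.
  move=> hc; have hK : compact (h @` K).
    apply: continuous_compact => //; apply: continuous_in_subspaceT => z zK.
    by apply: hc; exact: set_mem.
  have [M [_ /(_ (M + 1)) hM]] := compact_bounded hK.
  exists (M + 1) => z Kz; apply: hM; first by rewrite ltrDl.
  by exists z.
have [M1 h1] := bnd _ (fun z Kz => (fc z Kz).1).
have [M2 h2] := bnd _ (fun z Kz => (fc z Kz).2).
exists (M1 + M2) => z Kz; apply: le_trans (normc_le_ReIm _) _.
by apply: lerD; [exact: h1|exact: h2].
Qed.

End Continuity.

Section JetCalculus.
Context {V : normedModType R}.
Variable K : set V.
Implicit Types (f g : R -> V -> C) (df dg h : V -> C).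

(** One constant serves all small [t] and all [z] in [K]. The bounds on the values and on [df] are
    part of the definition so that products and inverses stay inside it; continuity is in the
    ambient space at points of [K], as the cutoffs need. *)
Definition jet f (df : V -> C) := exists M, \forall t \near (0 : R), forall z, K z ->
  [/\ Ccontinuous_at (f t) z, Normc.normc (f t z) <= M, Normc.normc (df z) <= M &
      Normc.normc (f t z - f 0 z - t%:C * df z) <= M * t ^+ 2].

Lemma jet_ext f df dg : jet f df -> (forall z, K z -> df z = dg z) -> jet f dg.
Proof.
move=> [M fM] fg; exists M; apply: filterS fM => t ht z Kz.
by rewrite -(fg z Kz); exact: ht.
Qed.

Lemma jet_eq f df g : jet f df -> (forall t z, f t z = g t z) -> jet g df.
Proof. by move=> fM fg; rewrite -(_ : f = g) //; apply/funext => t; apply/funext. Qed.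

Lemma jetD f df g dg : jet f df -> jet g dg ->
  jet (fun t z => f t z + g t z) (fun z => df z + dg z).
Proof.
move=> [M fM] [N gN]; exists (M + N); apply: filterS2 fM gN => t ht kt z Kz.
have [fc fb f1b fr] := ht z Kz; have [gc gb g1b gr] := kt z Kz; split.
- exact: CcontinuousD.
- by apply: le_trans (le_normcD _ _) _; exact: lerD.
- by apply: le_trans (le_normcD _ _) _; exact: lerD.
- have -> : f t z + g t z - (f 0 z + g 0 z) - t%:C * (df z + dg z) =
    (f t z - f 0 z - t%:C * df z) + (g t z - g 0 z - t%:C * dg z) by ring.
  by apply: le_trans (le_normcD _ _) _; rewrite mulrDl; exact: lerD.
Qed.

Lemma jetM f df g dg : jet f df -> jet g dg ->
  jet (fun t z => f t z * g t z) (fun z => df z * g 0 z + f 0 z * dg z).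
Proof.
(* The remainder splits into four terms, each at most M N t^2; for the one of third order this uses
   |t| <= 1. *)
move=> [M fM] [N gN]; exists (M * N *+ 4).
have t1 : \forall t \near (0 : R), `|t| <= 1.
  by have := @nbhs0_le R R^o 1 ltr01; apply: filterS.
have f0M := nbhs_singleton fM; have g0N := nbhs_singleton gN.
apply: filterS3 fM gN t1 => t ht kt tle1 z Kz.
have [fc fb f1b fr] := ht z Kz; have [gc gb g1b gr] := kt z Kz.
have [_ f0b _ _] := f0M z Kz; have [_ g0b _ _] := g0N z Kz.
have M0 : 0 <= M := le_trans (normc_ge0 _) fb.
have N0 : 0 <= N := le_trans (normc_ge0 _) gb.
have MN0 : 0 <= M * N by exact: mulr_ge0.
have bM (x y : C) : Normc.normc x <= M -> Normc.normc y <= N -> Normc.normc (x * y) <= M * N.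
  by move=> xM yN; rewrite Normc.normcM ler_pM ?normc_ge0.
split.
- exact: CcontinuousM.
- by apply: le_trans (bM _ _ fb gb) _; rewrite -mulr_natl ler_peMl // ler1n.
- apply: le_trans (le_normcD _ _) _; apply: le_trans (lerD (bM _ _ f1b g0b) (bM _ _ f0b g1b)) _.
  by move: MN0; lra.
set r := f t z - f 0 z - t%:C * df z in fr; set s := g t z - g 0 z - t%:C * dg z in gr.
have -> : f t z * g t z - f 0 z * g 0 z - t%:C * (df z * g 0 z + f 0 z * dg z) =
   (r * g t z + f 0 z * s) + (t%:C * (df z * s) + t%:C * t%:C * (df z * dg z)).
  by rewrite /r /s; ring.
have t20 : 0 <= t ^+ 2 by exact: sqr_ge0.
have n1 : Normc.normc (r * g t z) <= M * N * t ^+ 2.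
  by rewrite Normc.normcM mulrAC ler_pM ?normc_ge0.
have n2 : Normc.normc (f 0 z * s) <= M * N * t ^+ 2.
  by rewrite Normc.normcM -mulrA ler_pM ?normc_ge0.
have n3 : Normc.normc (t%:C * (df z * s)) <= M * N * t ^+ 2.
  rewrite Normc.normcM normc_real -[leRHS]mul1r ler_pM ?normc_ge0 //.
  by rewrite Normc.normcM -mulrA ler_pM ?normc_ge0.
have n4 : Normc.normc (t%:C * t%:C * (df z * dg z)) <= M * N * t ^+ 2.
  rewrite !Normc.normcM !normc_real -expr2 real_normK ?num_real // mulrC.
  by rewrite ler_wpM2r // ler_pM ?normc_ge0.
apply: le_trans (le_normcD _ _) _.
apply: le_trans (lerD (le_normcD _ _) (le_normcD _ _)) _.
apply: le_trans (lerD (lerD n1 n2) (lerD n3 n4)) _.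
by rewrite le_eqVlt; apply/orP; left; apply/eqP; ring.
Qed.

Lemma jet_cst h : (exists M, forall z, K z -> Normc.normc (h z) <= M) ->
  (forall z, K z -> Ccontinuous_at h z) -> jet (fun _ => h) (fun _ => 0).
Proof.
move=> [M hM] hc; exists M; near=> t => z Kz.
have M0 : 0 <= M := le_trans (normc_ge0 _) (hM z Kz).
have n0 : Normc.normc (0 : C) = 0 by exact: Normc.normc0.
split; [exact: hc|exact: hM|by rewrite n0|].
by rewrite subrr mulr0 subr0 n0 mulr_ge0 ?sqr_ge0.
Unshelve. all: end_near. Qed.

Hypothesis cK : compact K.

Lemma jet_continuous h : (forall z, K z -> Ccontinuous_at h z) ->
  jet (fun _ => h) (fun _ => 0).
Proof. by move=> hc; apply: jet_cst => //; exact: Ccontinuous_bounded. Qed.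

Lemma jet_param : jet (fun t _ => t%:C) (fun _ => 1).
Proof.
exists 1; have t1 : \forall t \near (0 : R), `|t| <= 1.
  by have := @nbhs0_le R R^o 1 ltr01; apply: filterS.
apply: filterS t1 => t t1 z Kz.
have n1 : Normc.normc (1 : C) = 1 by exact: Normc.normc1.
split; [exact: Ccontinuous_cst|by rewrite normc_real|by rewrite n1|].
by rewrite mulr1 subr0 subrr Normc.normc0 mul1r sqr_ge0.
Qed.

Lemma jet_sum (J : Type) (l : seq J) (P : pred J) (F : J -> R -> V -> C) (F1 : J -> V -> C) :
  (forall i, P i -> jet (F i) (F1 i)) ->
  jet (fun t z => \sum_(i <- l | P i) F i t z) (fun z => \sum_(i <- l | P i) F1 i z).
Proof.
move=> FJ; elim: l => [|i l IH].
  have j0 : jet (fun _ _ => 0) (fun _ => 0).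
    by apply: jet_continuous => z _; exact: Ccontinuous_cst.
  apply: jet_eq (jet_ext j0 _) _ => [z _|t z]; by rewrite big_nil.
case: (boolP (P i)) => Pi; last first.
  by apply: jet_eq (jet_ext IH _) _ => [z _|t z]; rewrite big_cons (negbTE Pi).
by apply: jet_eq (jet_ext (jetD (FJ i Pi) IH) _) _ => [z _|t z]; rewrite big_cons Pi.
Qed.

Lemma jet_sum_ex (J : Type) (l : seq J) (P : pred J) (F : J -> R -> V -> C) :
  (forall i, P i -> exists dF, jet (F i) dF) ->
  exists dF, jet (fun t z => \sum_(i <- l | P i) F i t z) dF.
Proof.
move=> FJ; have FJ' i : exists dF, P i -> jet (F i) dF.
  by have [/FJ[dF ?]|_] := boolP (P i); [exists dF|exists (fun _ => 0)].
exists (fun z => \sum_(i <- l | P i) projT1 (cid (FJ' i)) z).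
by apply: jet_sum => i Pi; case: cid => dF /= /(_ Pi).
Qed.

Lemma jet_prod (J : Type) (l : seq J) (F : J -> R -> V -> C) :
  (forall i, exists F1, jet (F i) F1) ->
  exists F1, jet (fun t z => \prod_(i <- l) F i t z) F1.
Proof.
move=> FJ; elim: l => [|i l [G1 IH]].
  exists (fun _ => 0).
  have j0 : jet (fun _ _ => 1) (fun _ => 0).
    by apply: jet_continuous => z _; exact: Ccontinuous_cst.
  by apply: jet_eq j0 _ => t z; rewrite big_nil.
have [F1 Fi] := FJ i; eexists; apply: jet_eq (jetM Fi IH) _ => t z.
by rewrite big_cons.
Qed.

Lemma jet_conj f df : jet f df -> jet (fun t z => ((f t z)^*)%R) (fun z => ((df z)^*)%R).
Proof.
move=> [M fM]; exists M; apply: filterS fM => t ht z Kz.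
have [fc fb f1b fr] := ht z Kz; split; rewrite ?normc_conj //.
  exact: Ccontinuous_conj.
have -> : ((f t z)^* - (f 0 z)^* - t%:C * (df z)^* = (f t z - f 0 z - t%:C * df z)^*)%R.
  case: (f t z) (f 0 z) (df z) => a b [c d] [x y]; simpc; congr (_ +i* _); ring.
by rewrite normc_conj.
Qed.

(** By compactness 1/f_0 is bounded by some B. The expansion moves f by at most 1/(2B) for small
    [t], uniformly on [K], so 2B bounds the perturbed inverse. *)
Lemma jet_neq0 f df : jet f df -> (forall z, K z -> f 0 z != 0) ->
  exists B, \forall t \near (0 : R), forall z, K z -> f t z != 0 /\ Normc.normc (f t z)^-1 <= B.
Proof.
move=> [M fM] f0.
have [B BP] : exists B, forall z, K z -> Normc.normc (f 0 z)^-1 <= B.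
  apply: Ccontinuous_bounded => // z Kz; apply: CcontinuousV; first exact: f0.
  by have [] := nbhs_singleton fM z Kz.
exists (B *+ 2).
(* A point of [K] is what makes B positive, so the empty set is treated apart. *)
have [->|[z0 Kz0]] : K = set0 \/ K !=set0.
  by have [->|/set0P] := eqVneq K set0; [left|right].
  by apply: filterE => t z.
have B0 : 0 < B.
  apply: lt_le_trans (BP z0 Kz0); rewrite lt_neqAle normc_ge0 andbT eq_sym.
  by apply: contraNneq (f0 z0 Kz0) => /Normc.eq0_normc /eqP; rewrite invr_eq0.
have M0 : 0 <= M.
  by have [_ fb _ _] := nbhs_singleton fM z0 Kz0; exact: le_trans (normc_ge0 _) fb.
have t1 : \forall t \near (0 : R), `|t| <= 1.
  by have := @nbhs0_le R R^o 1 ltr01; apply: filterS.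
(* The drift is at most M |t| + M t^2 <= 2M |t|, so |t| <= d keeps it below 1/(2B); the added 1
   makes the divisor positive even for M = 0. *)
pose d := (B *+ 2 * (M *+ 2 + 1))^-1.
have M21 : 0 < M *+ 2 + 1 by rewrite ltr_wpDl // mulrn_wge0.
have d0 : 0 < d by rewrite invr_gt0 mulr_gt0 ?pmulrn_lgt0.
have td : \forall t \near (0 : R), `|t| <= d.
  by have := @nbhs0_le R R^o d d0; apply: filterS.
apply: filterS3 fM t1 td => t ht t1 td z Kz.
have [_ _ f1b fr] := ht z Kz.
have low : B^-1 <= Normc.normc (f 0 z).
  have := BP z Kz; rewrite Normc.normcV -[leRHS]invrK lef_pV2 ?posrE ?invr_gt0 //.
  rewrite lt_neqAle normc_ge0 andbT eq_sym.
  by apply: contraNneq (f0 z Kz) => /Normc.eq0_normc ->.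
have dif : Normc.normc (f 0 z - f t z) <= (B *+ 2)^-1.
  have -> : f 0 z - f t z = - (f t z - f 0 z - t%:C * df z) - t%:C * df z by ring.
  apply: le_trans (le_normcD _ _) _; rewrite !normcN Normc.normcM normc_real.
  have h1 : M * t ^+ 2 <= M * `|t|.
    by rewrite ler_wpM2l // -real_normK ?num_real // expr2 ler_piMr.
  apply: (le_trans (lerD (le_trans fr h1) (ler_wpM2l (normr_ge0 t) f1b))).
  apply: (@le_trans _ _ (`|t| * (M *+ 2 + 1))).
    have -> : `|t| * (M *+ 2 + 1) = M * `|t| + `|t| * M + `|t| by ring.
    by rewrite lerDl.
  apply: (@le_trans _ _ (d * (M *+ 2 + 1))); first by rewrite ler_wpM2r // ltW.
  by rewrite /d invfM -mulrA mulVf ?mulr1 // gt_eqF.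
have lowt : (B *+ 2)^-1 <= Normc.normc (f t z).
  have e2 : B^-1 = (B *+ 2)^-1 + (B *+ 2)^-1.
    by rewrite -mulr_natl invfM -mulrDl; field; rewrite gt_eqF.
  rewrite -(lerD2r (B *+ 2)^-1) -e2 (le_trans low) //.
  have -> : f 0 z = f t z + (f 0 z - f t z) by ring.
  by apply: le_trans (le_normcD _ _) _; rewrite lerD2l.
have ft0 : f t z != 0.
  apply/negP => /eqP ft0; move: lowt; rewrite ft0 Normc.normc0 leNgt invr_gt0.
  by rewrite pmulrn_lgt0 // B0.
split=> //; rewrite Normc.normcV -[leRHS]invrK lef_pV2 ?posrE ?invr_gt0 ?pmulrn_lgt0 //.
rewrite lt_neqAle normc_ge0 andbT eq_sym.
by apply: contraNneq ft0 => /Normc.eq0_normc ->.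
Qed.

Lemma jetV f df : jet f df -> (forall z, K z -> f 0 z != 0) ->
  jet (fun t z => (f t z)^-1) (fun z => - df z * (f 0 z)^-1 ^+ 2).
Proof.
move=> fj f0; have [B fB] := jet_neq0 fj f0; have [M fM] := fj.
(* The summands bound the value, the derivative and the remainder of the inverse, in that order. *)
exists (B + M * B ^+ 2 + (M * M) * B ^+ 3 *+ 3).
have t1 : \forall t \near (0 : R), `|t| <= 1.
  by have := @nbhs0_le R R^o 1 ltr01; apply: filterS.
have f0M := nbhs_singleton fM; have f0B := nbhs_singleton fB.
apply: filterS3 fM fB t1 => t ht hB t1 z Kz.
have [fc fb f1b fr] := ht z Kz; have [_ f0b _ _] := f0M z Kz.
have [ft0 ftB] := hB z Kz; have [fz0 fzB] := f0B z Kz.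
have M0 : 0 <= M := le_trans (normc_ge0 _) fb.
have B0 : 0 <= B := le_trans (normc_ge0 _) ftB.
have MB0 : 0 <= M * B ^+ 2 by rewrite mulr_ge0 ?exprn_ge0.
have MMB0 : 0 <= (M * M) * B ^+ 3 *+ 3 by rewrite mulrn_wge0 // !mulr_ge0 ?exprn_ge0.
have bM (a b : R) (x y : C) : Normc.normc x <= a -> Normc.normc y <= b ->
    Normc.normc (x * y) <= a * b.
  by move=> xM yN; rewrite Normc.normcM ler_pM ?normc_ge0.
have B2 : Normc.normc ((f 0 z)^-1 ^+ 2) <= B ^+ 2 by rewrite !expr2; exact: bM.
split.
- exact: CcontinuousV.
- by apply: (le_trans ftB); rewrite -addrA lerDl addr_ge0.
- rewrite mulNr normcN; apply: (le_trans (bM _ _ _ _ f1b B2)).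
  by rewrite -addrA addrCA lerDl addr_ge0.
set r := f t z - f 0 z - t%:C * df z in fr.
(* Substituting f_t = f_0 + t df + r over the common denominator f_t f_0^2 leaves only terms of
   order t^2. *)
have -> : (f t z)^-1 - (f 0 z)^-1 - t%:C * (- df z * (f 0 z)^-1 ^+ 2) =
    (t%:C * t%:C * (df z * df z) + (t%:C * (df z * r) - r * f 0 z)) *
    ((f t z)^-1 * (f 0 z)^-1 ^+ 2).
  by rewrite /r; field; rewrite ft0 fz0.
have Mt0 : 0 <= M * t ^+ 2 by rewrite mulr_ge0 ?sqr_ge0.
have n1 : Normc.normc (t%:C * t%:C * (df z * df z)) <= (M * M) * t ^+ 2.
  rewrite !Normc.normcM !normc_real -expr2 real_normK ?num_real // mulrC.
  by rewrite ler_wpM2r ?sqr_ge0 // ler_pM ?normc_ge0.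
have n2 : Normc.normc (t%:C * (df z * r)) <= (M * M) * t ^+ 2.
  rewrite Normc.normcM normc_real -[leRHS]mul1r ler_pM ?normc_ge0 //.
  by rewrite -mulrA; exact: bM.
have n3 : Normc.normc (- (r * f 0 z)) <= (M * M) * t ^+ 2.
  by rewrite normcN mulrAC; exact: bM.
have n4 : Normc.normc (t%:C * t%:C * (df z * df z) + (t%:C * (df z * r) - r * f 0 z)) <=
    (M * M) * t ^+ 2 *+ 3.
  apply: (le_trans (le_normcD _ _)).
  rewrite [leRHS]mulrS mulr2n; apply: (lerD n1).
  by apply: (le_trans (le_normcD _ _)); exact: lerD.
apply: (le_trans (bM _ _ _ _ n4 (bM _ _ _ _ ftB B2))).
apply: (@le_trans _ _ ((M * M) * B ^+ 3 *+ 3 * t ^+ 2)).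
  by rewrite le_eqVlt; apply/orP; left; apply/eqP; ring.
by rewrite ler_wpM2r ?sqr_ge0 // lerDr addr_ge0.
Qed.

Lemma jetN f df : jet f df -> jet (fun t z => - f t z) (fun z => - df z).
Proof.
move=> fj; have c1 : jet (fun _ _ => -1) (fun _ => 0).
  by apply: jet_continuous => z _; exact: Ccontinuous_cst.
apply: jet_eq (jet_ext (jetM c1 fj) _) _ => [z _|t z]; last exact: mulN1r.
by rewrite mul0r add0r mulN1r.
Qed.

Lemma jetZ (c : C) f df : jet f df -> jet (fun t z => c * f t z) (fun z => c * df z).
Proof.
move=> fj; have c1 : jet (fun _ _ => c) (fun _ => 0).
  by apply: jet_continuous => z _; exact: Ccontinuous_cst.
by apply: jet_ext (jetM c1 fj) _ => z _; rewrite mul0r add0r.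
Qed.

Lemma jet_affine (a b : V -> C) : (forall z, K z -> Ccontinuous_at a z) ->
  (forall z, K z -> Ccontinuous_at b z) -> jet (fun t z => a z + t%:C * b z) b.
Proof.
move=> ac bc; have aj := jet_continuous ac; have bj := jet_continuous bc.
apply: jet_ext (jetD aj (jetM jet_param bj)) _ => z _.
by rewrite add0r mul1r mulr0 addr0.
Qed.

Lemma jet_det k (A : R -> V -> 'M[C]_k) :
  (forall a b, exists df, jet (fun t z => A t z a b) df) ->
  exists df, jet (fun t z => \det (A t z)) df.
Proof.
move=> Aj.
rewrite /determinant; apply: jet_sum_ex => s _.
have [i|df Fj] := @jet_prod _ (index_enum 'I_k) (fun i t z => A t z i (perm.fun_of_perm s i)).
  exact: Aj.
by eexists; apply: jetZ Fj.
Qed.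

End JetCalculus.
End Jets.

(** * Integrating expansions against a cutoff *)

Section CutoffIntegral.
Context {R : realType}.
Local Open Scope classical_set_scope.
Local Open Scope ring_scope.
Local Notation C := R[i].

Lemma quad_derive (g : R -> R) (dg : R) :
  (exists M, \forall t \near (0 : R), `|g t - g 0 - t * dg| <= M * t ^+ 2) ->
  derivable g 0 1 /\ 'D_1 g 0 = dg.
Proof.
move=> [M gM].
have lim : (fun h => h^-1 *: ((g \o shift 0) (h *: (1 : R^o)) - g 0)) @ (0 : R)^' --> dg.
  apply/cvgrPdist_le => e e0.
  have M1 : 0 < `|M| + 1 by rewrite ltr_wpDl.
  have te : \forall t \near (0 : R), `|t| <= e / (`|M| + 1).
    by have := @nbhs0_le R R^o _ (divr_gt0 e0 M1); apply: filterS.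
  near=> h; have h0 : h != 0 by near: h; exact: nbhs_dnbhs_neq.
  have hM : `|g h - g 0 - h * dg| <= M * h ^+ 2 by near: h; exact: nbhs_dnbhs.
  have he : `|h| <= e / (`|M| + 1) by near: h; exact: nbhs_dnbhs.
  have -> : dg - h^-1 *: ((g \o shift 0) (h *: (1 : R^o)) - g 0) =
      - (h^-1 * (g h - g 0 - h * dg)).
    by rewrite /= addr0 /GRing.scale /= mulr1; field.
  rewrite normrN normrM normfV ler_pdivrMl ?normr_gt0 //.
  apply: (le_trans hM); rewrite -real_normK ?num_real // expr2 mulrA [leRHS]mulrC.
  rewrite ler_wpM2r //; apply: (@le_trans _ _ ((`|M| + 1) * `|h|)).
    by rewrite ler_wpM2r // (le_trans (ler_norm _)) // lerDl.
  by rewrite mulrC -ler_pdivlMr.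
by split; [apply/cvg_ex; exists dg|apply/cvg_lim].
Unshelve. all: end_near. Qed.

(** What is left of a [jet] after integration. The quadratic remainder gives differentiability
    together with the value of the derivative. *)
Definition cquad (I : R -> C) (dI : C) := exists M, \forall t \near (0 : R),
  Normc.normc (I t - I 0 - t%:C * dI) <= M * t ^+ 2.

Lemma cquad_derive I dI : cquad I dI ->
  Cderivable (I : R^o -> C) 0 1 /\ Cderive (I : R^o -> C) 0 1 = dI.
Proof.
move=> [M IM].
have [r1 r2] : derivable (fun t => complex.Re (I t)) 0 1 /\
    'D_1 (fun t => complex.Re (I t)) 0 = complex.Re dI.
  apply: quad_derive; exists M; apply: filterS IM => t; apply: le_trans.
  apply: le_trans (normc_Re _); rewrite le_eqVlt; apply/orP; left; apply/eqP; congr `|_|.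
  by case: (I t) (I 0) (dI) => a b [c d] [x y] /=; ring.
have [i1 i2] : derivable (fun t => complex.Im (I t)) 0 1 /\
    'D_1 (fun t => complex.Im (I t)) 0 = complex.Im dI.
  apply: quad_derive; exists M; apply: filterS IM => t; apply: le_trans.
  apply: le_trans (normc_Im _); rewrite le_eqVlt; apply/orP; left; apply/eqP; congr `|_|.
  by case: (I t) (I 0) (dI) => a b [c d] [x y] /=; ring.
split; first by split.
by rewrite /Cderive r2 i2; case: (dI).
Qed.

Lemma cquad_sum (J : Type) (l : seq J) (F : J -> R -> C) (dF : J -> C) :
  (forall i, cquad (F i) (dF i)) ->
  cquad (fun t => \sum_(i <- l) F i t) (\sum_(i <- l) dF i).
Proof.
move=> FJ; elim: l => [|i l [M IM]].
  by exists 0; apply: filterE => t; rewrite !big_nil mulr0 !subr0 Normc.normc0 mul0r.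
have [N FN] := FJ i; exists (N + M); apply: filterS2 FN IM => t h1 h2.
rewrite !big_cons mulrDl.
have -> : F i t + \sum_(j <- l) F j t - (F i 0 + \sum_(j <- l) F j 0) -
    t%:C * (dF i + \sum_(j <- l) dF j) =
  (F i t - F i 0 - t%:C * dF i) + (\sum_(j <- l) F j t - \sum_(j <- l) F j 0 -
    t%:C * \sum_(j <- l) dF j) by ring.
by apply: (le_trans (le_normcD _ _)); exact: lerD.
Qed.

Lemma cquad_near I J dI : (\forall t \near (0 : R), I t = J t) -> cquad I dI -> cquad J dI.
Proof.
move=> IJ [M IM]; exists M; have IJ0 := nbhs_singleton IJ.
by apply: filterS2 IJ IM => t <-; rewrite -IJ0.
Qed.

Section Cutoff.
Context {m : nat}.
Variables (V K : set 'rV[R]_m) (rho : 'rV[R]_m -> R).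
Hypothesis V_open : open V.
Hypothesis K_compact : compact K.
Hypothesis KV : K `<=` V.
Hypothesis rho_supp : forall z, V z -> rho z != 0 -> K z.
Hypothesis rho_cont : forall z, V z -> Ccontinuous_at (fun y => (rho y)%:C) z.
Implicit Types (f g : 'rV[R]_m -> C).

(** The integrand of [integralX] in a single chart. *)
Definition cutoff f z : C := if z \in V then (rho z)%:C * f z else 0.

Lemma cutoff_eq f g : (forall z, K z -> f z = g z) -> cutoff f = cutoff g.
Proof.
move=> fg; apply/funext => z; rewrite /cutoff; case: ifPn => // /set_mem Vz.
by have [->|/(rho_supp Vz)/fg->//] := eqVneq (rho z) 0; rewrite !mul0r.
Qed.

Lemma cutoff_out f z : ~ K z -> cutoff f z = 0.
Proof.
move=> Kz; rewrite /cutoff; case: ifPn => // /set_mem Vz.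
by have [->|/(rho_supp Vz)//] := eqVneq (rho z) 0; rewrite mul0r.
Qed.

(** At points of [K] the cutoff is a product of continuous functions nearby, because [V] is open;
    elsewhere it vanishes on the open complement of [K]. *)
Lemma cutoff_continuous f z : (forall z, K z -> Ccontinuous_at f z) ->
  Ccontinuous_at (cutoff f) z.
Proof.
move=> fc; have [Kz|Kz] := pselect (K z).
  have Vz := KV Kz.
  apply: (@Ccontinuous_near _ _ (fun y => (rho y)%:C * f y)).
    have := open_nbhs_nbhs (conj V_open Vz); apply: filterS => y Vy.
    by rewrite /cutoff mem_set.
  by apply: CcontinuousM; [exact: rho_cont|exact: fc].
apply: (@Ccontinuous_near _ _ (fun _ => 0)); last exact: Ccontinuous_cst.
have Kcl : closed K by apply: compact_closed => //; exact: norm_hausdorff.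
have := open_nbhs_nbhs (conj (closed_openC Kcl) Kz); apply: filterS => y Ky.
by rewrite cutoff_out.
Qed.

Lemma compact_in_box : exists2 A : R, 0 <= A & forall z, K z -> forall j, `|z 0 j| <= A.
Proof.
have [M [_ /(_ (`|M| + 1)) hM]] := compact_bounded K_compact.
exists (`|M| + 1); first by rewrite addr_ge0.
move=> z Kz j; have : `|z| <= `|M| + 1.
  by apply: hM => //; rewrite (le_lt_trans (ler_norm _)) // ltrDl.
apply: le_trans; rewrite /Num.norm /= mx_normrE.
by apply: (le_bigmax _ (fun i => `|z i.1 i.2|) (0, j)).
Qed.

Lemma cutoff_supported f : (forall z, K z -> Ccontinuous_at f z) ->
  forall A, (forall z, K z -> forall j, `|z 0 j| <= A) ->
  box_supported A (fun z => complex.Re (cutoff f z)) /\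
  box_supported A (fun z => complex.Im (cutoff f z)).
Proof.
move=> fc A KA; have out (z : 'rV[R]_m) : (exists j, A < `|z 0 j|) -> ~ K z.
  by move=> [j Aj] /KA/(_ j); rewrite leNgt Aj.
split; split=> [z|z /out/cutoff_out->//].
  by have [] := cutoff_continuous z fc.
by have [] := cutoff_continuous z fc.
Qed.

Definition cutoff_int f : C := Cintegral_Rm (cutoff f).

(** Real parts commute with the integral since [Cintegral_Rm] integrates real and imaginary parts
    separately and the cutoff factor is real. *)
Lemma cutoff_int_linear f g h k : (forall z, K z -> Ccontinuous_at f z) ->
  (forall z, K z -> Ccontinuous_at g z) -> (forall z, K z -> Ccontinuous_at h z) ->
  (forall z, K z -> k z = f z + 2 * (complex.Re (g z))%:C - 2 * (complex.Re (h z))%:C) ->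
  cutoff_int k = cutoff_int f + 2 * (complex.Re (cutoff_int g))%:C
    - 2 * (complex.Re (cutoff_int h))%:C.
Proof.
move=> fc gc hc kE; have [A A0 KA] := compact_in_box.
have [iD iZ _] := @integral_Rm_lin_bound R m A A0.
have [fr fi] := cutoff_supported fc KA; have [gr _] := cutoff_supported gc KA.
have [hr _] := cutoff_supported hc KA.
have reE z : complex.Re (cutoff k z) = complex.Re (cutoff f z) +
   (2 * complex.Re (cutoff g z) + (-2) * complex.Re (cutoff h z)).
  rewrite (cutoff_eq kE) /cutoff; case: ifPn => _; last by rewrite /= !mulr0 !addr0.
  by case: (f z) (g z) (h z) => a b [c d] [x y] /=; ring.
have imE z : complex.Im (cutoff k z) = complex.Im (cutoff f z).
  rewrite (cutoff_eq kE) /cutoff; case: ifPn => _ //.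
  by case: (f z) (g z) (h z) => a b [c d] [x y] /=; ring.
rewrite /cutoff_int /Cintegral_Rm.
have -> : (fun z => complex.Im (cutoff k z)) = (fun z => complex.Im (cutoff f z)).
  by apply/funext.
have -> : (fun z => complex.Re (cutoff k z)) = (fun z => complex.Re (cutoff f z) +
   (2 * complex.Re (cutoff g z) + (-2) * complex.Re (cutoff h z))).
  by apply/funext.
have g2 := box_supportedZ 2 gr; have h2 := box_supportedZ (-2) hr.
rewrite iD ?iD ?iZ //; last exact: box_supportedD.
by apply/eqP; rewrite eq_complex /=; apply/andP; split; apply/eqP; ring.
Qed.

(** The integral of the remainder is controlled by its sup norm on a cube. The function [k] stands
    for [df], of which a [jet] asserts no continuity. *)
Lemma cutoff_int_quad (f : R -> 'rV[R]_m -> C) df k : jet K f df ->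
  (forall z, K z -> Ccontinuous_at k z) -> (forall z, K z -> df z = k z) ->
  cquad (fun t => cutoff_int (f t)) (cutoff_int k).
Proof.
move=> [M fM] kc dfk; have [A A0 KA] := compact_in_box.
have [iD iZ iB] := @integral_Rm_lin_bound R m A A0.
have [N rN] : exists N, forall z, K z -> Normc.normc (rho z)%:C <= N.
  by apply: Ccontinuous_bounded => // z /KV; exact: rho_cont.
have f0M := nbhs_singleton fM.
(* N bounds the cutoff weight, M the remainder, the power is the volume of the cube, and the factor
   2 adds the real and imaginary parts. *)
exists ((`|N| * `|M|) * (A + A) ^+ m *+ 2); apply: filterS fM => t ht.
have [kr ki] := cutoff_supported kc KA.
have [ftr fti] := cutoff_supported (fun z Kz => let: And4 c _ _ _ := ht z Kz in c) KA.
have [f0r f0i] := cutoff_supported (fun z Kz => let: And4 c _ _ _ := f0M z Kz in c) KA.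
pose d z := cutoff (f t) z - cutoff (f 0) z - t%:C * cutoff k z.
have bnd z : Normc.normc (d z) <= `|N| * `|M| * t ^+ 2.
  have [Kz|Kz] := pselect (K z); last first.
    rewrite /d !cutoff_out // mulr0 !subr0 Normc.normc0.
    by apply: mulr_ge0; [apply: mulr_ge0|exact: sqr_ge0].
  rewrite /d /cutoff mem_set; last exact: KV.
  have -> : (rho z)%:C * f t z - (rho z)%:C * f 0 z - t%:C * ((rho z)%:C * k z) =
     (rho z)%:C * (f t z - f 0 z - t%:C * df z) by rewrite dfk //; ring.
  have [_ _ _ fr] := ht z Kz.
  rewrite Normc.normcM -mulrA ler_pM ?normc_ge0 //.
    by apply: (le_trans (rN z Kz)); exact: ler_norm.
  by apply: (le_trans fr); rewrite ler_wpM2r ?sqr_ge0 // ler_norm.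
have part (p : C -> R) (pD : forall x y, p (x + y) = p x + p y)
    (pZ : forall (c : R) x, p (c%:C * x) = c * p x)
    (pb : forall x, `|p x| <= Normc.normc x) :
    box_supported A (fun z => p (cutoff (f t) z)) ->
    box_supported A (fun z => p (cutoff (f 0) z)) ->
    box_supported A (fun z => p (cutoff k z)) ->
  `|integral_Rm (fun z => p (cutoff (f t) z)) - integral_Rm (fun z => p (cutoff (f 0) z))
    - t * integral_Rm (fun z => p (cutoff k z))| <= `|N| * `|M| * t ^+ 2 * (A + A) ^+ m.
  move=> st s0 sk.
  have s0' := box_supportedZ (-1) s0; have sk' := box_supportedZ (- t) sk.
  have := iB (`|N| * `|M| * t ^+ 2) _ (box_supportedD st (box_supportedD s0' sk')).
  rewrite iD ?iD ?iZ //; last exact: box_supportedD.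
  rewrite !addrA mulN1r mulNr; apply=> z; apply: le_trans (bnd z).
  apply: le_trans (pb _); rewrite le_eqVlt; apply/orP; left; apply/eqP; congr `|_|.
  have -> : d z = cutoff (f t) z + ((-1)%:C * cutoff (f 0) z + (- t)%:C * cutoff k z).
    by rewrite /d !rmorphN rmorph1; ring.
  by rewrite !pD !pZ.
have hre := part (@complex.Re R) _ _ normc_Re ftr f0r kr.
have him := part (@complex.Im R) _ _ normc_Im fti f0i ki.
apply: le_trans (normc_le_ReIm _) _; rewrite mulrnAl mulr2n.
apply: lerD; rewrite mulrAC.
  apply: le_trans (hre _ _); first by rewrite /cutoff_int /Cintegral_Rm /= !mul0r !subr0.
    by case=> a b [c d'].
  by move=> c [a b]; rewrite /= mul0r subr0.
apply: le_trans (him _ _).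
    by rewrite /cutoff_int /Cintegral_Rm /= mul0r addr0.
  by case=> a b [c d'].
by move=> c [a b]; rewrite /= mul0r addr0.
Qed.

Lemma cutoff_int_ge0 f : (forall z, V z -> 0 <= rho z) ->
  (forall z, V z -> 0 <= f z) -> 0 <= cutoff_int f.
Proof.
move=> r0 f0; have c0 z : 0 <= cutoff f z.
  rewrite /cutoff; case: ifPn => // /set_mem Vz.
  by rewrite mulr_ge0 ?f0 // ler0c r0.
have int0 k (g : 'rV[R]_k -> R) : (forall z, 0 <= g z) -> 0 <= integral_Rm g.
  elim: k g => [|k IH] g g0; first exact: g0.
  by apply: Rintegral_ge0 => t _; apply: IH => v; exact: g0.
rewrite lecE /= int0 ?andbT.
  rewrite (_ : (fun z => complex.Im (cutoff f z)) = cst 0) ?integral_Rm0 //.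
  by apply/funext => z; exact: ger0_Im (c0 z).
by move=> z; have := c0 z; rewrite lecE => /andP[].
Qed.

End Cutoff.
End CutoffIntegral.

(** * The variation at a point *)

Section Variation.
Context {R : realType} {n : nat}.
Local Notation C := R[i].
Local Notation E := (ext R n).
Implicit Types (a b u v : E).

Variables (w : E) (m : nat).
Hypothesis w11 : is_type 1 1 w.
Hypothesis w_real : econj w = w.
Hypothesis w_unit : herm_mx w \in unitmx.
Hypothesis mn : (m + 3)%N = n.

(** Here [m] is n - 3. Placing omega_m in the middle matches [star12]; [pairingE] restores the order
    used in the functional. *)
Definition pairing a b : C := density ('i *: wedge a (wedge (divpow w m) (econj b))).

Lemma pairingDl a1 a2 b : pairing (a1 + a2) b = pairing a1 b + pairing a2 b.
Proof. by rewrite /pairing wedgeDl scalerDr densityD. Qed.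

Lemma pairingZl (c : C) a b : pairing (c *: a) b = c * pairing a b.
Proof. by rewrite /pairing wedgeZl scalerA mulrC -scalerA densityZ. Qed.

Lemma pairingNl a b : pairing (- a) b = - pairing a b.
Proof. by rewrite /pairing wedgeNl scalerN densityN. Qed.

Lemma pairing_comb (c : C) a b d v : pairing d v = 0 ->
  pairing (a - c *: (b + d)) v = pairing a v - pairing (c *: b) v.
Proof.
move=> dv; have e : pairing (c *: (b + d)) v = pairing (c *: b) v.
  by rewrite (pairingZl c (b + d)) (pairingDl b d) dv addr0 -(pairingZl c b).
by rewrite (pairingDl a) (pairingNl (c *: (b + d))) e.
Qed.

Lemma pairingE a b :
  pairing a b = density ('i *: wedge (wedge a (econj b)) (divpow w m)).
Proof. by rewrite /pairing (wedge_divpow_comm w11) wedgeA. Qed.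

Lemma econj_divpow (k : nat) : econj (divpow w k) = divpow w k.
Proof.
elim: k => [|k IH]; first by rewrite divpow0 econj1.
have := congr1 (@econj R n) (divpowS w k).
rewrite econjM w_real IH econjZ conjC_nat divpowS.
have k0 : (k.+1%:R : C) != 0 by rewrite pnatr_eq0.
by move=> e; apply: (scalerI k0); exact: (esym e).
Qed.

(** Conjugation turns i into -i, and exchanging two forms of odd degree gives a second sign. *)
Lemma pairing_conj a b : is_deg 3 a -> is_deg 3 b -> pairing b a = ((pairing a b)^*)%R.
Proof.
move=> da db; rewrite pairingE /pairing -density_econj.
  rewrite econjZ conjCi econjM econjM econjK econj_divpow.
  rewrite (wedge_divpow_comm w11) wedgeA; congr density.
  have odd3 : hat (econj a) = - econj a.
    by rewrite (is_deg_hat (is_deg_econj da)) exprS sqrrN expr1n mulr1 scaleN1r.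
  by rewrite (wedge_odd _ odd3) (is_deg_hat db) exprS sqrrN expr1n mulr1 scaleN1r
    !wedgeNl scaleNr scalerN opprK.
apply: is_degZ; have := is_deg_wedge da (is_deg_wedge (@is_deg_divpow _ _ _ w11 m) (is_deg_econj db)).
by congr (is_deg _ _); rewrite -mn; ring.
Qed.

(** The factor omega joins omega_m to give a multiple of omega_(m+1), which annihilates the
    primitive 3-form conj v since m + 1 + 3 > n. *)
Lemma pairing_form a v : is_deg 3 v -> Lam w v = 0 -> pairing (wedge w a) v = 0.
Proof.
move=> dv Lv; rewrite /pairing.
have hw := hat_form w11.
rewrite (wedge_even _ hw) -wedgeA [wedge w (wedge _ _)]wedgeA divpowS wedgeZl.
have -> : wedge (divpow w m.+1) (econj v) = 0.
  apply: (@prim_wedge0 _ _ w w11 w_unit 3 m.+1); first exact: is_deg_econj.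
    by rewrite -(econj_Lam w11 w_real) Lv econj0.
  by rewrite addSn mn.
by rewrite scaler0 wedge0r scaler0 density0.
Qed.

(** The i of the pairing cancels the -i of [star12]. *)
Lemma pairing_inner u v : is_type 1 2 u -> is_deg 3 v -> Lam w v = 0 ->
  pairing u v = inner w u v * density (divpow w n).
Proof.
move=> tu dv Lv; rewrite /pairing (@star12 _ _ _ w11 w_real w_unit u v m) // scalerA densityZ.
by congr (_ * _); rewrite mulrA mulrN -expr2 sqrCi opprK mul1r.
Qed.

Let n1 : (1 < n)%N. Proof. by rewrite -mn !addnS. Qed.

Let prE u : is_deg 3 u -> prim w u = u - (n.-1%:R)^-1 *: wedge w (Lam w u).
Proof. by move=> du; exact: (@primE _ _ _ w11 w_real w_unit). Qed.

Lemma prim_deg u : is_deg 3 u -> is_deg 3 (prim w u).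
Proof.
move=> du; rewrite prE //; apply: is_degD => //; apply/is_degN/is_degZ.
exact: (is_deg_wedge (is_type_deg w11) (is_deg_Lam du)).
Qed.

Lemma prim_Lam u : is_deg 3 u -> Lam w (prim w u) = 0.
Proof.
move=> du; have n0 : (n.-1%:R : C) != 0 by rewrite pnatr_eq0 -lt0n -ltnS (prednK (ltnW n1)).
have nE : n%:R - 1 = n.-1%:R :> C.
  by rewrite -{1}(prednK (ltnW n1)) -nat1r addrC addKr.
rewrite prE // LamD LamN LamZ (@Lam_wedge_form _ _ _ w11 w_unit); last exact: is_deg_Lam.
by rewrite nE scalerA mulVf // scale1r subrr.
Qed.

Lemma pairing_prim u v : is_deg 3 u -> is_deg 3 v -> Lam w v = 0 ->
  pairing (prim w u) v = pairing u v.
Proof.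
move=> du dv Lv; rewrite (prE du) pairingDl pairingNl pairingZl (pairing_form _ dv Lv).
by rewrite mulr0 subr0.
Qed.

Lemma inner_prim u v : is_deg 3 u -> is_deg 3 v -> Lam w v = 0 ->
  inner w (prim w u) v = inner w u v.
Proof.
move=> du dv Lv; rewrite (prE du) innerDl -scaleNr innerZl.
rewrite (@inner_wedge_form _ _ _ w11 w_real w_unit) Lv inner0r.
by rewrite mulr0 addr0.
Qed.

(** The type (1,2) is known for [u], and passing to [prim w u] adds a multiple of omega that is
    invisible to both sides. *)
Lemma pairing_prim_inner u v : is_type 1 2 u -> is_deg 3 v -> Lam w v = 0 ->
  pairing (prim w u) v = inner w (prim w u) v * density (divpow w n).
Proof.
move=> tu dv Lv; have du := is_type_deg tu.
by rewrite pairing_prim // inner_prim // pairing_inner.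
Qed.

Lemma pairing_prim_ge0 u : is_type 1 2 u -> posdef w ->
  0 <= pairing (prim w u) (prim w u).
Proof.
move=> tu wp; have du := is_type_deg tu; have dp := prim_deg du.
rewrite (pairing_prim_inner tu dp (prim_Lam du)).
have h1 := inner_ge0 w11 w_real wp dp.
have h2 := ltW (density_divpow_gt0 w11 w_real wp).
exact: (@mulr_ge0 C _ _ h1 h2).
Qed.

Section Terms.
(** In the application these are gamma, the dbar of omega and the dbar of gamma. *)
Variables (g u du : E).
Hypotheses (tg : is_type 1 1 g) (tu : is_type 1 2 u) (tdu : is_type 1 2 du).
Let v := prim w u.
Let c := (n.-1%:R : C)^-1.

Let du3 : is_deg 3 u. Proof. exact: is_type_deg tu. Qed.
Let ddu3 : is_deg 3 du. Proof. exact: is_type_deg tdu. Qed.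
Let dv3 : is_deg 3 v. Proof. exact: prim_deg. Qed.
Let Lv : Lam w v = 0. Proof. exact: prim_Lam. Qed.
Let tcL : is_type 0 1 (c *: Lam w u).
Proof. exact/is_typeZ/is_type_Lam. Qed.

Lemma inner_prim_pairing :
  inner w v (prim w du) * density (divpow w n) = ((pairing du v)^*)%R.
Proof.
rewrite -(pairing_prim_inner tu (prim_deg ddu3) (prim_Lam ddu3)).
by rewrite (pairing_conj (prim_deg ddu3) dv3) pairing_prim.
Qed.

(** [pu] stands for the (2,1)-part of d omega. Its contraction has type (1,0), so only the
    contraction of [u] survives in the (0,1)-part of the Lee form. *)
Lemma lee01_pairing pu : is_type 2 1 pu ->
  inner w (wedge (type_part 0 1 (c *: Lambda w (pu + u))) g) v * density (divpow w n) =
  pairing (wedge (c *: Lam w u) g) v.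
Proof.
move=> tpu; have -> : type_part 0 1 (c *: Lambda w (pu + u)) = c *: Lam w u.
  rewrite (@LambdaE _ _ _ w11 w_real w_unit) LamD scalerDr type_partD.
  have tpL : is_type 1 0 (c *: Lam w pu) by exact/is_typeZ/is_type_Lam.
  have t0 : type_part 0 1 (c *: Lam w pu) = 0 by exact: (type_part_eq0 tpL).
  exact: (etrans (congr2 +%R t0 (type_part_id tcL)) (add0r _)).
have tth : is_type 1 2 (wedge (c *: Lam w u) g) by exact: (is_type_wedge tcL tg).
by rewrite pairing_inner.
Qed.

(* The unknown derivative [dth] of the Lee form only enters through [omega /\ dth],
   which is orthogonal to the primitive form [v]. *)
Lemma pairing_variation (dth : E) : is_deg 1 dth ->
  let dv := du - c *: (wedge g (Lam w u) + wedge w dth) in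
  pairing dv v + pairing v dv =
    2 * (complex.Re ((pairing du v)^*)%R)%:C
    - 2 * (complex.Re (pairing (wedge (c *: Lam w u) g) v))%:C.
Proof.
move=> dth1 dv.
have hg : hat g = g by rewrite (is_deg_hat (is_type_deg tg)) sqrrN expr1n scale1r.
have ddv : is_deg 3 dv.
  apply: is_degD => //; apply/is_degN/is_degZ/is_degD.
    exact: (is_deg_wedge (is_type_deg tg) (is_type_deg (is_type_Lam tu))).
  exact: (is_deg_wedge (is_type_deg w11) dth1).
have we : wedge (c *: Lam w u) g = c *: wedge g (Lam w u).
  exact: (etrans (wedgeZl _ _ _) (congr1 (fun x => c *: x) (esym (wedge_even _ hg)))).
have e1 : pairing dv v = pairing du v - pairing (wedge (c *: Lam w u) g) v.
  exact: (etrans (pairing_comb _ _ _ (pairing_form dth dv3 Lv))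
    (congr1 (fun x => _ - pairing x v) (esym we))).
rewrite (pairing_conj ddv dv3) e1.
case: (pairing du v) => x y; case: (pairing _ v) => x' y'.
by apply/eqP; rewrite eq_complex /=; apply/andP; split; apply/eqP; ring.
Qed.

End Terms.
End Variation.

(** * Expansions of form-valued functions *)

Section FormJets.
Context {R : realType} {n : nat} {V : normedModType R}.
Local Notation C := R[i].
Local Notation E := (ext R n).
Variable K : set V.
Hypothesis cK : compact K.
Implicit Types (U W : R -> V -> E) (dU dW : V -> E).

Definition ejet U dU := forall S, jet K (fun t z => (U t z S : C)) (fun z => (dU z S : C)).

Lemma ejet_ext U dU dW : ejet U dU -> (forall z, K z -> dU z = dW z) -> ejet U dW.
Proof. by move=> Uj UW S; apply: jet_ext (Uj S) _ => z Kz; rewrite UW. Qed.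

Lemma ejet_eq U dU W : ejet U dU -> (forall t z, U t z = W t z) -> ejet W dU.
Proof. by move=> Uj UW S; apply: jet_eq (Uj S) _ => t z; rewrite UW. Qed.

Lemma ejetD U dU W dW : ejet U dU -> ejet W dW ->
  ejet (fun t z => U t z + W t z) (fun z => dU z + dW z).
Proof.
move=> Uj Wj S; have j := jetD (Uj S) (Wj S).
apply: jet_eq (jet_ext j _) _ => [z _|t z]; first exact: (esym (extDE _ _ _)).
exact: (esym (extDE _ _ _)).
Qed.

Lemma ejetM (f : R -> V -> C) (df : V -> C) U dU : jet K f df -> ejet U dU ->
  ejet (fun t z => f t z *: U t z) (fun z => df z *: U 0 z + f 0 z *: dU z).
Proof.
move=> fj Uj S; have j := jetM fj (Uj S).
apply: jet_eq (jet_ext j _) _ => [z _|t z]; last exact: (esym (extZE _ _ _)).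
by rewrite extDE extZE extZE.
Qed.

Lemma ejet_const (U : E) : ejet (fun _ _ => U) (fun _ => 0).
Proof.
move=> S; have j : jet K (fun _ _ => (U S : C)) (fun _ => 0).
  by apply: jet_continuous => // z _; exact: Ccontinuous_cst.
by apply: jet_ext j _ => z _; exact: (esym (ext0E _)).
Qed.

Lemma ejetZ (c : C) U dU : ejet U dU -> ejet (fun t z => c *: U t z) (fun z => c *: dU z).
Proof.
move=> Uj S; have j := jetZ cK c (Uj S).
apply: jet_eq (jet_ext j _) _ => [z _|t z]; first exact: (esym (extZE _ _ _)).
exact: (esym (extZE _ _ _)).
Qed.

Lemma ejetN U dU : ejet U dU -> ejet (fun t z => - U t z) (fun z => - dU z).
Proof.
move=> Uj S; have j := jetN cK (Uj S).
apply: jet_eq (jet_ext j _) _ => [z _|t z]; first exact: (esym (extNE _ _)).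
exact: (esym (extNE _ _)).
Qed.

Lemma ejet_sum (J : Type) (l : seq J) (F : J -> R -> V -> E) (dF : J -> V -> E) :
  (forall i, ejet (F i) (dF i)) ->
  ejet (fun t z => \sum_(i <- l) F i t z) (fun z => \sum_(i <- l) dF i z).
Proof.
move=> Fj S; have j := jet_sum (P := xpredT) cK l (fun i _ => Fj i S).
apply: jet_eq (jet_ext j _) _ => [z _|t z]; first exact: (esym (ext_sumE _ _ _ _)).
exact: (esym (ext_sumE _ _ _ _)).
Qed.

Lemma ejet_linear (f : {linear E -> E}) U dU :
  ejet U dU -> ejet (fun t z => f (U t z)) (fun z => f (dU z)).
Proof.
move=> Uj.
have fE (x : E) : f x = \sum_S (x S : C) *: f (ebasis S).
  by rewrite {1}(ext_expand x) linear_sum; apply: eq_bigr => S _; exact: linearZ_LR.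
have j := @ejet_sum _ (index_enum {set 'I_(n + n)}) _ _
  (fun S => ejetM (Uj S) (ejet_const (f (ebasis S)))).
apply: ejet_eq (ejet_ext j _) _ => [z _|t z]; last exact: (esym (fE _)).
rewrite fE; apply: eq_bigr => S _; rewrite scaler0; exact: addr0.
Qed.

Lemma ejet_contr s U dU : ejet U dU ->
  ejet (fun t z => contr s (U t z)) (fun z => contr s (dU z)).
Proof. exact: (@ejet_linear (contr s)). Qed.

Lemma ejet_conj U dU : ejet U dU ->
  ejet (fun t z => econj (U t z)) (fun z => econj (dU z)).
Proof.
move=> Uj; have cj : ejet (fun t z => conj_coef (U t z)) (fun z => conj_coef (dU z)).
  by move=> S; apply: jet_eq (jet_ext (jet_conj (Uj S)) _) _ => [z _|t z]; exact: (esym (ffunE _ _)).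
have j := @ejet_linear (@bar_subst R n) _ _ cj.
by apply: ejet_eq (ejet_ext j _) _ => [z _|t z]; exact: (esym (econjE _)).
Qed.

Lemma ejet_wedge U dU W dW : ejet U dU -> ejet W dW ->
  ejet (fun t z => wedge (U t z) (W t z))
       (fun z => wedge (dU z) (W 0 z) + wedge (U 0 z) (dW z)).
Proof.
move=> Uj Wj S.
have j := jet_sum (P := fun A => A \subset S) cK (index_enum {set 'I_(n + n)})
  (fun A _ => jetZ cK (shuffle_sign A (S :\: A)) (jetM (Uj A) (Wj (S :\: A)))).
apply: jet_eq (jet_ext j _) _ => [z _|t z]; last exact: (esym (wedgeE _ _ _)).
rewrite extDE wedgeE wedgeE -big_split; apply: eq_bigr => A _ /=; exact: mulrDr.
Qed.

Lemma ejet_affine (a b : V -> E) :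
  (forall z, K z -> forall S, Ccontinuous_at (fun y => (a y S : C)) z) ->
  (forall z, K z -> forall S, Ccontinuous_at (fun y => (b y S : C)) z) ->
  ejet (fun t z => a z + t%:C *: b z) b.
Proof.
move=> ac bc S; have j := @jet_affine _ _ _ cK (fun y => (a y S : C)) (fun y => (b y S : C))
  (fun z Kz => ac z Kz S) (fun z Kz => bc z Kz S).
by apply: jet_eq j _ => t z; rewrite extDE extZE.
Qed.

Lemma ejet_cst (a : V -> E) :
  (forall z, K z -> forall S, Ccontinuous_at (fun y => (a y S : C)) z) ->
  ejet (fun _ => a) (fun _ => 0).
Proof.
move=> ac S; have j := @jet_continuous _ _ _ cK (fun y => (a y S : C)) (fun z Kz => ac z Kz S).
by apply: jet_ext j _ => z _; exact: (esym (ext0E _)).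
Qed.

Lemma jet_density U dU : ejet U dU ->
  jet K (fun t z => density (U t z)) (fun z => density (dU z)).
Proof.
move=> Uj; have j := jetZ cK (@vol R n finset.setT : C)^-1 (Uj finset.setT).
apply: jet_eq (jet_ext j _) _ => [z _|t z]; exact: mulrC.
Qed.

(** Used on families constant in [t]: the closure rules for expansions then also prove continuity of
    the integrands. *)
Lemma jet_continuous0 (f : R -> V -> C) df : jet K f df ->
  forall z, K z -> Ccontinuous_at (f 0) z.
Proof. by move=> [M /nbhs_singleton fM] z /fM[]. Qed.

(* The exponent of [divpow] is an integer so that [m - 1] is a negative integer, and
   the derivative zero, when [m = 0]. *)
Lemma ejet_divpow U dU (m : nat) : (forall z, K z -> is_type 1 1 (U 0 z)) ->
  ejet U dU ->
  ejet (fun t z => divpow (U t z) m)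
       (fun z => wedge (dU z) (divpow (U 0 z) (m%:Z - 1))).
Proof.
move=> U11 Uj; elim: m => [|m IH].
  apply: ejet_eq (ejet_ext (ejet_const ext1) _) _ => [z _|t z]; last exact: (esym (divpow0 _)).
  exact: (esym (wedge0r _)).
have m0 : (m.+1%:R : C) != 0 by rewrite pnatr_eq0.
have j := ejetZ (m.+1%:R)^-1 (ejet_wedge Uj IH).
apply: ejet_eq (ejet_ext j _) _ => [z Kz|t z]; last first.
  by rewrite divpowS scalerA mulVf // scale1r.
have -> : m.+1%:Z - 1 = m by rewrite -addn1 PoszD addrK.
rewrite wedgeA (wedge_even _ (hat_form (U11 z Kz))) -wedgeA.
case: m m0 {IH j} => [|m] m0.
  by rewrite (wedge0r (U 0 z)) (wedge0r (dU z)) addr0 invr1 scale1r.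
have -> : m.+1%:Z - 1 = m by rewrite -addn1 PoszD addrK.
rewrite divpowS wedgeZr -{1}[wedge (dU z) (divpow _ m.+1)]scale1r -scalerDl.
by rewrite nat1r scalerA mulVf // scale1r.
Qed.

(* [Lam] with the inverse matrix expanded by Cramer's rule: a rational expression in
   the coefficients, whereas [Lambda] and [prim] are given by a choice operator. *)
Definition Lamf (w u : E) : E := - \sum_a \sum_b
  ('i * ((\det (herm_mx w))^-1 * (\adj (herm_mx w)) b a)) *:
    contr (rshift n b) (contr (lshift n a) u).

Lemma LamfE w u : herm_mx w \in unitmx -> Lamf w u = Lam w u.
Proof.
move=> wu; rewrite /Lamf /Lam; congr (- _); apply: eq_bigr => a _.
rewrite J_lshift; apply: eq_bigr => b _; congr (_ *: _); congr (_ * _).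
by rewrite /invmx wu [RHS]mxE.
Qed.

Lemma jet_herm U dU : ejet U dU -> forall a b : 'I_n,
  exists df, jet K (fun t z => herm_mx (U t z) a b) df.
Proof.
move=> Uj a b; eexists.
apply: jet_eq (jetZ cK (- 'i) (Uj (lshift n a |: [set rshift n b]))) _ => t z.
by rewrite [RHS]mxE.
Qed.

Lemma jet_herm_inv U dU : ejet U dU -> (forall z, K z -> herm_mx (U 0 z) \in unitmx) ->
  forall a b : 'I_n, exists df, jet K (fun t z =>
    'i * ((\det (herm_mx (U t z)))^-1 * (\adj (herm_mx (U t z))) b a)) df.
Proof.
move=> Uj Uu a b.
have [d1 j1] := jet_det cK (jet_herm Uj).
have j1' := jetV cK j1 (fun z Kz => etrans (esym (unitfE _)) (Uu z Kz)).
have [d2 j2] : exists df, jet K (fun t z =>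
    \det (row' a (col' b (herm_mx (U t z)))) ) df.
  apply: jet_det => // a' b'; have [df j] := jet_herm Uj (lift a a') (lift b b').
  by exists df; apply: jet_eq j _ => t z; rewrite [RHS]mxE [RHS]mxE.
eexists; apply: jet_eq (jetZ cK 'i (jetM j1' (jetZ cK ((-1) ^+ (a + b)) j2))) _ => t z.
by rewrite [in RHS]mxE.
Qed.

(** The derivative is kept abstract. Its degree is all that [pairing_variation] asks of it. *)
Lemma ejet_Lamf W dW U dU : ejet W dW -> ejet U dU ->
  (forall z, K z -> herm_mx (W 0 z) \in unitmx) ->
  (forall z, K z -> is_deg 3 (U 0 z)) -> (forall z, K z -> is_deg 3 (dU z)) ->
  exists2 dL, ejet (fun t z => Lamf (W t z) (U t z)) dL & forall z, K z -> is_deg 1 (dL z).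
Proof.
move=> Wj Uj Wu U3 dU3.
pose cf a b := projT1 (cid (jet_herm_inv Wj Wu a b)).
have cfj a b := projT2 (cid (jet_herm_inv Wj Wu a b)).
have j a b := ejetM (cfj a b) (ejet_contr (rshift n b) (ejet_contr (lshift n a) Uj)).
have J := ejetN (@ejet_sum _ (index_enum 'I_n) _ _
  (fun a => @ejet_sum _ (index_enum 'I_n) _ _ (fun b => j a b))).
exists (fun z => - \sum_a \sum_b (cf a b z *: contr (rshift n b) (contr (lshift n a) (U 0 z)) +
   ('i * ((\det (herm_mx (W 0 z)))^-1 * (\adj (herm_mx (W 0 z))) b a)) *:
    contr (rshift n b) (contr (lshift n a) (dU z)))); first exact: J.
move=> z Kz; apply/is_degN/is_deg_sum => a _; apply/is_deg_sum => b _; apply: is_degD.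
  by apply/is_degZ/is_deg_contr/is_deg_contr/U3.
by apply/is_degZ/is_deg_contr/is_deg_contr/dU3.
Qed.

Definition primf (w u : E) : E := u - (n.-1%:R)^-1 *: wedge w (Lamf w u).

End FormJets.

(** * Expansion of the integrand *)

Section VariationJet.
Context {R : realType} {n : nat} {V : normedModType R}.
Local Notation C := R[i].
Local Notation E := (ext R n).
Variable m : nat.
Hypothesis mn : (m + 3)%N = n.

Let n1 : (1 < n)%N. Proof. by rewrite -mn !addnS. Qed.

Lemma primfE (w u : E) : is_type 1 1 w -> econj w = w -> herm_mx w \in unitmx ->
  is_deg 3 u -> primf w u = prim w u.
Proof.
move=> w11 wr wu du; rewrite /primf LamfE //; exact: (esym (primE w11 wr wu du n1)).
Qed.

Definition energy (w v : E) : C :=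
  density ('i *: wedge (wedge v (econj v)) (divpow w m)).

Variable K : set V.
Hypothesis cK : compact K.
Variables a g u du : V -> E.
Local Notation ccont f := (forall z, K z -> forall S, Ccontinuous_at (fun y => (f y S : C)) z).
Hypotheses (a_cont : ccont a) (g_cont : ccont g) (u_cont : ccont u) (du_cont : ccont du).
Hypothesis a11 : forall z, K z -> is_type 1 1 (a z).
Hypothesis a_real : forall z, K z -> econj (a z) = a z.
Hypothesis a_unit : forall z, K z -> herm_mx (a z) \in unitmx.
Hypothesis g11 : forall z, K z -> is_type 1 1 (g z).
Hypothesis u12 : forall z, K z -> is_type 1 2 (u z).
Hypothesis du12 : forall z, K z -> is_type 1 2 (du z).

Let c : C := (n.-1%:R)^-1.
Let W t z := a z + t%:C *: g z.
Let U t z := u z + t%:C *: du z.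
Let v z := primf (a z) (u z).

(** The three densities of the variation, written with [primf] and [Lamf] so that they are visibly
    rational in continuous coefficients. *)
Definition var_metric z : C :=
  density ('i *: wedge (wedge (wedge (v z) (econj (v z))) (g z)) (divpow (a z) (m%:Z - 1))).
Definition var_delbar z : C := ((pairing (a z) m (du z) (v z))^*)%R.
Definition var_lee z : C := pairing (a z) m (wedge (c *: Lamf (a z) (u z)) (g z)) (v z).

Let W0 z : W 0 z = a z.
Proof. by rewrite /W -[RHS]addr0; congr (_ + _); exact: scale0r. Qed.
Let U0 z : U 0 z = u z.
Proof. by rewrite /U -[RHS]addr0; congr (_ + _); exact: scale0r. Qed.
Let u3 z : K z -> is_deg 3 (u z). Proof. by move=> Kz; exact: (is_type_deg (u12 Kz)). Qed.
Let du3 z : K z -> is_deg 3 (du z). Proof. by move=> Kz; exact: (is_type_deg (du12 Kz)). Qed.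

Let jW : ejet K W g. Proof. exact: ejet_affine. Qed.
Let jU : ejet K U du. Proof. exact: ejet_affine. Qed.

Let Lam_jet : exists2 dL, ejet K (fun t z => Lamf (W t z) (U t z)) dL &
  forall z, K z -> is_deg 1 (dL z).
Proof.
apply: (ejet_Lamf cK jW jU) => z Kz; rewrite ?W0 ?U0; [exact: a_unit|exact: u3|exact: du3].
Qed.

Lemma energy_jet : jet K (fun t z => energy (W t z) (primf (W t z) (U t z)))
  (fun z => var_metric z + 2 * (complex.Re (var_delbar z))%:C
            - 2 * (complex.Re (var_lee z))%:C).
Proof.
have [dL jL dL1] := Lam_jet.
have jv := ejetD jU (ejetN cK (ejetZ cK c (ejet_wedge cK jW jL))).
have a110 z : K z -> is_type 1 1 (W 0 z) by rewrite W0; exact: a11.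
have j := jet_density cK (ejetZ cK 'i (ejet_wedge cK
   (ejet_wedge cK jv (ejet_conj cK jv)) (ejet_divpow cK m a110 jW))).
apply: jet_ext j _ => z Kz; rewrite W0 U0.
set v0 := u z - _; set dv := du z - _.
have v0E : v0 = v z by [].
rewrite {}v0E wedgeDl scalerDr scalerDr densityD densityD.
have e1 := pairingE m (a11 Kz) dv (v z); have e2 := pairingE m (a11 Kz) (v z) dv.
have pE : v z = prim (a z) (u z).
  by apply: primfE; [exact: a11|exact: a_real|exact: a_unit|exact: u3].
have LE : Lamf (a z) (u z) = Lam (a z) (u z) by apply: LamfE; exact: a_unit.
(* The two terms where the derivative falls on v or on its conjugate are evaluated together, the
   unknown [dL z] dropping out. *)
have pv := pairing_variation (a11 Kz) (a_real Kz) (a_unit Kz) mn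
  (g11 Kz) (u12 Kz) (du12 Kz) (dL1 z Kz).
rewrite /= -pE -LE in pv.
have e3 : density ('i *: wedge (wedge (v z) (econj (v z)))
    (wedge (g z) (divpow (a z) (m%:Z - 1)))) = var_metric z.
  exact: (congr1 (fun x => density ('i *: x)) (wedgeA _ _ _)).
apply: (etrans (congr2 +%R (etrans (esym (congr2 +%R e1 e2)) pv) e3)).
by rewrite addrC addrA.
Qed.

Let jv0 : exists dv, ejet K (fun _ => v) dv.
Proof.
have [dL jL _] : exists2 dL, ejet K (fun _ z => Lamf (a z) (u z)) dL &
    forall z, K z -> is_deg 1 (dL z).
  apply: (ejet_Lamf cK (ejet_cst cK a_cont) (ejet_cst cK u_cont)) => z Kz.
  - exact: a_unit.
  - exact: u3.
  - exact: is_deg0.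
by eexists; exact: (ejetD (ejet_cst cK u_cont)
  (ejetN cK (ejetZ cK c (ejet_wedge cK (ejet_cst cK a_cont) jL)))).
Qed.

Let jdiv : forall k : int, exists dw, ejet K (fun _ z => divpow (a z) k) dw.
Proof.
case=> k; last by exists (fun _ => 0); exact: (ejet_const cK 0).
by eexists; exact: (ejet_divpow cK k a11 (ejet_cst cK a_cont)).
Qed.

Lemma var_metric_cont z : K z -> Ccontinuous_at var_metric z.
Proof.
have [dv jv] := jv0; have [dw jw] := jdiv (m%:Z - 1).
exact: (jet_continuous0 (jet_density cK (ejetZ cK 'i (ejet_wedge cK (ejet_wedge cK
  (ejet_wedge cK jv (ejet_conj cK jv)) (ejet_cst cK g_cont)) jw)))).
Qed.

Let pairing_cont (b : V -> E) db z : ejet K (fun _ => b) db -> K z ->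
  Ccontinuous_at (fun z => pairing (a z) m (b z) (v z)) z.
Proof.
move=> jb; have [dv jv] := jv0; have [dw jw] := jdiv m.
exact: (jet_continuous0 (jet_density cK (ejetZ cK 'i (ejet_wedge cK jb
  (ejet_wedge cK jw (ejet_conj cK jv)))))).
Qed.

Lemma var_delbar_cont z : K z -> Ccontinuous_at var_delbar z.
Proof. by move=> Kz; apply/Ccontinuous_conj/(pairing_cont (ejet_cst cK du_cont)). Qed.

Lemma var_lee_cont z : K z -> Ccontinuous_at var_lee z.
Proof.
have [dL jL _] : exists2 dL, ejet K (fun _ z => Lamf (a z) (u z)) dL &
    forall z, K z -> is_deg 1 (dL z).
  apply: (ejet_Lamf cK (ejet_cst cK a_cont) (ejet_cst cK u_cont)) => y Ky.
  - exact: a_unit.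
  - exact: u3.
  - exact: is_deg0.
exact: (pairing_cont (ejet_wedge cK (ejetZ cK c jL) (ejet_cst cK g_cont))).
Qed.

(** For nonzero [t] the choice in [prim] is resolved by [primfE], which needs omega + t gamma
    invertible. Applying [jet_neq0] to the determinant provides this for all points of [K] at
    once. *)
Lemma primf_near : \forall t \near (0 : R), forall z, K z ->
  econj (g z) = g z -> is_deg 3 (U t z) -> primf (W t z) (U t z) = prim (W t z) (U t z).
Proof.
have [df j] := jet_det cK (jet_herm cK jW).
have d0 z : K z -> \det (herm_mx (W 0 z)) != 0.
  by move=> Kz; rewrite W0 -unitfE; exact: a_unit.
have [B] := jet_neq0 cK j d0; apply: filterS => t ht z Kz gr dU.
apply: primfE => //.
- by apply: is_typeD; [exact: a11|apply: is_typeZ; exact: g11].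
- rewrite econjD econjZ gr (a_real Kz); congr (_ + _ *: _).
  by have := conjc_real t.
- by rewrite unitmxE unitfE; have [] := ht z Kz.
Qed.

End VariationJet.

(** * Globalisation *)

Section LocalDolbeault.
Context {R : realType} {n : nat}.
Local Open Scope classical_set_scope.
Local Open Scope ring_scope.
Local Notation C := R[i].
Local Notation E := (ext R n).
Local Notation pt := 'rV[R]_(n + n).
Variable V : set pt.
Hypothesis V_open : open V.
Implicit Types (e f : pt -> E).

Lemma CderiveDZ (f g : pt -> C) (t : R) z v : Cderivable f z v -> Cderivable g z v ->
  Cderive (fun y => f y + t%:C * g y) z v = Cderive f z v + t%:C * Cderive g z v.
Proof.
move=> [fr fi] [gr gi]; rewrite /Cderive.
have -> : (fun y => complex.Re (f y + t%:C * g y)) =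
    (fun y => complex.Re (f y)) + (t \*: (fun y => complex.Re (g y))).
  apply/funext => y; rewrite -[RHS]/(complex.Re (f y) + t * complex.Re (g y)).
  by case: (f y) (g y) => a b [c d] /=; rewrite mul0r subr0.
have -> : (fun y => complex.Im (f y + t%:C * g y)) =
    (fun y => complex.Im (f y)) + (t \*: (fun y => complex.Im (g y))).
  apply/funext => y; rewrite -[RHS]/(complex.Im (f y) + t * complex.Im (g y)).
  by case: (f y) (g y) => a b [c d] /=; rewrite mul0r addr0.
have comb (h k : pt -> R) : derivable h z v -> derivable k z v ->
    'D_v (h + t \*: k) z = 'D_v h z + t * 'D_v k z.
  by move=> dh dk; rewrite (deriveD dh (@derivableZ _ _ _ k t z v dk)) (@deriveZ _ _ _ k t z v dk).
rewrite (comb _ _ fr gr) (comb _ _ fi gi).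
by apply/eqP; rewrite eq_complex /= !mul0r subr0 addr0 !eqxx.
Qed.

Lemma Cderive_near0 (f : pt -> C) z v : v != 0 -> (\forall y \near z, f y = 0) -> Cderive f z v = 0.
Proof.
move=> v0 f0; rewrite /Cderive.
rewrite (@near_eq_derive _ _ _ _ (cst 0)) //; last by apply: filterS f0 => y ->.
rewrite [X in _ +i* X](@near_eq_derive _ _ _ _ (cst 0)) //; last by apply: filterS f0 => y ->.
by rewrite !derive_cst.
Qed.

Definition dcoef (D : (pt -> C) -> pt -> C) e z : E := [ffun S => D (fun y => e y S) z].
Definition ldelbar e z : E :=
  \sum_(b < n) wedge (gen (rshift n b)) (dcoef (@d_dzbar R n b) e z).
Definition ldel e z : E :=
  \sum_(b < n) wedge (gen (lshift n b)) (dcoef (@d_dz R n b) e z).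

Definition smooth_coef e := forall S, smooth_on V (fun z => (e z S : C)).

Lemma dcoefE D e z S : dcoef D e z S = D (fun y => e y S) z.
Proof. exact: ffunE. Qed.

Lemma smooth_coef_cont e : smooth_coef e -> forall z, V z ->
  forall S, Ccontinuous_at (fun y => (e y S : C)) z.
Proof. by move=> es z Vz S; have [+ _] := es S 0%N; apply. Qed.

Lemma ldelbarDZ (t : R) e f z : V z -> smooth_coef e -> smooth_coef f ->
  ldelbar (fun y => e y + t%:C *: f y) z = ldelbar e z + t%:C *: ldelbar f z.
Proof.
move=> Vz es fs; rewrite /ldelbar scaler_sumr -big_split; apply: eq_bigr => b _ /=.
rewrite -wedgeZr -wedgeDr; congr wedge; apply/ffunP => S.
rewrite extDE extZE !dcoefE /d_dzbar.
have -> : (fun y => ((e y + t%:C *: f y) S : C)) = (fun y => e y S + t%:C * f y S).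
  by apply/funext => y; rewrite extDE extZE.
have [_ eS] := es S 1%N; have [_ fS] := fs S 1%N.
have dZ (s : 'I_(n + n)) : Cderive (fun y => (e y S + t%:C * f y S : C)) z (delta_mx 0 s) =
    Cderive (fun y => (e y S : C)) z (delta_mx 0 s) +
    t%:C * Cderive (fun y => (f y S : C)) z (delta_mx 0 s).
  by apply: CderiveDZ; [have [d _] := eS s|have [d _] := fS s]; exact: d.
rewrite (dZ (lshift n b)) (dZ (rshift n b)).
have comb (F : comNzRingType) (x y x' y' s i h : F) :
  (x + s * y + i * (x' + s * y')) * h = (x + i * x') * h + s * ((y + i * y') * h) by ring.
exact: comb.
Qed.

Lemma ldelbar_cont e z : V z -> smooth_coef e ->
  forall S, Ccontinuous_at (fun y => (ldelbar e y S : C)) z.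
Proof.
move=> Vz es S.
(* Over the compact set consisting of [z] alone, an expansion constant in the parameter is
   continuity at [z]. *)
have cz := @compact_set1 _ z.
have j b : ejet [set z] (fun _ y => dcoef (@d_dzbar R n b) e y) (fun _ => 0).
  apply: ejet_cst => // y -> T.
  have [_ eT] := es T 1%N.
  have [_ [c1 _]] := eT (lshift n b); have [_ [c2 _]] := eT (rshift n b).
  apply: (@Ccontinuous_near _ _ (fun y => (Cderive (fun y => (e y T : C)) y (delta_mx 0 (lshift n b))
   + 'i * Cderive (fun y => (e y T : C)) y (delta_mx 0 (rshift n b))) * 2^-1)).
    by apply: filterE => x; rewrite dcoefE.
  apply: CcontinuousM; last exact: Ccontinuous_cst.
  apply: CcontinuousD; first exact: c1.
  by apply: CcontinuousM; [exact: Ccontinuous_cst|exact: c2].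
exact: (jet_continuous0 (ejet_sum cz (index_enum 'I_n) (fun b =>
  ejet_wedge cz (ejet_const cz (gen (rshift n b))) (j b)) S) (erefl z)).
Qed.

(** A coefficient outside the type vanishes on the open set [V], hence so do its partial
    derivatives. The combination [cf] covers both d/dz and d/dzbar. *)
Lemma dcoef_type (cf : C -> C -> C) (cf0 : cf 0 0 = 0) (b : 'I_n) p q e z :
  V z -> (forall y, V y -> is_type p q (e y)) ->
  is_type p q (dcoef (fun h y => cf (Cderive h y (delta_mx 0 (lshift n b)))
     (Cderive h y (delta_mx 0 (rshift n b)))) e z).
Proof.
move=> Vz tp; apply/is_typeP => S Spq; rewrite dcoefE.
have d0 (s : 'I_(n + n)) : (delta_mx 0 s : pt) != 0.
  by apply/eqP => /matrixP/(_ 0 s)/eqP; rewrite !mxE !eqxx oner_eq0.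
have e0 : \forall y \near z, (e y S : C) = 0.
  have := open_nbhs_nbhs (conj V_open Vz); apply: filterS => y /tp ty.
  exact: (proj1 (is_typeP _ _ _) ty S Spq).
by rewrite !Cderive_near0.
Qed.

Lemma ldelbar_type e z : V z -> (forall y, V y -> is_type 1 1 (e y)) -> is_type 1 2 (ldelbar e z).
Proof.
move=> Vz te; apply: is_type_sum => b _.
have td : is_type 1 1 (dcoef (@d_dzbar R n b) e z).
  by apply: (@dcoef_type (fun x y => (x + 'i * y) / 2)) => //; rewrite mulr0 addr0 mul0r.
exact: (is_type_wedge (@is_type_genr _ _ b) td).
Qed.

Lemma ldel_type e z : V z -> (forall y, V y -> is_type 1 1 (e y)) -> is_type 2 1 (ldel e z).
Proof.
move=> Vz te; apply: is_type_sum => b _.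
have td : is_type 1 1 (dcoef (@d_dz R n b) e z).
  by apply: (@dcoef_type (fun x y => (x - 'i * y) / 2)) => //; rewrite mulr0 subr0 mul0r.
exact: (is_type_wedge (@is_type_genl _ _ b) td).
Qed.

End LocalDolbeault.

(** * Summing over the charts of a partition of unity *)

Section Assembly.
Context {R : realType} {n : nat}.
Local Open Scope classical_set_scope.
Local Open Scope complex_scope.
Local Open Scope ring_scope.
Local Notation C := R[i].
Local Notation E := (ext R n).
Local Notation pt := 'rV[R]_(n + n).
Variable X : complexManifold R n.
Hypothesis X_compact : compact [set: X].
Hypothesis n3 : (3 <= n)%N.

Lemma Ccontinuous_Re (f : pt -> C) z : Ccontinuous_at f z ->
  Ccontinuous_at (fun y => 2 * (complex.Re (f y))%:C) z.
Proof.
move=> fc; apply: Ccontinuous_near (CcontinuousD fc (Ccontinuous_conj fc)).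
apply: filterE => y; case: (f y) => a b.
by apply/eqP; rewrite eq_complex /=; apply/andP; split; apply/eqP; ring.
Qed.

Definition loc (i : chart_index X) (eta : diff_form X) (z : pt) : E := eta i (chart_inv i z).

Lemma chart_invP (i : chart_index X) z : chart_img i z ->
  chart_dom i (chart_inv i z) /\ chart i (chart_inv i z) = z.
Proof. by move=> [x dx <-]; rewrite chartK. Qed.

Lemma loc_delbar i (eta : diff_form X) z : chart_img i z ->
  delbar eta i (chart_inv i z) = ldelbar (loc i eta) z.
Proof. by move=> /chart_invP[_ cz]; rewrite /delbar cz. Qed.

Lemma loc_del i (eta : diff_form X) z : chart_img i z ->
  del eta i (chart_inv i z) = ldel (loc i eta) z.
Proof. by move=> /chart_invP[_ cz]; rewrite /del cz. Qed.

Lemma loc_smooth i (eta : diff_form X) : smooth_form eta ->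
  smooth_coef (chart_img i) (loc i eta).
Proof. by move=> [_ es] S; exact: es. Qed.

Variable P : partition_of_unity X.

Section Patch.
Variable k : 'I_(pu_size P).
Let i := pu_chart k.
Let V : set pt := chart_img i.
Let K : set pt := chart i @` closure [set x | pu_fun k x != 0].
Let rho (z : pt) : R := pu_fun k (chart_inv i z).

Lemma patch_sub : K `<=` V.
Proof. by move=> z [x /(@pu_supp _ _ _ P k) dx <-]; exists x. Qed.

Lemma patch_compact : compact K.
Proof.
apply: continuous_compact.
  by apply: (continuous_subspaceW (@pu_supp _ _ _ P k)); exact: chart_continuous.
by apply: (subclosed_compact _ X_compact) => //; exact: closed_closure.
Qed.

Lemma patch_supp z : V z -> rho z != 0 -> K z.
Proof.
move=> /chart_invP[dx cz] rz; exists (chart_inv i z) => //.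
exact: subset_closure.
Qed.

Lemma patch_cont z : V z -> Ccontinuous_at (fun y => (rho y)%:C) z.
Proof. by have [+ _] := @pu_smooth _ _ _ P k i 0%N; apply. Qed.

Definition patch_int (f : pt -> C) : C := cutoff_int V rho f.

Lemma patch_int_eq (f g : pt -> C) : (forall z, K z -> f z = g z) -> patch_int f = patch_int g.
Proof. by move=> fg; rewrite /patch_int /cutoff_int (cutoff_eq patch_supp fg). Qed.

End Patch.

Lemma integralXE (eta : diff_form X) :
  integralX P eta = \sum_k patch_int k (fun z => density (loc (pu_chart k) eta z)).
Proof. by []. Qed.

Lemma integralX_comb (A B D : diff_form X) :
  integralX P A + 2 * (complex.Re (integralX P B))%:C - 2 * (complex.Re (integralX P D))%:C =
  \sum_k (patch_int k (fun z => density (loc (pu_chart k) A z))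
    + 2 * (complex.Re (patch_int k (fun z => density (loc (pu_chart k) B z))))%:C
    - 2 * (complex.Re (patch_int k (fun z => density (loc (pu_chart k) D z))))%:C).
Proof.
have Re_sum (F : 'I_(pu_size P) -> C) :
    2 * (complex.Re (\sum_k F k))%:C = \sum_k 2 * (complex.Re (F k))%:C.
  rewrite -mulr_sumr; congr (2 * _).
  by elim/big_rec2: _ => [//|k y x _ <-]; case: (F k) x => p q [p' q']; apply/eqP;
     rewrite eq_complex /= addr0 !eqxx.
rewrite (integralXE A) (integralXE B) (integralXE D) sumrB big_split /=.
by rewrite (Re_sum (fun k => patch_int k (fun z => density (loc (pu_chart k) B z))))
  (Re_sum (fun k => patch_int k (fun z => density (loc (pu_chart k) D z)))).
Qed.

Let m := (n - 3)%N.
Let mn : (m + 3)%N = n. Proof. exact: subnK. Qed.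

Let int_n3 : n%:Z - 3 = m%:Z :> int.
Proof. by rewrite -[in LHS]mn PoszD addrK. Qed.

(** For n = 3 this integer is -1, where [divpow] is zero and the first term of the variation
    disappears. *)
Let int_n4 : n%:Z - 4 = m%:Z - 1 :> int.
Proof. by rewrite -int_n3 -addrA -opprD. Qed.

Section Metric.
Variables omega gamma : diff_form X.
Hypothesis omega_herm : hermitian_metric omega.
Hypothesis gamma11 : real11_form gamma.

Section Local.
Variable k : 'I_(pu_size P).
Let i := pu_chart k.
Let V : set pt := chart_img i.
Let K : set pt := chart i @` closure [set x | pu_fun k x != 0].
Let a := loc i omega.
Let g := loc i gamma.
Let u := ldelbar a.
Let du := ldelbar g.

Let a11 z : V z -> is_type 1 1 (a z).
Proof. by move=> /chart_invP[dz _]; have [[_ t11 _] _] := omega_herm; exact: t11. Qed.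
Let g11 z : V z -> is_type 1 1 (g z).
Proof. by move=> /chart_invP[dz _]; have [_ t11 _] := gamma11; exact: t11. Qed.
Let a_real z : V z -> econj (a z) = a z.
Proof. by move=> /chart_invP[dz _]; have [[_ _ r] _] := omega_herm; exact: r. Qed.
Let g_real z : V z -> econj (g z) = g z.
Proof. by move=> /chart_invP[dz _]; have [_ _ r] := gamma11; exact: r. Qed.
Let a_pos z : V z -> posdef (a z).
Proof. by move=> /chart_invP[dz _]; have [_ p] := omega_herm; exact: p. Qed.
Let a_smooth : smooth_coef V a.
Proof. by have [[s _ _] _] := omega_herm; exact: loc_smooth. Qed.
Let g_smooth : smooth_coef V g.
Proof. by have [s _ _] := gamma11; exact: loc_smooth. Qed.
Let Vo : open V. Proof. exact: chart_img_open. Qed.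
Let a_unit z : V z -> herm_mx (a z) \in unitmx.
Proof. by move=> Vz; exact: (posdef_unit (a_pos Vz)). Qed.
Let u12 z : V z -> is_type 1 2 (u z).
Proof. by move=> Vz; exact: (ldelbar_type Vo Vz a11). Qed.
Let du12 z : V z -> is_type 1 2 (du z).
Proof. by move=> Vz; exact: (ldelbar_type Vo Vz g11). Qed.
Let ut z : V z -> is_type 2 1 (ldel a z).
Proof. by move=> Vz; exact: (ldel_type Vo Vz a11). Qed.

Lemma patch_energy_ge0 : 0 <= patch_int k (fun z =>
  energy m (a z) (prim (a z) (delbar omega i (chart_inv i z)))).
Proof.
apply: cutoff_int_ge0 => z Vz; first exact: pu_ge0.
rewrite (loc_delbar omega Vz) /energy -(pairingE m (a11 Vz)).
exact: (pairing_prim_ge0 (a11 Vz) (a_real Vz) (a_unit Vz) mn (u12 Vz) (a_pos Vz)).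
Qed.

Let vm := var_metric m a g u.
Let vd := var_delbar m a u du.
Let vl := var_lee m a g u.

Let KV : K `<=` V. Proof. exact: patch_sub. Qed.
Let cK : compact K. Proof. exact: patch_compact. Qed.

Lemma patch_variation : cquad (fun t : R => patch_int k (fun z =>
    energy m (a z + t%:C *: g z)
      (prim (a z + t%:C *: g z)
        (delbar (fadd omega (fscale t%:C gamma)) i (chart_inv i z)))))
  (patch_int k vm + 2 * (complex.Re (patch_int k vd))%:C
     - 2 * (complex.Re (patch_int k vl))%:C).
Proof.
have ac z : K z -> forall S, Ccontinuous_at (fun y => (a y S : C)) z.
  by move=> Kz; exact: (smooth_coef_cont a_smooth (KV Kz)).
have gc z : K z -> forall S, Ccontinuous_at (fun y => (g y S : C)) z.
  by move=> Kz; exact: (smooth_coef_cont g_smooth (KV Kz)).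
have uc z : K z -> forall S, Ccontinuous_at (fun y => (u y S : C)) z.
  by move=> Kz; exact: (ldelbar_cont (KV Kz) a_smooth).
have duc z : K z -> forall S, Ccontinuous_at (fun y => (du y S : C)) z.
  by move=> Kz; exact: (ldelbar_cont (KV Kz) g_smooth).
have aK z (Kz : K z) := a11 (KV Kz); have gK z (Kz : K z) := g11 (KV Kz).
have arK z (Kz : K z) := a_real (KV Kz); have auK z (Kz : K z) := a_unit (KV Kz).
have uK z (Kz : K z) := u12 (KV Kz); have duK z (Kz : K z) := du12 (KV Kz).
have j := energy_jet mn cK ac gc uc duc aK arK auK gK uK duK.
have cm := var_metric_cont m cK ac gc uc aK auK uK.
have cd := var_delbar_cont m cK ac uc duc aK auK uK.
have cl := var_lee_cont m cK ac gc uc aK auK uK.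
have sup := @patch_supp k; have rc := @patch_cont k.
pose h z : C := vm z + 2 * (complex.Re (vd z))%:C - 2 * (complex.Re (vl z))%:C.
have hc z : K z -> Ccontinuous_at h z.
  move=> Kz; apply: CcontinuousD.
    by apply: CcontinuousD; [exact: cm|exact/Ccontinuous_Re/cd].
  have c1 : Ccontinuous_at (fun _ : pt => -1 : C) z by exact: Ccontinuous_cst.
  have := CcontinuousM c1 (Ccontinuous_Re (cl z Kz)).
  by apply: Ccontinuous_near; apply: filterE => y; exact: mulN1r.
have <- : patch_int k h = patch_int k vm + 2 * (complex.Re (patch_int k vd))%:C
     - 2 * (complex.Re (patch_int k vl))%:C.
  exact: (cutoff_int_linear Vo cK KV sup rc cm cd cl).
have q := cutoff_int_quad Vo cK KV sup rc j hc (fun _ _ => erefl).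
(* The expansion was obtained for [primf]; for small [t] it is the same function of [t] as the one
   built from [prim]. *)
apply: cquad_near q.
have pn := primf_near mn cK u du ac gc aK arK auK gK.
apply: filterS pn => t ht; apply: patch_int_eq => z Kz.
have Vz := KV Kz.
have dE : delbar (fadd omega (fscale t%:C gamma)) i (chart_inv i z) = u z + t%:C *: du z.
  by rewrite (loc_delbar _ Vz); exact: (ldelbarDZ t Vz a_smooth g_smooth).
have d3 : is_deg 3 (u z + t%:C *: du z).
  apply: (@is_degD _ _ 3); first exact: (is_type_deg (u12 Vz)).
  by apply: (@is_degZ _ _ 3); exact: (is_type_deg (du12 Vz)).
by rewrite dE -(ht z Kz (g_real Vz) d3).
Qed.

Let pE z : K z -> primf (a z) (u z) = prim (a z) (delbar omega i (chart_inv i z)).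
Proof.
move=> Kz; have Vz := KV Kz; rewrite (loc_delbar _ Vz).
exact: (primfE mn (a11 Vz) (a_real Vz) (a_unit Vz) (is_type_deg (u12 Vz))).
Qed.

Lemma patch_metric : patch_int k vm = patch_int k (fun z => density (loc i
  (fscale 'i (fwedge (fwedge (fwedge (fprim omega (delbar omega))
     (fconj (fprim omega (delbar omega)))) gamma) (fdivpow omega (n%:Z - 4)))) z)).
Proof.
apply: patch_int_eq => z Kz; rewrite int_n4 /vm /var_metric (pE Kz).
by [].
Qed.

Lemma patch_delbar : patch_int k vd = patch_int k (fun z => density (loc i
  (fun j x => inner (omega j x) (fprim omega (delbar omega) j x)
     (fprim omega (delbar gamma) j x) *: divpow (omega j x) n%:Z) z)).
Proof.
apply: patch_int_eq => z Kz; have Vz := KV Kz.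
rewrite /vd /var_delbar (pE Kz) (loc_delbar _ Vz).
rewrite -(inner_prim_pairing (a11 Vz) (a_real Vz) (a_unit Vz) mn (u12 Vz) (du12 Vz)).
rewrite [RHS]densityZ /fprim (loc_delbar omega Vz) (loc_delbar gamma Vz).
by [].
Qed.

Lemma patch_lee : patch_int k vl = patch_int k (fun z => density (loc i
  (fun j x => inner (omega j x) (fwedge (lee_form01 omega) gamma j x)
     (fprim omega (delbar omega) j x) *: divpow (omega j x) n%:Z) z)).
Proof.
apply: patch_int_eq => z Kz; have Vz := KV Kz.
rewrite /vl /var_lee (LamfE _ (a_unit Vz)) (pE Kz) (loc_delbar _ Vz).
rewrite -(lee01_pairing (a11 Vz) (a_real Vz) (a_unit Vz) mn (g11 Vz) (u12 Vz) (ut Vz)).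
rewrite [RHS]densityZ /fprim /fwedge /lee_form01 /ftype_part /lee_form /fscale /fLambda.
rewrite /ext_d /fadd (loc_delbar omega Vz) (loc_del omega Vz).
by [].
Qed.

Lemma patch_energy_variation : cquad
  (fun t : R => let omega_t := fadd omega (fscale t%:C gamma) in
     let v_t := fprim omega_t (delbar omega_t) in
     patch_int k (fun z => density (loc i
       (fscale 'i (fwedge (fwedge v_t (fconj v_t)) (fdivpow omega_t m%:Z))) z)))
  (patch_int k (fun z => density (loc i
      (fscale 'i (fwedge (fwedge (fwedge (fprim omega (delbar omega))
         (fconj (fprim omega (delbar omega)))) gamma) (fdivpow omega (n%:Z - 4)))) z))
   + 2 * (complex.Re (patch_int k (fun z => density (loc i
      (fun j x => inner (omega j x) (fprim omega (delbar omega) j x)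
         (fprim omega (delbar gamma) j x) *: divpow (omega j x) n%:Z) z))))%:C
   - 2 * (complex.Re (patch_int k (fun z => density (loc i
      (fun j x => inner (omega j x) (fwedge (lee_form01 omega) gamma j x)
         (fprim omega (delbar omega) j x) *: divpow (omega j x) n%:Z) z))))%:C).
Proof.
have eq3 I (x y z x' y' z' : C) : x = x' -> y = y' -> z = z' ->
    cquad I (x + 2 * (complex.Re y)%:C - 2 * (complex.Re z)%:C) ->
    cquad I (x' + 2 * (complex.Re y')%:C - 2 * (complex.Re z')%:C) by move=> -> -> ->.
exact: (eq3 _ _ _ _ _ _ _ patch_metric patch_delbar patch_lee patch_variation).
Qed.

End Local.

Lemma functional_L_ge0 : 0 <= functional_L P omega.
Proof.
rewrite /functional_L integralXE int_n3; apply: sumr_ge0 => k _.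
exact: patch_energy_ge0.
Qed.

Lemma functional_L_variation : cquad
  (fun t : R => functional_L P (fadd omega (fscale t%:C gamma)))
  (integralX P (fscale 'i (fwedge (fwedge (fwedge (fprim omega (delbar omega))
       (fconj (fprim omega (delbar omega)))) gamma) (fdivpow omega (n%:Z - 4))))
   + 2 * (complex.Re (innerX P omega (fprim omega (delbar omega))
                                     (fprim omega (delbar gamma))))%:C
   - 2 * (complex.Re (innerX P omega (fwedge (lee_form01 omega) gamma)
                                     (fprim omega (delbar omega))))%:C).
Proof.
rewrite /innerX integralX_comb /functional_L int_n3.
exact: (cquad_sum (index_enum 'I_(pu_size P)) patch_energy_variation).
Qed.

End Metric.
End Assembly.

Local Open Scope classical_set_scope.
Local Open Scope complex_scope.
Local Open Scope ring_scope.

Theorem theorem5p1 (R : realType) (n : nat) (n_ge3 : (3 <= n)%N)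
    (X : complexManifold R n) (X_compact : compact [set: X])
    (P : partition_of_unity X) :
  (forall omega : diff_form X, hermitian_metric omega -> 0 <= functional_L P omega) /\
  (forall omega gamma : diff_form X, hermitian_metric omega -> real11_form gamma ->
     derivable_L P omega gamma /\
     diff_L P omega gamma =
       integralX P
         (fscale 'i
            (fwedge (fwedge (fwedge (fprim omega (delbar omega))
                                    (fconj (fprim omega (delbar omega))))
                            gamma)
                    (fdivpow omega (n%:Z - 4))))
       + 2 * (complex.Re (innerX P omega (fprim omega (delbar omega))
                                 (fprim omega (delbar gamma))))%:C
       - 2 * (complex.Re (innerX P omega (fwedge (lee_form01 omega) gamma)
                                 (fprim omega (delbar omega))))%:C).
Proof.
split=> [omega ho|omega gamma ho hg]; first exact: functional_L_ge0.
exact: (cquad_derive (functional_L_variation X_compact n_ge3 P ho hg)).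
Qed.
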